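(* Let $R$ be a ring. Then the following are equivalent. (1) $R$ is a TAF-ring. (2) $R$ is strongly Laskerian, and for each maximal ideal $M$ of $R$, every $M$-primary ideal of $R$ is comparable to $M^2$ under inclusion. (3) $R$ is a strongly Laskerian locally pseudo-valuation ring. (4) $R$ is a finite-absorbing locally pseudo-valuation ring. (5) $R=R_1\times\cdots\times R_r$, where for each $i\in\{1,\dots,r\}$, $R_i$ is either an atomic pseudo-valuation ring or a Mori locally pseudo-valuation domain.
   Context: All rings are nonzero, commutative and unital (zero divisors allowed). For $n\in\mathbb N$, a proper ideal $I$ of a ring $R$ is $n$-absorbing if whenever $a_1,\dots,a_{n+1}\in R$ and $a_1\cdots a_{n+1}\in I$, there is $i$ with $\prod_{j\neq i}a_j\in I$. A TAF-ring is a ring in which each proper ideal is a finite product of 2-absorbing ideals. $R$ is finite-absorbing if every proper ideal of $R$ is $n$-absorbing for some $n\in\mathbb N$ (depending on the ideal). A ring is Laskerian if each proper ideal is a finite intersection of primary ideals; a Laskerian ring in which each primary ideal contains a power of its radical is strongly Laskerian. A prime ideal $P$ of a ring $R$ is strongly prime if $aP$ and $bR$ are comparable under inclusion for any $a,b\in R$. $R$ is a pseudo-valuation ring (PVR) if some maximal ideal of $R$ is strongly prime. $R$ is a locally pseudo-valuation ring (LPVR) if $R_M$ is a PVR for each maximal ideal $M$ of $R$. A nonunit $a\in R$ is irreducible if for all $b,c\in R$ with $a=bc$, either $aR=bR$ or $aR=cR$. $R$ is atomic if every nonzero nonunit of $R$ is a finite product of irreducible elements. An integral domain $D$ with quotient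 field $K$ is a pseudo-valuation domain (PVD) if every prime ideal $P$ satisfies: $x,y\in K$, $xy\in P$ imply $x\in P$ or $y\in P$. $D$ is a locally pseudo-valuation domain (LPVD) if $D_M$ is a PVD for each maximal ideal $M$. $D$ is Mori if it satisfies the ascending chain condition on divisorial ideals, i.e. ideals $I$ with $D:(D:I)=I$, where $I:J=\{x\in K\mid xJ\subseteq I\}$. *)

(* Defs.v *)
From HB Require Import structures.
From mathcomp Require Import all_boot all_algebra generic_quotient ring.
From mathcomp Require Import boolp classical_sets.

Set Implicit Arguments.
Unset Strict Implicit.
Unset Printing Implicit Defensive.

Import GRing.Theory.

Local Open Scope classical_set_scope.
Local Open Scope ring_scope.

(* Rings are [comNzRingType]s: commutative, unital, with 1 != 0, zero divisors
   allowed. Ideals are [Prop]-valued sets; the structure [idealr] of the library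
   is not used because its ideals are boolean predicates, all of them proper. *)

Section Ideals.
Variable R : comNzRingType.
Implicit Types (I J P Q M : set R) (a b c x y : R).

Definition is_ideal I : Prop :=
  [/\ I 0, forall x y, I x -> I y -> I (x + y) & forall a x, I x -> I (a * x)].

Definition is_proper_ideal I : Prop := is_ideal I /\ ~ I 1.

Definition is_prime_ideal P : Prop :=
  is_proper_ideal P /\ forall x y, P (x * y) -> P x \/ P y.

Definition is_maximal_ideal M : Prop :=
  is_proper_ideal M /\ forall I, is_proper_ideal I -> M `<=` I -> I = M.

Lemma maximal_ideal_prime M : is_maximal_ideal M -> is_prime_ideal M.
Proof.
move=> [[[M0 MD MM] M1] Mmax]; split=> // x y Mxy.
have [Mx|nMx] := pselect (M x); first by left.
right; pose I := [set z | exists m r, M m /\ z = m + r * x].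
have MI : M `<=` I by move=> m Mm; exists m, 0; split=> //; ring.
have Ii : is_ideal I.
  split; first exact: MI.
  - move=> _ _ [m [r [Mm ->]]] [m' [r' [Mm' ->]]].
    by exists (m + m'), (r + r'); split; [exact: MD | ring].
  - move=> a _ [m [r [Mm ->]]].
    by exists (a * m), (a * r); split; [exact: MM | ring].
have [[m [r [Mm e]]]|nI1] := pselect (I 1).
  have -> : y = y * m + r * (x * y) by rewrite -{1}[y]mulr1 e; ring.
  by apply: MD; apply: MM.
case: nMx; rewrite -(Mmax I (conj Ii nI1) MI).
by exists 0, 1; split=> //; ring.
Qed.

Definition comparable_sets I J : Prop := I `<=` J \/ J `<=` I.

Definition ideal_mul I J : set R :=
  [set x | exists s : seq (R * R),
     (forall p, p \in s -> I p.1 /\ J p.2) /\ x = \sum_(p <- s) p.1 * p.2].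

Definition ideal_exp I (n : nat) : set R := \big[ideal_mul/setT]_(i < n) I.

Definition principal a : set R := [set a * x | x in setT].

Definition radical I : set R := [set x | exists n : nat, I (x ^+ n)].

Definition is_absorbing (n : nat) I : Prop :=
  is_proper_ideal I /\
  forall a : 'I_n.+1 -> R, I (\prod_i a i) ->
    exists i, I (\prod_(j | j != i) a j).

Definition is_primary Q : Prop :=
  is_proper_ideal Q /\ forall x y, Q (x * y) -> Q x \/ radical Q y.

Definition is_primary_to M Q : Prop := is_primary Q /\ radical Q = M.

Definition is_strongly_prime P : Prop :=
  is_prime_ideal P /\
  forall a b, comparable_sets [set a * x | x in P] (principal b).

(* A [comNzRingType] carries no predicate of units. *)
Definition is_invertible a : Prop := exists b, a * b = 1.

Definition is_irreducible a : Prop :=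
  ~ is_invertible a /\
  forall b c, a = b * c ->
    principal a = principal b \/ principal a = principal c.

End Ideals.

Section RingClasses.
Variable R : comNzRingType.

(* Allowing n = 0 below is harmless: the empty product and the empty intersection
   are R, which is not proper; no proper ideal is 0-absorbing. *)
Definition TAF_ring : Prop :=
  forall I : set R, is_proper_ideal I ->
    exists (n : nat) (J : 'I_n -> set R),
      (forall i, is_absorbing 2 (J i)) /\ I = \big[@ideal_mul R/setT]_i J i.

Definition finite_absorbing : Prop :=
  forall I : set R, is_proper_ideal I -> exists n : nat, is_absorbing n I.

Definition Laskerian : Prop :=
  forall I : set R, is_proper_ideal I ->
    exists (n : nat) (Q : 'I_n -> set R),
      (forall i, is_primary (Q i)) /\ I = \bigcap_i Q i.

Definition strongly_Laskerian : Prop :=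
  Laskerian /\
  forall Q : set R, is_primary Q -> exists n : nat, ideal_exp (radical Q) n `<=` Q.

Definition PVR : Prop :=
  exists M : set R, is_maximal_ideal M /\ is_strongly_prime M.

Definition atomic : Prop :=
  forall a : R, a != 0 -> ~ is_invertible a ->
    exists s : seq R,
      (forall x, x \in s -> is_irreducible x) /\ a = \prod_(x <- s) x.

End RingClasses.

(* Localization at a prime ideal P: fractions n / d with d outside P, where
   n / d = n' / d' iff s n d' = s n' d for some s outside P. *)
Record loc_frac (R : comNzRingType) (P : set R) :=
  LocFrac { loc_num : R; loc_den : R; loc_denP : ~ P loc_den }.

Arguments LocFrac {R P} loc_num loc_den loc_denP.
Arguments loc_denP {R P} l _.

HB.instance Definition _ (R : comNzRingType) (P : set R) :=
  gen_eqMixin (loc_frac P).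
HB.instance Definition _ (R : comNzRingType) (P : set R) :=
  gen_choiceMixin (loc_frac P).

Section Localization.
Variables (R : comNzRingType) (P : set R) (hP : is_prime_ideal P).

Local Notation frac := (loc_frac P).
Local Notation num := loc_num.
Local Notation den := loc_den.

Lemma loc1P : ~ P 1. Proof. by case: hP => -[]. Qed.

Lemma locMP x y : ~ P x -> ~ P y -> ~ P (x * y).
Proof. by case: hP => _ h nx ny /h[]. Qed.

Lemma loc0 : P 0. Proof. by case: hP => -[[]]. Qed.

Definition loc_equiv (x y : frac) : bool :=
  `[< exists s, ~ P s /\ s * (num x * den y) = s * (num y * den x) >].

Lemma loc_equiv_refl : reflexive loc_equiv.
Proof. by move=> x; apply/asboolP; exists 1; split=> //; exact: loc1P. Qed.

Lemma loc_equiv_sym : symmetric loc_equiv.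
Proof.
by move=> x y; apply/asboolP/asboolP => -[s [Ps e]]; exists s; split.
Qed.

Lemma loc_equiv_trans : transitive loc_equiv.
Proof.
move=> y x z /asboolP[s [Ps e]] /asboolP[t [Pt f]]; apply/asboolP.
exists (s * t * den y); split.
  by apply: locMP; [exact: locMP | exact: loc_denP].
transitivity (s * (num x * den y) * (t * den z)); first by ring.
rewrite e; transitivity (t * (num y * den z) * (s * den x)); first by ring.
by rewrite f; ring.
Qed.

Canonical loc_equiv_equiv :=
  EquivRel loc_equiv loc_equiv_refl loc_equiv_sym loc_equiv_trans.

Definition localization := {eq_quot loc_equiv}%qT.

HB.instance Definition _ : EqQuotient _ loc_equiv localization :=
  EqQuotient.on localization.
HB.instance Definition _ := Choice.on localization.

Definition loc_pi (x : frac) : localization := (\pi_localization x)%qT.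

Lemma loc_piP (x y : frac) :
  (loc_pi x = loc_pi y) <->
  exists s, ~ P s /\ s * (num x * den y) = s * (num y * den x).
Proof.
by split=> [/eqmodP/asboolP|?] //; apply/eqmodP/asboolP.
Qed.

Lemma loc_reprK (a : localization) : loc_pi (repr a) = a.
Proof. exact: reprK. Qed.

Lemma loc_repr (x : frac) :
  exists s, ~ P s /\
    s * (num (repr (loc_pi x)) * den x) = s * (num x * den (repr (loc_pi x))).
Proof. by apply/loc_piP; rewrite loc_reprK. Qed.

Lemma loc_ind (Q : localization -> Prop) :
  (forall x, Q (loc_pi x)) -> forall a, Q a.
Proof. by move=> h a; rewrite -(loc_reprK a). Qed.

Definition frac_add (x y : frac) : frac :=
  LocFrac (num x * den y + num y * den x) (den x * den y)
    (locMP (loc_denP x) (loc_denP y)).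
Definition frac_mul (x y : frac) : frac :=
  LocFrac (num x * num y) (den x * den y) (locMP (loc_denP x) (loc_denP y)).
Definition frac_opp (x : frac) : frac := LocFrac (- num x) (den x) (loc_denP x).

Definition loc_add (a b : localization) := loc_pi (frac_add (repr a) (repr b)).
Definition loc_mul (a b : localization) := loc_pi (frac_mul (repr a) (repr b)).
Definition loc_opp (a : localization) := loc_pi (frac_opp (repr a)).
Definition loc_of (a : R) : localization := loc_pi (LocFrac a 1 loc1P).

Lemma loc_addE x y : loc_add (loc_pi x) (loc_pi y) = loc_pi (frac_add x y).
Proof.
apply/loc_piP; have [s [Ps e]] := loc_repr x; have [t [Pt f]] := loc_repr y.
exists (s * t); split; first exact: locMP.
move: (repr (loc_pi x)) (repr (loc_pi y)) e f => x' y' e f /=.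
transitivity (s * (num x' * den x) * (t * den y' * den y)
            + t * (num y' * den y) * (s * den x' * den x)); first by ring.
by rewrite e f; ring.
Qed.

Lemma loc_mulE x y : loc_mul (loc_pi x) (loc_pi y) = loc_pi (frac_mul x y).
Proof.
apply/loc_piP; have [s [Ps e]] := loc_repr x; have [t [Pt f]] := loc_repr y.
exists (s * t); split; first exact: locMP.
move: (repr (loc_pi x)) (repr (loc_pi y)) e f => x' y' e f /=.
transitivity (s * (num x' * den x) * (t * (num y' * den y))); first by ring.
by rewrite e f; ring.
Qed.

Lemma loc_oppE x : loc_opp (loc_pi x) = loc_pi (frac_opp x).
Proof.
apply/loc_piP; have [s [Ps e]] := loc_repr x; exists s; split=> //=.
by rewrite !mulNr !mulrN e.
Qed.

Lemma loc_pi_eq (x y : frac) : num x * den y = num y * den x -> loc_pi x = loc_pi y.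
Proof.
by move=> e; apply/loc_piP; exists 1; split; [exact: loc1P | rewrite e].
Qed.

Lemma loc_addA : associative loc_add.
Proof.
elim/loc_ind=> x; elim/loc_ind=> y; elim/loc_ind=> z.
by rewrite !loc_addE; apply: loc_pi_eq => /=; ring.
Qed.

Lemma loc_addC : commutative loc_add.
Proof.
elim/loc_ind=> x; elim/loc_ind=> y.
by rewrite !loc_addE; apply: loc_pi_eq => /=; ring.
Qed.

Lemma loc_add0 : left_id (loc_of 0) loc_add.
Proof. by elim/loc_ind=> x; rewrite loc_addE; apply: loc_pi_eq => /=; ring. Qed.

Lemma loc_addN : left_inverse (loc_of 0) loc_opp loc_add.
Proof.
elim/loc_ind=> x; rewrite loc_oppE loc_addE.
by apply: loc_pi_eq => /=; ring.
Qed.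

HB.instance Definition _ :=
  GRing.isZmodule.Build localization loc_addA loc_addC loc_add0 loc_addN.

Lemma loc_mulA : associative loc_mul.
Proof.
elim/loc_ind=> x; elim/loc_ind=> y; elim/loc_ind=> z.
by rewrite !loc_mulE; apply: loc_pi_eq => /=; ring.
Qed.

Lemma loc_mulC : commutative loc_mul.
Proof.
elim/loc_ind=> x; elim/loc_ind=> y.
by rewrite !loc_mulE; apply: loc_pi_eq => /=; ring.
Qed.

Lemma loc_mul1 : left_id (loc_of 1) loc_mul.
Proof. by elim/loc_ind=> x; rewrite loc_mulE; apply: loc_pi_eq => /=; ring. Qed.

Lemma loc_mulDl : left_distributive loc_mul loc_add.
Proof.
elim/loc_ind=> x; elim/loc_ind=> y; elim/loc_ind=> z.
by rewrite !(loc_mulE, loc_addE); apply: loc_pi_eq => /=; ring.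
Qed.

Lemma loc1_neq0 : loc_of 1 != loc_of 0.
Proof.
apply/eqP => /loc_piP[s [Ps /=]]; rewrite mul0r mul1r mulr0 mulr1 => s0.
by apply: Ps; rewrite s0; exact: loc0.
Qed.

HB.instance Definition _ := GRing.Zmodule_isComNzRing.Build localization
  loc_mulA loc_mulC loc_mul1 loc_mulDl loc1_neq0.

Definition loc_unit : {pred localization} :=
  fun a => `[< exists b : localization, b * a = 1 >].

Definition loc_inv (a : localization) : localization :=
  if pselect (exists b : localization, b * a = 1) is left h
  then projT1 (cid h) else a.

Lemma loc_mulV : {in loc_unit, left_inverse 1 loc_inv *%R}.
Proof.
move=> a /asboolP h; rewrite /loc_inv.
by case: pselect => // h'; case: (cid h').
Qed.

Lemma loc_unitP (a b : localization) : b * a = 1 -> loc_unit a.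
Proof. by move=> e; apply/asboolP; exists b. Qed.

Lemma loc_inv_out : {in [predC loc_unit], loc_inv =1 id}.
Proof. by move=> a /asboolP h; rewrite /loc_inv; case: pselect. Qed.

HB.instance Definition _ := GRing.ComNzRing_hasMulInverse.Build localization
  loc_mulV loc_unitP loc_inv_out.

End Localization.

Section LocalizationOfDomain.
Variables (D : idomainType) (P : set D) (hP : is_prime_ideal P).

Lemma localization_integral (a b : localization hP) :
  a * b = 0 -> (a == 0) || (b == 0).
Proof.
elim/loc_ind: a => x; elim/loc_ind: b => y.
rewrite [_ * _]loc_mulE => /loc_piP[s [Ps /= e]].
have loc_eq0 z : loc_num z = 0 -> @loc_pi D P hP z = 0.
  by move=> z0; apply: loc_pi_eq; rewrite /= z0 !mul0r.
have /eqP : s * (loc_num x * loc_num y) = 0 by rewrite mulr1 mul0r mulr0 in e.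
rewrite !mulf_eq0 => /or3P[/eqP s0|/eqP x0|/eqP y0].
- by case: Ps; rewrite s0; exact: (loc0 hP).
- by rewrite (loc_eq0 x) ?eqxx.
- by rewrite (loc_eq0 y) ?eqxx ?orbT.
Qed.

HB.instance Definition _ := GRing.ComUnitRing_isIntegral.Build (localization hP)
  localization_integral.

End LocalizationOfDomain.

Definition LPVR (R : comNzRingType) : Prop :=
  forall (M : set R) (hM : is_maximal_ideal M),
    PVR (localization (maximal_ideal_prime hM)).

(* Subsets of D are read inside the quotient field {fraction D} as images under
   the embedding [tofrac]. *)
Definition PVD (D : idomainType) : Prop :=
  forall P : set D, is_prime_ideal P ->
  forall x y : {fraction D},
    (@tofrac D @` P) (x * y) -> (@tofrac D @` P) x \/ (@tofrac D @` P) y.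

Definition LPVD (D : idomainType) : Prop :=
  forall (M : set D) (hM : is_maximal_ideal M),
    PVD (localization (maximal_ideal_prime hM)).

(* The quotient I : J taken in K. *)
Definition colon (K : fieldType) (I J : set K) : set K :=
  [set x | forall y, J y -> I (x * y)].

Definition is_divisorial (D : idomainType) (I : set D) : Prop :=
  is_ideal I /\
  let D' := range (@tofrac D) in let I' := @tofrac D @` I in
  colon D' (colon D' I') = I'.

Definition Mori (D : idomainType) : Prop :=
  forall I : nat -> set D,
    (forall n, is_divisorial (I n)) -> (forall n, I n `<=` I n.+1) ->
    exists N : nat, forall n, (N <= n)%N -> I n = I N.

Definition ring_isomorphic (R S : comNzRingType) : Prop :=
  exists f : {rmorphism R -> S}, bijective f.

(* The library has no product of a dependent family of rings. As the operations
   of the product are componentwise, a ring isomorphism onto the product is a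
   family of ring morphisms that is jointly bijective. *)
Definition isomorphic_to_product (R : comNzRingType) (r : nat)
    (R_ : 'I_r -> comNzRingType) : Prop :=
  exists f : forall i, {rmorphism R -> R_ i},
    bijective (fun (x : R) (i : 'I_r) => f i x).

(* For a bare ring: being (isomorphic to) such an integral domain. *)
Definition Mori_LPVD (R : comNzRingType) : Prop :=
  exists D : idomainType, [/\ ring_isomorphic R D, Mori D & LPVD D].

(* Main.v *)
(* Call a maximal ideal M tame if, in the localization at M, M^2 <= yR for every y in M
   outside M^2 and the powers of M intersect in 0.  Then aM = M^(k+1) locally for
   every a in M^k outside M^(k+1): every nonzero ideal of R_M lies between two
   consecutive powers of the maximal ideal, and R_M is either a domain of dimension at
   most one or has a nilpotent maximal ideal.  Each of the five conditions amounts to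
   this: every maximal ideal of R is tame, and every proper ideal I has only finitely
   many contracted localizations I R_M (its saturations).  In that case distinct saturations of I are comaximal, so I is their
   product, each one being prime or containing a power of its maximal ideal M.  The
   latter kind is a product of ideals between M^2 and M, which are 2-absorbing and primary.
   The saturations of 0 give the decomposition of R, by the Chinese remainder theorem. *)
From HB Require Import structures.
From mathcomp Require Import all_boot all_algebra ring_quotient generic_quotient ring.
From mathcomp Require Import boolp classical_sets.
Require Import Defs.

Set Implicit Arguments.
Unset Strict Implicit.
Unset Printing Implicit Defensive.

Import GRing.Theory.

Local Open Scope classical_set_scope.
Local Open Scope ring_scope.

(** * Ideals *)

(** Most arguments stay inside R: a statement about the localization at M is written with
    saturations, as equations that hold after multiplication by an element outside M. The ring
    [localization] itself enters where a definition mentions it or where the TAF argument needs a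
    local ring; [local_iso] carries tameness across it, across quotients and across the projections
    of a product. Comparability alone does not give tameness: a valuation domain can have M = M^2 or
    nonzero elements in every power of M. Each condition excludes this by a finiteness of its own: a
    number of absorbed factors, of atoms or of 2-absorbing factors, a primary decomposition, a chain
    of divisorial ideals. Each time an equation putting x locally in xM kills x by Nakayama's lemma.
    The case M = M^2 of a TAF-ring is the hardest, since there powers of M do not bound the number
    of factors; a chain of primes is used instead. Saturations are counted rather than maximal
    ideals: in a domain the zero ideal has a single saturation, however many maximal ideals there
    are. This is why the domains in the decomposition need not be local. *)

Section IdealArithmetic.
Variable R : comNzRingType.
Implicit Types (I J K P Q M A : set R) (a b c x y z s : R).

Lemma ideal0 I : is_ideal I -> I 0. Proof. by case. Qed.

Lemma idealD I x y : is_ideal I -> I x -> I y -> I (x + y).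
Proof. by case=> _ h _; exact: h. Qed.

Lemma idealMl I a x : is_ideal I -> I x -> I (a * x).
Proof. by case=> _ _; apply. Qed.

Lemma idealMr I a x : is_ideal I -> I x -> I (x * a).
Proof. by move=> hI Ix; rewrite mulrC; exact: idealMl. Qed.

Lemma idealN I x : is_ideal I -> I x -> I (- x).
Proof. by move=> hI Ix; rewrite -mulN1r; exact: idealMl. Qed.

Lemma idealB I x y : is_ideal I -> I x -> I y -> I (x - y).
Proof. by move=> hI Ix Iy; apply: idealD => //; exact: idealN. Qed.

Lemma ideal_sum I (T : eqType) (s : seq T) (F : T -> R) :
  is_ideal I -> (forall t, t \in s -> I (F t)) -> I (\sum_(t <- s) F t).
Proof.
move=> hI; elim: s => [|t s IH] h; first by rewrite big_nil; exact: ideal0.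
rewrite big_cons; apply: idealD => //; first by apply: h; rewrite mem_head.
by apply: IH => u us; apply: h; rewrite inE us orbT.
Qed.

Lemma ideal_all I : is_ideal I -> I 1 -> forall x, I x.
Proof. by move=> hI I1 x; rewrite -[x]mulr1; exact: idealMl. Qed.

Lemma ideal_setT : is_ideal [set: R]. Proof. by []. Qed.

Lemma is_ideal0 : is_ideal [set (0 : R)].
Proof.
split=> //= [x y -> ->|a x ->]; [exact: addr0|exact: mulr0].
Qed.

Lemma idealI I J : is_ideal I -> is_ideal J -> is_ideal (I `&` J).
Proof.
move=> hI hJ; split=> [|x y [? ?] [? ?]|a x [? ?]].
- by split; exact: ideal0.
- by split; exact: idealD.
- by split; exact: idealMl.
Qed.

Definition ideal_add I J : set R := [set x | exists a b, [/\ I a, J b & x = a + b]].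

Lemma ideal_add_ideal I J : is_ideal I -> is_ideal J -> is_ideal (ideal_add I J).
Proof.
move=> hI hJ; split.
- by exists 0, 0; split; [exact: ideal0|exact: ideal0|rewrite addr0].
- move=> _ _ [a [b [Ia Jb ->]]] [a' [b' [Ia' Jb' ->]]].
  by exists (a + a'), (b + b'); split; [exact: idealD|exact: idealD|ring].
- move=> c _ [a [b [Ia Jb ->]]].
  by exists (c * a), (c * b); split; [exact: idealMl|exact: idealMl|ring].
Qed.

Lemma ideal_addl I J : is_ideal J -> I `<=` ideal_add I J.
Proof. by move=> hJ x Ix; exists x, 0; rewrite addr0; split=> //; exact: ideal0. Qed.

Lemma ideal_addr I J : is_ideal I -> J `<=` ideal_add I J.
Proof. by move=> hI x Jx; exists 0, x; rewrite add0r; split=> //; exact: ideal0. Qed.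

Lemma ideal_add_sub I J K : is_ideal K -> I `<=` K -> J `<=` K -> ideal_add I J `<=` K.
Proof. by move=> hK IK JK _ [a [b [/IK Ka /JK Kb ->]]]; exact: idealD. Qed.

Lemma principalP a x : principal a x <-> exists y, x = a * y.
Proof. by split=> [[y _ <-]|[y ->]]; exists y. Qed.

Lemma principal_mem a : principal a a.
Proof. by apply/principalP; exists 1; rewrite mulr1. Qed.

Lemma principal_ideal a : is_ideal (principal a).
Proof.
split.
- by apply/principalP; exists 0; rewrite mulr0.
- move=> x y /principalP[u ->] /principalP[v ->].
  by apply/principalP; exists (u + v); ring.
- by move=> b x /principalP[u ->]; apply/principalP; exists (b * u); ring.
Qed.

Lemma principal_sub I a : is_ideal I -> I a -> principal a `<=` I.
Proof. by move=> hI Ia x /principalP[y ->]; exact: idealMr. Qed.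

Lemma scale_ideal a I : is_ideal I -> is_ideal [set a * x | x in I].
Proof.
move=> hI; split.
- by exists 0; [exact: ideal0|rewrite mulr0].
- by move=> _ _ [x Ix <-] [y Iy <-]; exists (x + y); [exact: idealD|rewrite mulrDr].
- by move=> b _ [x Ix <-]; exists (b * x); [exact: idealMl|ring].
Qed.

Lemma ideal_mul_mem I J x y : I x -> J y -> ideal_mul I J (x * y).
Proof.
move=> Ix Jy; exists [:: (x, y)]; rewrite big_seq1; split=> //.
by move=> p; rewrite inE => /eqP->.
Qed.

Lemma ideal_mul0 I J : ideal_mul I J 0.
Proof. by exists [::]; rewrite big_nil. Qed.

Lemma ideal_mulD I J x y :
  ideal_mul I J x -> ideal_mul I J y -> ideal_mul I J (x + y).
Proof.
move=> [s [hs ->]] [t [ht ->]]; exists (s ++ t); rewrite big_cat; split=> //.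
by move=> p; rewrite mem_cat => /orP[/hs|/ht].
Qed.

(** [A] is only additively closed, so that existence statements such as that of [comparable_exp2]
    can be proved on a product before they are known to define an ideal. *)
Lemma ideal_mul_ind I J A :
    A 0 -> (forall x y, A x -> A y -> A (x + y)) ->
  (forall x y, I x -> J y -> A (x * y)) -> ideal_mul I J `<=` A.
Proof.
move=> A0 AD AM x [s [hs ->]]; elim: s hs => [|p s IH] h; first by rewrite big_nil.
rewrite big_cons; apply: AD.
  by have [] := h p (mem_head _ _); exact: AM.
by apply: IH => q qs; apply: h; rewrite inE qs orbT.
Qed.

Lemma ideal_mul_sub I J A :
  is_ideal A -> (forall x y, I x -> J y -> A (x * y)) -> ideal_mul I J `<=` A.
Proof. by case=> A0 AD _; exact: ideal_mul_ind. Qed.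

Lemma ideal_mulC I J : ideal_mul I J = ideal_mul J I.
Proof.
by apply/seteqP; split; apply: ideal_mul_ind => [|x y|x y Ix Jy];
  [exact: ideal_mul0|exact: ideal_mulD|rewrite mulrC; exact: ideal_mul_mem
  |exact: ideal_mul0|exact: ideal_mulD|rewrite mulrC; exact: ideal_mul_mem].
Qed.

Lemma ideal_mul_ideal I J : is_ideal I -> is_ideal (ideal_mul I J).
Proof.
move=> hI; split; [exact: ideal_mul0|by move=> x y; exact: ideal_mulD|].
move=> a; apply: ideal_mul_ind => [|x y|x y Ix Jy].
- by rewrite mulr0; exact: ideal_mul0.
- by rewrite mulrDr; exact: ideal_mulD.
- by rewrite mulrA; apply: ideal_mul_mem => //; exact: idealMl.
Qed.

Lemma ideal_mulA I J K :
  ideal_mul I (ideal_mul J K) = ideal_mul (ideal_mul I J) K.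
Proof.
apply/seteqP; split; apply: ideal_mul_ind => [|x y|x y].
- exact: ideal_mul0.
- exact: ideal_mulD.
- move=> Ix; move: y; apply: ideal_mul_ind => [|y z|y z Jy Kz].
  + by rewrite mulr0; exact: ideal_mul0.
  + by rewrite mulrDr; exact: ideal_mulD.
  + by rewrite mulrA; apply: ideal_mul_mem => //; exact: ideal_mul_mem.
- exact: ideal_mul0.
- exact: ideal_mulD.
- move=> + Kz; move: x; apply: ideal_mul_ind => [|u v|u v Iu Jv].
  + by rewrite mul0r; exact: ideal_mul0.
  + by rewrite mulrDl; exact: ideal_mulD.
  + by rewrite -mulrA; apply: ideal_mul_mem => //; exact: ideal_mul_mem.
Qed.

Lemma ideal_mul1 I : is_ideal I -> ideal_mul setT I = I.
Proof.
move=> hI; apply/seteqP; split.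
  by apply: ideal_mul_sub => // x y _; exact: idealMl.
by move=> x Ix; rewrite -[x]mul1r; exact: ideal_mul_mem.
Qed.

Lemma ideal_mulS I I' J J' :
  I `<=` I' -> J `<=` J' -> ideal_mul I J `<=` ideal_mul I' J'.
Proof.
move=> II JJ; apply: ideal_mul_ind => [|x y|x y /II ? /JJ ?];
  [exact: ideal_mul0|exact: ideal_mulD|exact: ideal_mul_mem].
Qed.

Lemma ideal_mul_subr I J : is_ideal J -> ideal_mul I J `<=` J.
Proof. by move=> hJ; apply: ideal_mul_sub => // x y _; exact: idealMl. Qed.

Lemma ideal_mul_subl I J : is_ideal I -> ideal_mul I J `<=` I.
Proof. by move=> hI; rewrite ideal_mulC; exact: ideal_mul_subr. Qed.

Lemma ideal_exp0 I : ideal_exp I 0 = setT.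
Proof. by rewrite /ideal_exp big_ord0. Qed.

Lemma ideal_expS I n : ideal_exp I n.+1 = ideal_mul I (ideal_exp I n).
Proof. by rewrite /ideal_exp big_ord_recl. Qed.

Lemma ideal_exp_ideal I n : is_ideal I -> is_ideal (ideal_exp I n).
Proof.
move=> hI; case: n => [|n]; first by rewrite ideal_exp0; exact: ideal_setT.
by rewrite ideal_expS; exact: ideal_mul_ideal.
Qed.

Lemma ideal_exp1 I : is_ideal I -> ideal_exp I 1 = I.
Proof. by move=> hI; rewrite ideal_expS ideal_exp0 ideal_mulC ideal_mul1. Qed.

Lemma ideal_exp2 I : is_ideal I -> ideal_exp I 2 = ideal_mul I I.
Proof. by move=> hI; rewrite ideal_expS ideal_exp1. Qed.

Lemma ideal_expD I m n : is_ideal I ->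
  ideal_exp I (m + n) = ideal_mul (ideal_exp I m) (ideal_exp I n).
Proof.
move=> hI; elim: m => [|m IH].
  by rewrite add0n ideal_exp0 ideal_mul1 //; exact: ideal_exp_ideal.
by rewrite addSn !ideal_expS IH ideal_mulA.
Qed.

Lemma ideal_exp_mem I n x : I x -> ideal_exp I n (x ^+ n).
Proof.
move=> Ix; elim: n => [|n IH]; first by rewrite ideal_exp0.
by rewrite ideal_expS exprS; exact: ideal_mul_mem.
Qed.

Lemma ideal_exp_le I m n : is_ideal I -> (m <= n)%N -> ideal_exp I n `<=` ideal_exp I m.
Proof.
move=> hI mn; rewrite -(subnK mn) ideal_expD //.
by apply: ideal_mul_subr; exact: ideal_exp_ideal.
Qed.

Lemma ideal_expSub I n : is_ideal I -> (0 < n)%N -> ideal_exp I n `<=` I.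
Proof. by move=> hI n0; rewrite -[X in _ `<=` X](ideal_exp1 hI); exact: ideal_exp_le. Qed.

Lemma ideal_exp_sub I J n : I `<=` J -> ideal_exp I n `<=` ideal_exp J n.
Proof.
move=> IJ; elim: n => [|n IH]; first by rewrite !ideal_exp0.
by rewrite !ideal_expS; exact: ideal_mulS.
Qed.

Lemma ideal_exp_prod I (T : finType) (a : T -> R) (A : {set T}) :
  (forall t, t \in A -> I (a t)) -> ideal_exp I #|A| (\prod_(t in A) a t).
Proof.
have [n] := ubnP #|A|; elim: n A => // n IH A cA hA.
have [->|[t tA]] := set_0Vmem A; first by rewrite cards0 ideal_exp0.
rewrite (bigD1 t) //= (cardsD1 t) tA ideal_expS; apply: ideal_mul_mem; first exact: hA.
rewrite (eq_bigl (mem (A :\ t)%SET)); last by move=> u; rewrite !inE andbC.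
apply: IH => [|u]; last by rewrite !inE => /andP[_]; exact: hA.
by move: cA; rewrite (cardsD1 t) tA.
Qed.

Lemma prime_ideal_ideal P : is_prime_ideal P -> is_ideal P.
Proof. by case=> -[]. Qed.

Lemma prime_mulP P x y : is_prime_ideal P -> P (x * y) -> P x \/ P y.
Proof. by case=> _; apply. Qed.

Lemma prime_nmul P x y : is_prime_ideal P -> ~ P x -> ~ P y -> ~ P (x * y).
Proof. by move=> hP nx ny /(prime_mulP hP)[]. Qed.

Lemma prime_n1 P : is_prime_ideal P -> ~ P 1.
Proof. by case=> -[]. Qed.

Lemma prime_expP P x n : is_prime_ideal P -> P (x ^+ n) -> P x.
Proof.
move=> hP; elim: n => [|n IH]; first by rewrite expr0 => /(prime_n1 hP).
by rewrite exprS => /(prime_mulP hP)[].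
Qed.

Lemma prime_nprod P (T : finType) (a : T -> R) (p : pred T) : is_prime_ideal P ->
  (forall t, p t -> ~ P (a t)) -> ~ P (\prod_(t | p t) a t).
Proof.
move=> hP h; elim/big_ind: _ => //; first exact: prime_n1.
by move=> x y; exact: prime_nmul.
Qed.

Lemma prime_ideal_mul P I J : is_prime_ideal P -> ideal_mul I J `<=` P ->
  I `<=` P \/ J `<=` P.
Proof.
move=> hP h; have [|/existsNP[x /not_implyP[Ix nPx]]] := pselect (I `<=` P); first by left.
right=> y Jy; have /(prime_mulP hP)[] // : P (x * y) by apply: h; exact: ideal_mul_mem.
Qed.

Lemma prime_ideal_exp P I n : is_prime_ideal P -> ideal_exp I n `<=` P -> I `<=` P.
Proof.
move=> hP; elim: n => [|n IH].
  by rewrite ideal_exp0 => h; case: (prime_n1 hP); exact: h.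
by rewrite ideal_expS => /(prime_ideal_mul hP)[].
Qed.

Lemma maximal_ideal M : is_maximal_ideal M -> is_ideal M.
Proof. by case=> -[]. Qed.

Lemma maximal_n1 M : is_maximal_ideal M -> ~ M 1.
Proof. by case=> -[]. Qed.

Lemma maximal_sub_eq M I : is_maximal_ideal M -> is_ideal I -> ~ I 1 -> M `<=` I -> I = M.
Proof. by move=> [_ h] hI I1; exact: h. Qed.

Lemma maximal_coprime M s : is_maximal_ideal M -> ~ M s ->
  exists t m, M m /\ t * s + m = 1.
Proof.
move=> hM ns; have hM' := maximal_ideal hM; apply: contrapT => h.
have hS : is_ideal (ideal_add M (principal s)).
  by apply: ideal_add_ideal => //; exact: principal_ideal.
case: ns; rewrite -(maximal_sub_eq hM hS) //.
- by apply: ideal_addr => //; exact: principal_mem.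
- move=> [m [_ [Mm /principalP[t ->] e]]]; apply: h.
  by exists t, m; rewrite mulrC addrC -e.
- by apply: ideal_addl; exact: principal_ideal.
Qed.

Lemma maximal_exp_coprime M s n : is_maximal_ideal M -> ~ M s ->
  exists t m, ideal_exp M n m /\ t * s + m = 1.
Proof.
move=> hM ns; have [t [m [Mm e]]] := maximal_coprime hM ns.
elim: n => [|n [u [v [Mv f]]]].
  by exists 0, 1; rewrite ideal_exp0 mul0r add0r.
exists (u + v * t), (m * v); split.
  by rewrite ideal_expS; exact: ideal_mul_mem.
by rewrite -[RHS]f -[X in _ = _ + X]mulr1 -e; ring.
Qed.

Lemma exists_prime_avoiding I (T : set R) : is_ideal I -> T 1 ->
    (forall x y, T x -> T y -> T (x * y)) -> (forall x, T x -> ~ I x) ->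
  exists P, [/\ is_prime_ideal P, I `<=` P, forall x, T x -> ~ P x &
    forall J, is_ideal J -> P `<=` J -> (forall x, T x -> ~ J x) -> J = P].
Proof.
move=> hI T1 TM TI.
(* [Zorn_bigcup] also asks for the union of the empty chain, which is the empty set. Hence I is
   adjoined to A instead of being required to lie in it. *)
pose S A := is_ideal (A `|` I) /\ forall x, T x -> ~ (A `|` I) x.
have [F FS Ftot|A [[hA TA] Amax]] := @Zorn_bigcup R S.
  split; last first.
    move=> x Tx [[A FA Ax]|/(TI _ Tx)] //.
    by have [_ /(_ x Tx)] := FS _ FA; apply; left.
  split; first by right; exact: ideal0.
  - have sub A : F A -> A `|` I `<=` \bigcup_(X in F) X `|` I.
      by move=> FA x [Ax|]; [left; exists A|right].
    have UI A x y : F A -> (A `|` I) x -> (A `|` I) y ->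
        (\bigcup_(X in F) X `|` I) (x + y).
      by move=> FA Ax Ay; apply: (sub A FA); apply: idealD => //; case: (FS _ FA).
    move=> x y [[A FA Ax]|Ix] [[B FB By]|Iy].
    + have [AB|BA] := Ftot _ _ FA FB.
      * by apply: (UI B) => //; left => //; exact: AB.
      * by apply: (UI A) => //; left => //; exact: BA.
    + by apply: (UI A) => //; [left|right].
    + by apply: (UI B) => //; [right|left].
    + by right; exact: idealD.
  - move=> a x [[A FA Ax]|Ix]; last by right; exact: idealMl.
    have [hA _] := FS _ FA.
    have [?|?] := @idealMl _ a x hA (or_introl Ax); last by right.
    by left; exists A.
pose P := A `|` I.
have Pmax J : is_ideal J -> P `<=` J -> (forall x, T x -> ~ J x) -> J = P.
  move=> hJ PJ TJ; apply/seteqP; split=> // x Jx; apply: contrapT => nPx.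
  have JI : J `|` I = J by apply/setUidPl => y Iy; apply: PJ; right.
  apply: (Amax J); last by rewrite /S JI.
  split; first by move=> y Ay; apply: PJ; left.
  by move=> JA; apply: nPx; left; exact: JA.
have ext x : ~ P x -> exists r p, P p /\ T (r * x + p).
  move=> nPx; apply: contrapT => h.
  have hJ : is_ideal (ideal_add P (principal x)).
    by apply: ideal_add_ideal => //; exact: principal_ideal.
  apply: nPx; rewrite -(Pmax _ hJ).
  - by apply: ideal_addr => //; exact: principal_mem.
  - by apply: ideal_addl; exact: principal_ideal.
  - move=> _ /[swap] [[p [_ [Pp /principalP[r ->] ->]]]] Tx.
    by apply: h; exists r, p; rewrite mulrC addrC.
exists P; split=> //; last by move=> x Ix; right.
split; first by split=> // P1; exact: (TA 1).
move=> x y Pxy; apply: contrapT => /not_orP[/ext[r [p [Pp Tx]]] /ext[u [q [Pq Ty]]]].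
apply: (TA _ (TM _ _ Tx Ty)).
have -> : (r * x + p) * (u * y + q) = r * u * (x * y) + ((r * x + p) * q + u * y * p).
  by ring.
apply: (idealD hA); first exact: (idealMl _ hA).
by apply: (idealD hA); exact: (idealMl _ hA).
Qed.

Lemma exists_maximal_ideal I : is_proper_ideal I ->
  exists M, is_maximal_ideal M /\ I `<=` M.
Proof.
move=> [hI I1]; have [|x y|x|P [hP IP P1 Pmax]] := @exists_prime_avoiding I [set 1] hI.
- by [].
- by move=> /= -> ->; rewrite mulr1.
- by move=> /= ->.
exists P; split=> //; split; first by case: hP.
by move=> J [hJ J1] PJ; apply: Pmax => // x /= ->.
Qed.

Lemma exists_prime_avoiding_powers I x : is_ideal I -> ~ radical I x ->
  exists P, [/\ is_prime_ideal P, I `<=` P & ~ P x].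
Proof.
move=> hI nI.
have [|_ _ [i ->] [j ->]|_ [i ->] Ii|P [hP IP TP _]] :=
    @exists_prime_avoiding I [set y | exists n : nat, y = x ^+ n] hI.
- by exists 0%N.
- by exists (i + j)%N; rewrite exprD.
- by apply: nI; exists i.
- by exists P; split=> //; apply: TP; exists 1%N.
Qed.

Lemma exists_minimal_prime I Q : is_prime_ideal Q -> I `<=` Q ->
  exists P, [/\ is_prime_ideal P, I `<=` P, P `<=` Q &
    forall P', is_prime_ideal P' -> I `<=` P' -> P' `<=` P -> P' = P].
Proof.
move=> hQ IQ; have hQ' := prime_ideal_ideal hQ.
(* Zorn's lemma goes upwards along unions, so a descending chain of primes is encoded by the
   complements in Q; the empty chain yields Q itself. *)
pose S A := is_prime_ideal (Q `\` A) /\ I `<=` Q `\` A.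
have [F FS Ftot|A [[hA IA] Amax]] := @Zorn_bigcup R S; last first.
  exists (Q `\` A); split=> //.
  move=> P' hP' IP' P'A; apply/seteqP; split=> // x [Qx nAx].
  apply: contrapT => nP'x; have Q' : Q `\` (Q `\` P') = P'.
    by rewrite setDD; apply/setIidr => y /P'A[].
  apply: (Amax (A `|` (Q `\` P'))); last first.
    suff e : Q `\` (A `|` (Q `\` P')) = P' by rewrite /S e.
    by rewrite setDUr Q'; apply/setIidr.
  by split=> [|/(_ x) h]; [exact: subsetUl|apply: nAx; apply: h; right].
have memU x : (Q `\` \bigcup_(X in F) X) x <-> Q x /\ forall A, F A -> (Q `\` A) x.
  split=> [[Qx nx]|[Qx h]]; split=> //.
    by move=> A FA; split=> // Ax; apply: nx; exists A.
  by move=> [A FA Ax]; case: (h A FA).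
have FP A : F A -> is_ideal (Q `\` A) by move=> /FS[/prime_ideal_ideal].
split; last first.
  by move=> x Ix; apply/memU; split; [exact: IQ|move=> A /FS[_]; exact].
split; first split; [split| |].
- by apply/memU; split; [exact: ideal0|move=> A /FP/ideal0].
- move=> x y /memU[Qx hx] /memU[Qy hy]; apply/memU; split; first exact: idealD.
  by move=> A FA; apply: idealD; [exact: FP|exact: hx|exact: hy].
- move=> a x /memU[Qx hx]; apply/memU; split; first exact: idealMl.
  by move=> A FA; apply: idealMl; [exact: FP|exact: hx].
- by move=> /memU[/(prime_n1 hQ)].
move=> x y /memU[Qxy h]; apply: contrapT => /not_orP[nx ny].
have out z : ~ (Q `\` \bigcup_(X in F) X) z ->
    ~ Q z \/ exists A, F A /\ ~ (Q `\` A) z.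
  move=> nz; apply: contrapT => /not_orP[/contrapT Qz /forallNP nA]; apply: nz.
  by apply/memU; split=> // A FA; apply: contrapT => nAz; apply: (nA A).
have absurd A z w : F A -> ~ (Q `\` A) z -> ~ (Q `\` A) w -> (Q `\` A) (z * w) -> False.
  by move=> /FS[hA _] nz nw /(prime_mulP hA)[].
have [nQx|[A [FA nAx]]] := out x nx; have [nQy|[B [FB nBy]]] := out y ny.
- by case: (prime_mulP hQ Qxy).
- by apply: (absurd B x y) => //; [case|exact: h].
- by apply: (absurd A x y) => //; [case|exact: h].
- have [AB|BA] := Ftot _ _ FA FB.
  + by apply: (absurd B x y) => //; [case=> Qx nBx; apply: nAx; split=> // /AB|exact: h].
  + by apply: (absurd A x y) => //; [case=> Qy nAy; apply: nBy; split=> // /BA|exact: h].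
Qed.

End IdealArithmetic.

(** * Saturations at maximal ideals *)

Section Saturation.
Variable R : comNzRingType.
Implicit Types (I J K P Q M N A : set R) (a b c m x y z s : R).

(* The preimage in R of the extension of I to the localization at M. *)
Definition saturation M I : set R := [set x | exists s, ~ M s /\ I (s * x)].

Section AtPrime.
Variables (M : set R) (hM : is_prime_ideal M).

Lemma sat_sub I : I `<=` saturation M I.
Proof. by move=> x Ix; exists 1; rewrite mul1r; split=> //; exact: prime_n1. Qed.

Lemma satS I J : I `<=` J -> saturation M I `<=` saturation M J.
Proof. by move=> IJ x [s [ns /IJ Jx]]; exists s. Qed.

Lemma sat_idem I : saturation M (saturation M I) `<=` saturation M I.
Proof.
move=> x [s [ns [t [nt Ix]]]]; exists (t * s); split; first exact: prime_nmul.
by rewrite -mulrA.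
Qed.

Lemma sat_cancel I s x : ~ M s -> saturation M I (s * x) -> saturation M I x.
Proof. by move=> ns Ix; apply: sat_idem; exists s. Qed.

Lemma sat_subl I J : I `<=` saturation M J -> saturation M I `<=` saturation M J.
Proof. by move=> /satS IJ x /IJ /sat_idem. Qed.

Lemma sat_ideal I : is_ideal I -> is_ideal (saturation M I).
Proof.
move=> hI; split.
- by apply: sat_sub; exact: ideal0.
- move=> x y [s [ns Ix]] [t [nt Iy]]; exists (s * t); split; first exact: prime_nmul.
  have -> : s * t * (x + y) = t * (s * x) + s * (t * y) by ring.
  by apply: idealD => //; exact: idealMl.
- by move=> a x [s [ns Ix]]; exists s; rewrite mulrCA; split=> //; exact: idealMl.
Qed.

Lemma sat_prime I P : is_prime_ideal P -> P `<=` M -> I `<=` P -> saturation M I `<=` P.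
Proof.
by move=> hP PM IP x [s [ns /IP /(prime_mulP hP)[/PM|]]].
Qed.

Lemma sat_proper I : I `<=` M -> saturation M I `<=` M.
Proof. exact: sat_prime. Qed.

Lemma sat0_sub I : is_ideal I -> saturation M [set 0] `<=` saturation M I.
Proof. by move=> hI; apply: satS => x ->; exact: ideal0. Qed.

Lemma sat0_ideal : is_ideal (saturation M [set 0]).
Proof. exact/sat_ideal/is_ideal0. Qed.

(* Nakayama for a principal ideal *)
Lemma sat0_fix x s m : ~ M s -> M m -> s * x = m * x -> saturation M [set 0] x.
Proof.
move=> ns Mm e; exists (s - m); split; last by rewrite /= mulrBl e subrr.
by move=> Msm; apply: ns; rewrite -[s](subrK m); apply: idealD => //; exact: prime_ideal_ideal.
Qed.

End AtPrime.

Section AtMaximal.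
Variables (M : set R) (hM : is_maximal_ideal M).
Let pM : is_prime_ideal M := maximal_ideal_prime hM.
Let iM : is_ideal M := maximal_ideal hM.

(** An element outside M is invertible modulo M^n, so it can be cancelled modulo any ideal that
    contains M^n. *)
Lemma sat_power_sub I n : is_ideal I -> ideal_exp M n `<=` I -> saturation M I `<=` I.
Proof.
move=> hI MI x [s [ns Ix]]; have [t [m [Mm e]]] := maximal_exp_coprime n hM ns.
rewrite -[x]mul1r -e mulrDl -mulrA; apply: idealD => //; first exact: idealMl.
by apply: idealMr => //; exact: MI.
Qed.

Lemma sat_exp n : saturation M (ideal_exp M n) `<=` ideal_exp M n.
Proof. by apply: (@sat_power_sub _ n); first exact: ideal_exp_ideal. Qed.

Lemma exp_cancel n s x : ~ M s -> ideal_exp M n (s * x) -> ideal_exp M n x.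
Proof. by move=> ns h; apply: sat_exp; exists s. Qed.

Lemma exp_cancelE n s x y : ~ M s -> s * x = y -> ideal_exp M n y -> ideal_exp M n x.
Proof. by move=> ns <-; exact: exp_cancel. Qed.

(** If M = M^2, the first clause is void and the second says that M vanishes locally: this is the
    case of a field. *)
Definition tame_at : Prop :=
  (forall y, M y -> ~ ideal_exp M 2 y -> ideal_exp M 2 `<=` saturation M (principal y)) /\
  (forall x, (forall n, ideal_exp M n x) -> saturation M [set 0] x).

(* Up to elements outside M: the maximal ideal of the localization at M is strongly prime. *)
Definition comparable_at : Prop := forall a b,
  (forall m, M m -> saturation M (principal b) (a * m)) \/
  saturation M [set a * m | m in M] b.

Lemma idempotent_exp : M `<=` ideal_exp M 2 -> forall n, M `<=` ideal_exp M n.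
Proof.
move=> MM; elim=> [|n IH]; first by rewrite ideal_exp0.
apply: subset_trans MM _; rewrite ideal_expS ideal_exp1 //.
by rewrite ideal_expS; exact: ideal_mulS.
Qed.

Section Powers.
Variable y : R.
Hypotheses (ny : ~ ideal_exp M 2 y).
Hypothesis (hy : ideal_exp M 2 `<=` saturation M (principal y)).

(** The induction trades a product a m of two elements of M for y r. The cofactor r is again in M,
    since otherwise y itself would lie in M^2. *)
Lemma exp_sub_sat_pow n : ideal_exp M n.+1 `<=` saturation M [set y ^+ n * m | m in M].
Proof.
elim: n => [|n IH].
  rewrite ideal_exp1 // => m Mm; apply: sat_sub => //; exists m => //.
  by rewrite expr0 mul1r.
rewrite ideal_expS; apply: ideal_mul_sub => [|a b Ma /IH[s [ns [m Mm e]]]].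
  by apply: sat_ideal => //; exact: scale_ideal.
have /hy[t [nt /principalP[r f]]] : ideal_exp M 2 (a * m).
  by rewrite ideal_exp2 //; exact: ideal_mul_mem.
have Mr : M r.
  apply: contrapT => nr; apply: ny; apply: (exp_cancel nr); rewrite mulrC -f.
  by apply: idealMl; [exact: ideal_exp_ideal|rewrite ideal_exp2 //; exact: ideal_mul_mem].
exists (t * s); split; first exact: prime_nmul.
exists r => //; transitivity (t * (a * (s * b))); last by ring.
by rewrite -e; transitivity (y ^+ n * (t * (a * m))); [rewrite f exprS; ring|ring].
Qed.

End Powers.

(** Locally x is y^(k-1) m, and m is outside M^2 because x is outside M^(k+1). So m can take over
    the role of y in the last of the k factors. Only the first half of tameness is assumed:
    TAF-rings use this before the second half is known. *)
Lemma exp_sub_scale k x :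
    (forall y, M y -> ~ ideal_exp M 2 y -> ideal_exp M 2 `<=` saturation M (principal y)) ->
    ideal_exp M k x -> ~ ideal_exp M k.+1 x ->
  ideal_exp M k.+1 `<=` saturation M [set x * m | m in M].
Proof.
move=> h2; case: k => [_|k].
  rewrite ideal_exp1 // => nx z Mz; exists x; split=> //; exists z => //.
move=> Mx nx; have [MM|/existsNP[y /not_implyP[My ny]]] := pselect (M `<=` ideal_exp M 2).
  by case: nx; apply: (idempotent_exp MM); apply: ideal_expSub Mx.
have hy := h2 y My ny; have [s [ns [m Mm e]]] := exp_sub_sat_pow ny hy Mx.
have nm : ~ ideal_exp M 2 m.
  move=> M2m; apply: nx; apply: (exp_cancelE ns (esym e)).
  by rewrite -addn2 ideal_expD //; apply: ideal_mul_mem => //; exact: ideal_exp_mem.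
move=> z /(exp_sub_sat_pow ny hy)[t [nt [m' Mm' f]]].
have [|u [nu [m'' Mm'' g]]] := @exp_sub_sat_pow m nm (h2 m Mm nm) 1 (y * m').
  by rewrite ideal_exp2 //; exact: ideal_mul_mem.
exists (u * t); split; first exact: prime_nmul.
exists (s * m''); first exact: idealMl.
transitivity (u * (t * z)); last by ring.
rewrite -f; transitivity (y ^+ k * (u * (y * m'))); last by rewrite exprS; ring.
by rewrite -g; transitivity (s * x * m''); [ring|rewrite -e expr1; ring].
Qed.

Hypothesis tM : tame_at.

Lemma tame_order x : ~ saturation M [set 0] x ->
  exists k, ideal_exp M k x /\ ~ ideal_exp M k.+1 x.
Proof.
move=> nx; apply: contrapT => h; apply: nx; apply: tM.2; elim=> [|n IH].
  by rewrite ideal_exp0.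
by apply: contrapT => nS; apply: h; exists n.
Qed.

Lemma tame_exp_sub k x : ideal_exp M k x -> ~ ideal_exp M k.+1 x ->
  ideal_exp M k.+1 `<=` saturation M [set x * m | m in M].
Proof. exact/exp_sub_scale/tM.1. Qed.

(** The orders of a and b with respect to the powers of M decide: the element of smaller order
    divides, and at equal orders aM lies in bR. *)
Lemma tame_comparable : comparable_at.
Proof.
move=> a b.
have [a0|/tame_order[k [Ma na]]] := pselect (saturation M [set 0] a).
  left=> m _; apply: idealMr; first exact/sat_ideal/principal_ideal.
  by apply: sat0_sub a0; exact: principal_ideal.
have [b0|/tame_order[l [Mb nb]]] := pselect (saturation M [set 0] b).
  by right; apply: sat0_sub b0; exact: scale_ideal.
have [kl|lk] := ltnP k l.
  by right; apply: (tame_exp_sub Ma na); apply: ideal_exp_le Mb.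
left=> m Mm; suff : saturation M [set b * m | m in M] (a * m).
  by apply: satS => _ [x _ <-]; apply/principalP; exists x.
apply: (tame_exp_sub Mb nb); apply: (ideal_exp_le (n := k.+1)) => //.
by rewrite mulrC ideal_expS; exact: ideal_mul_mem.
Qed.

Lemma tame_exp_sub_sat I x : is_ideal I -> saturation M I x -> ~ saturation M [set 0] x ->
  exists k, ideal_exp M k `<=` saturation M I.
Proof.
move=> hI Ix /tame_order[k [Mx nx]]; exists k.+1 => z /(tame_exp_sub Mx nx).
apply: sat_subl => // _ [m _ <-]; apply: idealMr => //; exact: sat_ideal.
Qed.

(** If a and b have orders k and l, then v in M^(k+1) is locally a m, and m times u in M^l is
    locally in bM. So u v is locally a multiple of ab, and ab = 0 would kill M^(l+k+1). *)
Lemma tame_sat0_prime : (forall k, ~ (ideal_exp M k `<=` saturation M [set 0])) ->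
  is_prime_ideal (saturation M [set 0]).
Proof.
move=> h; split; first split; first exact: sat0_ideal.
  by move=> /ideal_all/(_ _) hT; apply: (h 0) => x _; apply: hT; exact: sat0_ideal.
move=> a b ab; apply: contrapT => /not_orP[/tame_order[k [Ma na]] /tame_order[l [Mb nb]]].
apply: (h (l + k.+1)%N); rewrite ideal_expD //.
apply: ideal_mul_sub => [|u v Mu /(tame_exp_sub Ma na)[s [ns [m Mm e]]]].
  exact: sat0_ideal.
have Mmu : ideal_exp M l.+1 (m * u) by rewrite ideal_expS; exact: ideal_mul_mem.
have [t [nt [m' Mm' f]]] := tame_exp_sub Mb nb Mmu.
apply: (sat_cancel pM (prime_nmul pM nt ns)).
have -> : t * s * (u * v) = m' * (a * b).
  transitivity (t * u * (s * v)); first by ring.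
  by rewrite -e; transitivity (a * (t * (m * u))); [ring|rewrite -f; ring].
by apply: idealMl => //; exact: sat0_ideal.
Qed.

(** The dichotomy behind all later case distinctions: either I contains a power of M locally, or I
    vanishes locally and the localization is a domain. *)
Lemma tame_sat_cases I : is_ideal I ->
  (exists k, ideal_exp M k `<=` saturation M I) \/
  [/\ saturation M I = saturation M [set 0], is_prime_ideal (saturation M [set 0]) &
      forall k, ~ (ideal_exp M k `<=` saturation M [set 0])].
Proof.
move=> hI; have [|nk] := pselect (exists k, ideal_exp M k `<=` saturation M I); first by left.
right; have e : saturation M I = saturation M [set 0].
  apply/seteqP; split; last exact: sat0_sub.
  by move=> x Ix; apply: contrapT => /(tame_exp_sub_sat hI Ix).
have nk0 k : ~ (ideal_exp M k `<=` saturation M [set 0]).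
  by rewrite -e => h; apply: nk; exists k.
by split=> //; exact: tame_sat0_prime.
Qed.

Lemma tame_prime P : is_prime_ideal P -> P `<=` M -> P = M \/ P `<=` saturation M [set 0].
Proof.
move=> hP PM; have iP := prime_ideal_ideal hP.
have [|/existsNP[x /not_implyP[Px nx]]] := pselect (P `<=` saturation M [set 0]); first by right.
left; apply/seteqP; split=> //.
have [k hk] := tame_exp_sub_sat iP (sat_sub pM Px) nx.
apply: (prime_ideal_exp hP (n := k)); apply: subset_trans hk _.
exact: sat_prime.
Qed.

End AtMaximal.

(** Otherwise some maximal ideal contains all s with s x in I. It contains I as well, so only the
    maximal ideals above I have to be tested. *)
Lemma sat_cap I x : is_ideal I ->
  (forall M, is_maximal_ideal M -> I `<=` M -> saturation M I x) -> I x.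
Proof.
move=> hI h; pose A := [set s | I (s * x)].
have hA : is_ideal A.
  split; rewrite /A /=; first by rewrite mul0r; exact: ideal0.
  - by move=> u v Iu Iv; rewrite mulrDl; exact: idealD.
  - by move=> a u Iu; rewrite -mulrA; exact: idealMl.
apply: contrapT => nIx.
have [|M [hM AM]] := @exists_maximal_ideal _ A; first by split=> //; rewrite /A /= mul1r.
have [|s [ns Isx]] := h M hM; last by apply: ns; exact: AM.
by move=> y Iy; apply: AM; exact: idealMr.
Qed.

Lemma comaximal_orthogonal (T : finType) (K : T -> set R) : (forall t, is_ideal (K t)) ->
    (forall t u : T, t != u -> exists a b, [/\ K t a, K u b & a + b = 1]) ->
  exists e : T -> R, forall t : T, K t (1 - e t) /\ forall u, u != t -> K u (e t).
Proof.
move=> hK h.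
suff : forall t, exists et, K t (1 - et) /\ forall u, u != t -> K u et.
  by move=> /choice[e he]; exists e.
move=> t.
have /choice[b hb] : forall u : T, exists b, u != t -> K t (1 - b) /\ K u b.
  move=> u; have [->|ut] := eqVneq u t; first by exists 0.
  have [|a [b [Ka Kb e]]] := h t u; first by rewrite eq_sym.
  by exists b => _; split=> //; rewrite -e addrK.
exists (\prod_(u | u != t) b u); split.
  elim/big_ind: _ => [|x y Kx Ky|u /hb[]//]; first by rewrite subrr; exact: ideal0.
  have -> : 1 - x * y = (1 - x) + x * (1 - y) by ring.
  by apply: idealD => //; exact: idealMl.
move=> u ut; rewrite (bigD1 u) //=; apply: idealMr => //.
by case: (hb u ut).
Qed.

(** The family lists representatives of the saturations, not all maximal ideals above I. It may be
    empty, as it is for I = R. *)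
Definition finitely_saturated I : Prop :=
  exists (T : finType) (N : T -> set R),
    (forall t, is_maximal_ideal (N t) /\ I `<=` N t) /\
    forall M, is_maximal_ideal M -> I `<=` M ->
      exists t, saturation M I = saturation (N t) I.

Definition tame_ring : Prop :=
  (forall M, is_maximal_ideal M -> tame_at M) /\
  (forall I, is_proper_ideal I -> finitely_saturated I).

Section TameEverywhere.
Hypothesis tR : forall M, is_maximal_ideal M -> tame_at M.

(** Otherwise some maximal ideal L contains both saturations. A saturation that contains a power of
    its maximal ideal forces this ideal to be L; a prime one is, by [tame_prime], the saturation of
    0 at L. *)
Lemma tame_comaximal I M N : is_ideal I ->
    is_maximal_ideal M -> is_maximal_ideal N -> I `<=` M -> I `<=` N ->
  saturation M I = saturation N I \/
  exists a b, [/\ saturation M I a, saturation N I b & a + b = 1].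
Proof.
move=> hI hM hN IM IN.
have pM := maximal_ideal_prime hM; have pN := maximal_ideal_prime hN.
have iMI : is_ideal (saturation M I) by exact: sat_ideal.
have iNI : is_ideal (saturation N I) by exact: sat_ideal.
have [|n1] := pselect (ideal_add (saturation M I) (saturation N I) 1).
  by move=> [a [b [? ? e]]]; right; exists a, b.
have [|L [hL hadd]] := @exists_maximal_ideal R (ideal_add (saturation M I) (saturation N I)).
  by split=> //; exact: ideal_add_ideal.
have pL := maximal_ideal_prime hL.
have ML : saturation M I `<=` L by move=> x /(ideal_addl iNI) /hadd.
have NL : saturation N I `<=` L by move=> x /(ideal_addr iMI) /hadd.
have power K k : is_maximal_ideal K -> ideal_exp K k `<=` saturation K I ->
    saturation K I `<=` L -> K = L.
  move=> hK KI IL; apply/esym/(maximal_sub_eq hK); first exact: maximal_ideal.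
    exact: maximal_n1.
  by apply: (prime_ideal_exp pL (n := k)); exact: subset_trans IL.
(* The saturation p of 0 at K' is a prime between I and K, so it contains the saturation of I at K,
   hence a power of K, hence K. As p lies in K', K = K'. *)
have mixed K K' k : is_maximal_ideal K -> is_maximal_ideal K' ->
    ideal_exp K k `<=` saturation K I -> is_prime_ideal (saturation K' [set 0]) ->
    I `<=` saturation K' [set 0] -> saturation K' [set 0] `<=` K -> K = K'.
  move=> hK hK' KI pK' IK' K'K; apply/esym/(maximal_sub_eq hK); first exact: maximal_ideal.
    exact: maximal_n1.
  apply: subset_trans (_ : saturation K' [set 0] `<=` K').
    apply: (prime_ideal_exp pK' (n := k)); apply: subset_trans KI _.
    by apply: sat_prime => //; exact: maximal_ideal_prime.
  apply: sat_proper; first exact: maximal_ideal_prime.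
  by move=> _ ->; apply: ideal0; exact: maximal_ideal.
have [[k Mk]|[eM pM0 nM]] := tame_sat_cases hM (tR hM) hI.
  have eML := power M k hM Mk ML.
  have [[l Nl]|[eN pN0 nN]] := tame_sat_cases hN (tR hN) hI.
    by left; rewrite eML -(power N l hN Nl NL).
  left; rewrite (mixed M N k) // -eN; first exact: sat_sub.
  by rewrite eML.
have [[l Nl]|[eN pN0 nN]] := tame_sat_cases hN (tR hN) hI.
  have eNL := power N l hN Nl NL.
  left; rewrite -(mixed N M l) // -eM; first exact: sat_sub.
  by rewrite eNL.
left; rewrite eM eN.
have key K : is_maximal_ideal K -> is_prime_ideal (saturation K [set 0]) ->
    (forall k, ~ (ideal_exp K k `<=` saturation K [set 0])) ->
    saturation K [set 0] `<=` L -> saturation K [set 0] = saturation L [set 0].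
  move=> hK pK0 nK KL; apply/seteqP; split; last first.
    by apply: sat_prime => // _ ->; apply: ideal0; exact: prime_ideal_ideal.
  have [eL|//] := tame_prime hL (tR hL) pK0 KL.
  case: (nK 1%N); rewrite ideal_exp1; last exact: maximal_ideal.
  rewrite eL; suff -> : L = K by [].
  apply/esym/(maximal_sub_eq hL); [exact: maximal_ideal|exact: maximal_n1|].
  rewrite -eL; apply: sat_proper; first exact: maximal_ideal_prime.
  by move=> _ ->; apply: ideal0; exact: maximal_ideal.
by rewrite (key M) // -?eM // (key N) // -?eN.
Qed.

(* Given n+1 distinct, hence comaximal, saturations, the Chinese remainder theorem
   yields a product of n+1 factors in I no n of which multiply into I. *)
Lemma absorbing_finitely_saturated I n : is_absorbing n I -> finitely_saturated I.
Proof.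
move=> [[hI I1] hn]; apply: contrapT => nfin.
have [N [hN IN dN]] : exists N : 'I_n.+1 -> set R, [/\ forall i, is_maximal_ideal (N i),
    forall i, I `<=` N i & forall i j, i != j -> saturation (N i) I <> saturation (N j) I].
  elim: (n.+1) => [|k [N [hN IN dN]]].
    by exists (fun=> set0); split; case.
  have [M [hM IM dM]] : exists M, [/\ is_maximal_ideal M, I `<=` M &
      forall i, saturation M I <> saturation (N i) I].
    apply: contrapT => nM; apply: nfin; exists 'I_k, N; split=> // M hM IM.
    by apply: contrapT => nt; apply: nM; exists M; split=> // i e; apply: nt; exists i.
  exists (fun i => if unlift ord_max i is Some j then N j else M).
  split=> [i|i|i j]; first by case: unliftP.
    by case: unliftP.
  case: (unliftP ord_max i) => [i'|] ->; case: (unliftP ord_max j) => [j'|] ->.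
  - by move=> ij; apply: dN; apply: contra_neq ij => ->.
  - by move=> _ /esym; exact: dM.
  - by move=> _; exact: dM.
  - by rewrite eqxx.
pose K i := saturation (N i) I.
have pN i := maximal_ideal_prime (hN i).
have iK i : is_ideal (K i) by exact: sat_ideal.
have KN i : K i `<=` N i by exact: sat_proper.
have [|e he] := @comaximal_orthogonal 'I_n.+1 K iK.
  by move=> i j /dN ij; case: (tame_comaximal hI (hN i) (hN j) (IN i) (IN j)).
pose x := \prod_i (1 - e i).
have /choice[s hs] i : exists s, ~ N i s /\ I (s * x).
  by have : K i x by rewrite /x (bigD1 i) //=; apply: idealMr => //; case: (he i).
(* The e i glue the local denominators of x: d is congruent to s i modulo N i, so it lies outside
   every N i. *)
pose d := \sum_i e i * s i.
have Idx : I (d * x).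
  rewrite mulr_suml; apply: ideal_sum => // i _; rewrite -mulrA.
  by apply: idealMl => //; case: (hs i).
have iN i := maximal_ideal (hN i).
have nd i : ~ N i d.
  move=> Nd; have [ns _] := hs i; apply: ns.
  have Ne : N i (1 - e i) by apply: KN; case: (he i).
  suff : N i (d - e i * s i).
    move=> h; have -> : s i = (1 - e i) * s i + (d - (d - e i * s i)) by ring.
    by apply: idealD => //; [exact: idealMr|exact: idealB].
  rewrite /d (bigD1 i) //= addrAC subrr add0r; elim/big_ind: _ => [|u v|j ji].
  - exact: ideal0.
  - exact: idealD.
  - by apply: idealMr => //; apply: KN; apply: (he j).2; rewrite eq_sym.
(* The denominator d is put into each factor, so that the n+1 factors multiply to a multiple of d x,
   while those other than the i-th all stay outside N i. *)
have [|i] := hn (fun i => d * (1 - e i)).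
  rewrite big_split /= prodr_const card_ord exprSr -mulrA -/x.
  exact: idealMl.
move=> /(IN i); apply: (prime_nprod (pN i)) => j ji; apply: prime_nmul => // Nj.
apply: (maximal_n1 (hN i)); rewrite -[1](subrK (e j)); apply: idealD => //.
by apply: KN; apply: (he j).2; rewrite eq_sym.
Qed.

End TameEverywhere.

Lemma finitely_saturated_reduced I : finitely_saturated I ->
  exists n (N : 'I_n -> set R), [/\ forall i, is_maximal_ideal (N i),
    forall i, I `<=` N i,
    forall M, is_maximal_ideal M -> I `<=` M -> exists i, saturation M I = saturation (N i) I &
    forall i j, i != j -> saturation (N i) I <> saturation (N j) I].
Proof.
move=> [T [N [hN hM]]].
(* Maximal ideals with equal saturations yield the same [pick], so the fixed points of [r] represent
   each saturation once. *)
pose r t := odflt t [pick u | `[< saturation (N u) I = saturation (N t) I >]].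
have rE t : saturation (N (r t)) I = saturation (N t) I.
  by rewrite /r; case: pickP => //= u /asboolP.
have rr t u : saturation (N t) I = saturation (N u) I -> r t = r u.
  rewrite /r => e.
  rewrite (eq_pick (_ : _ =1 (fun v => `[< saturation (N v) I = saturation (N u) I >]))).
    by case: pickP => //= /(_ u)/asboolP.
  by move=> v; rewrite e.
pose A := [pred t | r t == t].
exists #|A|, (fun i => N (enum_val i)); split=> [i|i|M mM IM|i j ij e].
- by case: (hN (enum_val i)).
- by case: (hN (enum_val i)).
- have [t e] := hM M mM IM; have At : r t \in A by rewrite inE; apply/eqP/rr.
  by exists (enum_rank_in At (r t)); rewrite enum_rankK_in // rE.
move/eqP: ij; apply; apply: enum_val_inj.
have : enum_val i \in A by exact: enum_valP.
have : enum_val j \in A by exact: enum_valP.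
by rewrite !inE => /eqP <- /eqP <-; exact: rr.
Qed.

Lemma finitely_saturated_cap I n (N : 'I_n -> set R) : is_ideal I ->
    (forall i, is_maximal_ideal (N i)) ->
    (forall M, is_maximal_ideal M -> I `<=` M -> exists i, saturation M I = saturation (N i) I) ->
  I = \bigcap_i saturation (N i) I.
Proof.
move=> hI hN h; apply/seteqP; split=> [x Ix i _|x hx].
  by apply: sat_sub Ix; exact: maximal_ideal_prime.
by apply: sat_cap => // M hM IM; have [i ->] := h M hM IM; exact: hx.
Qed.

End Saturation.

(** * Localizations and quotients *)

Section LocalIsomorphism.
Variables (R S : comNzRingType) (f : {rmorphism R -> S}) (M : set R) (N : set S).

(* f induces an isomorphism from the localization of R at M onto that of S at N. *)
Definition local_iso : Prop :=
  [/\ is_prime_ideal M, is_maximal_ideal N, M = f @^-1` N,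
      forall x, f x = 0 -> saturation M [set 0] x &
      forall a, exists t x, ~ M t /\ f t * a = f x].

Hypothesis fMN : local_iso.
Let pM : is_prime_ideal M. Proof. by case: fMN. Qed.
Let hN : is_maximal_ideal N. Proof. by case: fMN. Qed.
Let pN : is_prime_ideal N := maximal_ideal_prime hN.

Lemma liso_mem x : M x <-> N (f x).
Proof. by case: fMN => _ _ ->. Qed.

Lemma liso_nmem x : ~ M x -> ~ N (f x).
Proof. by move=> nx /liso_mem. Qed.

Lemma liso_lift a : exists t x, ~ M t /\ f t * a = f x.
Proof. by case: fMN. Qed.

Lemma liso_ker x y : f x = f y -> exists s, ~ M s /\ s * x = s * y.
Proof.
move=> e; have [_ _ _ h _] := fMN; have [|s [ns s0]] := h (x - y).
  by rewrite rmorphB e subrr.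
by exists s; split=> //; apply/eqP; rewrite -subr_eq0 -mulrBr; apply/eqP.
Qed.

(** J' is the extension of J up to denominators outside M. As a relation it can be checked on
    principal ideals, multiples and powers one by one. *)
Definition extends_to (J : set R) (J' : set S) : Prop :=
  (forall x, J x -> J' (f x)) /\
  (forall a, J' a -> exists t x, [/\ ~ M t, J x & f t * a = f x]).

(** Every transfer between R and S reduces to this equivalence: denominators in S lift to R up to a
    factor outside M, and the kernel of f is killed outside M. *)
Lemma liso_sat J J' x : is_ideal J -> extends_to J J' ->
  saturation M J x <-> saturation N J' (f x).
Proof.
move=> hJ [JJ J'J]; split=> [[s [ns /JJ Js]]|[s' [ns' /J'J[t [j [nt Jj e]]]]]].
  by exists (f s); rewrite -rmorphM; split=> //; exact: liso_nmem.
have [u [s [nu es]]] := liso_lift s'.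
have [|v [nv ev]] := @liso_ker (t * s * x) (u * j).
  by rewrite !rmorphM -es -e; ring.
exists (v * t * s); split; last by rewrite -!mulrA (mulrA t) ev mulrA; exact: idealMl.
apply: prime_nmul => //; first exact: prime_nmul.
by apply/liso_mem; rewrite -es; apply: prime_nmul => //; exact: liso_nmem.
Qed.

Lemma extends_set0 : extends_to [set 0] [set 0].
Proof.
split=> [_ ->|_ ->]; first by rewrite /= rmorph0.
by exists 1, 0; rewrite mulr0 rmorph0; split=> //; exact: prime_n1.
Qed.

Lemma extends_max : extends_to M N.
Proof.
split=> [x /liso_mem//|a Na]; have [t [x [nt e]]] := liso_lift a.
by exists t, x; split=> //; apply/liso_mem; rewrite -e; apply: idealMl => //; exact: maximal_ideal.
Qed.

Lemma extends_setT : extends_to setT setT.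
Proof.
by split=> // a _; have [t [x [nt e]]] := liso_lift a; exists t, x.
Qed.

Lemma extends_principal b : extends_to (principal b) (principal (f b)).
Proof.
split=> [_ /principalP[y ->]|_ /principalP[y ->]].
  by apply/principalP; exists (f y); rewrite rmorphM.
have [t [x [nt e]]] := liso_lift y; exists t, (b * x); split=> //.
  by apply/principalP; exists x.
by rewrite rmorphM -e; ring.
Qed.

Lemma extends_scale b : extends_to [set b * m | m in M] [set f b * m | m in N].
Proof.
split=> [_ [m Mm <-]|_ [m /extends_max.2[t [x [nt Mx e]]] <-]].
  by exists (f m); [exact/liso_mem|rewrite rmorphM].
by exists t, (b * x); split=> //; [exists x|rewrite rmorphM -e; ring].
Qed.

Lemma extends_mul I I' J J' : is_ideal I -> extends_to I I' -> extends_to J J' ->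
  extends_to (ideal_mul I J) (ideal_mul I' J').
Proof.
move=> hI [II I'I] [JJ J'J]; split.
  apply: (@ideal_mul_ind R I J (fun x => ideal_mul I' J' (f x))) => [|x y|x y Ix Jy].
  - by rewrite rmorph0; exact: ideal_mul0.
  - by rewrite rmorphD; exact: ideal_mulD.
  - by rewrite rmorphM; apply: ideal_mul_mem; [exact: II|exact: JJ].
have hIJ := @ideal_mul_ideal R I J hI.
apply: (@ideal_mul_ind S I' J') => [|a b|a b /I'I[t [x [nt Ix e]]] /J'J[u [y [nu Jy g]]]].
- exists 1, 0; rewrite mulr0 rmorph0; split=> //; [exact: prime_n1|exact: ideal_mul0].
- move=> [t [x [nt Ix e]]] [u [y [nu Jy g]]]; exists (t * u), (u * x + t * y); split.
  + exact: prime_nmul.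
  + by apply: ideal_mulD; exact: idealMl.
  + by rewrite rmorphD !rmorphM -e -g; ring.
- exists (t * u), (x * y); split; [exact: prime_nmul|exact: ideal_mul_mem|].
  by rewrite !rmorphM -e -g; ring.
Qed.

Lemma extends_exp n : extends_to (ideal_exp M n) (ideal_exp N n).
Proof.
elim: n => [|n IH]; first by rewrite !ideal_exp0; exact: extends_setT.
rewrite !ideal_expS; apply: extends_mul => //; first exact: prime_ideal_ideal.
exact: extends_max.
Qed.

Hypothesis hM : is_maximal_ideal M.

Lemma liso_exp n x : ideal_exp M n x <-> ideal_exp N n (f x).
Proof.
have iMn := ideal_exp_ideal n (maximal_ideal hM).
split=> [/(extends_exp n).1//|Nx]; apply: sat_exp => //.
by apply/(liso_sat _ iMn (extends_exp n)); exact: sat_sub.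
Qed.

Lemma liso_tame : tame_at N -> tame_at M.
Proof.
move=> [h h0]; split=> [y My ny z Mz|x hx].
  apply/(liso_sat _ (principal_ideal y) (extends_principal y)); apply: h.
  - exact/liso_mem.
  - by move/liso_exp.
  - exact/liso_exp.
apply/(liso_sat _ (@is_ideal0 R) extends_set0); apply: h0 => n.
exact/liso_exp.
Qed.

Lemma liso_tame' : tame_at M -> tame_at N.
Proof.
move=> [h h0]; split=> [y' Ny' ny' z' /(extends_exp 2).2[u [z [nu Mz ez]]]|x' hx'].
  have [t [y [nt e]]] := liso_lift y'.
  apply: (sat_cancel pN (liso_nmem nu)); rewrite ez.
  apply: (satS (I := principal (f y))).
    apply: principal_sub; first exact: principal_ideal.
    by apply/principalP; exists (f t); rewrite -e mulrC.
  apply/(liso_sat _ (principal_ideal y) (extends_principal y)); apply: h => //.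
    by apply/liso_mem; rewrite -e; apply: idealMl => //; exact: maximal_ideal.
  by move=> /liso_exp; rewrite -e => /(exp_cancel hN (liso_nmem nt)).
have [t [x [nt e]]] := liso_lift x'.
apply: (sat_cancel pN (liso_nmem nt)); rewrite e.
apply/(liso_sat _ (@is_ideal0 R) extends_set0); apply: h0 => n.
by apply/liso_exp; rewrite -e; apply: idealMl => //; apply: ideal_exp_ideal; exact: maximal_ideal.
Qed.

Lemma liso_comparable : comparable_at N -> comparable_at M.
Proof.
have iM := maximal_ideal hM.
move=> h a b; have [ab|ba] := h (f a) (f b); [left=> m Mm|right].
  apply/(liso_sat _ (principal_ideal b) (extends_principal b)); rewrite rmorphM.
  by apply: ab; exact/liso_mem.
exact/(liso_sat _ (scale_ideal a iM) (extends_scale a)).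
Qed.

Lemma liso_comparable' : comparable_at M -> comparable_at N.
Proof.
have iM := maximal_ideal hM.
move=> h a' b'; have [t [a [nt ea]]] := liso_lift a'; have [u [b [nu eb]]] := liso_lift b'.
have [ab|ba] := h a b; [left=> m' /extends_max.2[v [m [nv Mm em]]]|right].
  apply: (sat_cancel pN (liso_nmem (prime_nmul pM nt nv))).
  have -> : f (t * v) * (a' * m') = f (a * m) by rewrite !rmorphM -ea -em; ring.
  apply: (satS (I := principal (f b))).
    apply: principal_sub; first exact: principal_ideal.
    by apply/principalP; exists (f u); rewrite -eb mulrC.
  by apply/(liso_sat _ (principal_ideal b) (extends_principal b)); exact: ab.
apply: (sat_cancel pN (liso_nmem nu)); rewrite eb.
apply: (satS (I := [set f a * m | m in N])).
  move=> _ [m Nm <-]; exists (f t * m); last by rewrite -ea; ring.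
  by apply: idealMl => //; exact: maximal_ideal.
exact/(liso_sat _ (scale_ideal a iM) (extends_scale a)).
Qed.

End LocalIsomorphism.

Section LocalRings.
Variable R : comNzRingType.
Implicit Types (M N I : set R).

Definition local_at M : Prop :=
  is_maximal_ideal M /\ forall x, ~ M x -> is_invertible x.

Lemma local_sub M I : local_at M -> is_proper_ideal I -> I `<=` M.
Proof.
move=> [hM hu] [hI I1] x Ix; apply: contrapT => /hu[y e].
by apply: I1; rewrite -e; exact: idealMr.
Qed.

Lemma local_sat M I : local_at M -> is_ideal I -> saturation M I `<=` I.
Proof.
move=> [hM hu] hI x [s [/hu[t e] Is]]; rewrite -[x]mul1r -e.
by rewrite [s * t]mulrC -mulrA; exact: idealMl.
Qed.

(** Comparing M itself, that is a = 1, with xR: either x is in M, or M lies in xR and so in any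
    maximal ideal containing x. *)
Lemma strongly_prime_local M : is_maximal_ideal M -> is_strongly_prime M -> local_at M.
Proof.
move=> hM [_ h]; split=> // x nx; apply: contrapT => ninv.
have hx : is_proper_ideal (principal x).
  split; first exact: principal_ideal.
  by move=> /principalP[y e]; apply: ninv; exists y.
have [L [hL xL]] := exists_maximal_ideal hx.
have [Mx|xM] := h 1 x; last first.
  by have /xM[y My e] := principal_mem x; apply: nx; rewrite -e mul1r.
apply: nx; rewrite -(maximal_sub_eq hM (maximal_ideal hL) (maximal_n1 hL)).
  exact/xL/principal_mem.
by move=> m Mm; apply/xL/Mx; exists m => //; rewrite mul1r.
Qed.

Lemma strongly_prime_comparable M : is_maximal_ideal M ->
  is_strongly_prime M -> comparable_at M.
Proof.
move=> hM [pM h] a b; have [ab|ba] := h a b; [left=> m Mm|right].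
  by apply: sat_sub => //; apply: ab; exists m.
by apply: sat_sub => //; apply: ba; exact: principal_mem.
Qed.

Lemma local_comparable M : local_at M -> comparable_at M -> is_strongly_prime M.
Proof.
move=> lM h; have hM := lM.1; split; first exact: maximal_ideal_prime.
move=> a b; have [ab|ba] := h a b; [left|right].
  move=> _ [m Mm <-]; apply: (local_sat lM (principal_ideal b)).
  exact: ab.
have hs := scale_ideal a (maximal_ideal hM).
by apply: principal_sub => //; exact: (local_sat lM hs ba).
Qed.

Lemma PVR_local : PVR R <-> exists M, local_at M /\ comparable_at M.
Proof.
split=> [[M [hM sM]]|[M [lM cM]]]; exists M.
  by split; [exact: strongly_prime_local|exact: strongly_prime_comparable].
by split; [case: lM|exact: local_comparable].
Qed.

Lemma local_unique M N : local_at M -> is_maximal_ideal N -> N = M.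
Proof.
move=> lM hN; have [hM _] := lM.
apply/esym/(maximal_sub_eq hN); [exact: maximal_ideal|exact: maximal_n1|].
by apply: local_sub; case: hN.
Qed.

End LocalRings.

Section LocalizationMap.
Variables (R : comNzRingType) (P : set R) (hP : is_prime_ideal P).

Lemma loc_of_zmod_morphism : zmod_morphism (loc_of hP).
Proof.
move=> x y; rewrite /loc_of -[RHS]/(loc_add _ (loc_opp _)) loc_oppE loc_addE.
by apply: loc_pi_eq => //=; ring.
Qed.

Lemma loc_of_monoid_morphism : monoid_morphism (loc_of hP).
Proof.
split=> // x y; rewrite /loc_of -[RHS]/(loc_mul _ _) loc_mulE.
by apply: loc_pi_eq => //=; ring.
Qed.

HB.instance Definition _ :=
  GRing.isZmodMorphism.Build R (localization hP) (loc_of hP) loc_of_zmod_morphism.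
HB.instance Definition _ :=
  GRing.isMonoidMorphism.Build R (localization hP) (loc_of hP) loc_of_monoid_morphism.

Definition loc_max : set (localization hP) :=
  [set a | exists x : loc_frac P, P (loc_num x) /\ a = loc_pi hP x].

Lemma loc_maxP (x : loc_frac P) : loc_max (loc_pi hP x) <-> P (loc_num x).
Proof.
have iP := prime_ideal_ideal hP.
split=> [[y [Py /loc_piP[s [ns e]]]]|Px]; last by exists x.
have [|//] : P (s * loc_den y) \/ P (loc_num x).
  apply: (prime_mulP hP); have -> : s * loc_den y * loc_num x = s * (loc_num x * loc_den y).
    by ring.
  by rewrite e; apply: idealMl => //; exact: idealMr.
by move/(prime_mulP hP) => [//|/(loc_denP y)].
Qed.

Lemma loc_frac_mul (x : loc_frac P) :
  loc_of hP (loc_den x) * loc_pi hP x = loc_of hP (loc_num x).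
Proof.
rewrite -[LHS]/(loc_mul _ _) /loc_of loc_mulE.
by apply: loc_pi_eq => //=; ring.
Qed.

Lemma loc_of_max x : loc_max (loc_of hP x) <-> P x.
Proof. exact: loc_maxP. Qed.

Lemma loc_of_eq0 x : loc_of hP x = 0 -> saturation P [set 0] x.
Proof.
move=> /loc_piP[s [ns /=]]; rewrite mulr1 mul0r mulr0 => e.
by exists s.
Qed.

Lemma loc_max_ideal : is_ideal loc_max.
Proof.
have iP := prime_ideal_ideal hP; split.
- by apply/(loc_of_max 0); exact: ideal0.
- elim/loc_ind=> x; elim/loc_ind=> y /loc_maxP Px /loc_maxP Py.
  rewrite -[_ + _]/(loc_add _ _) loc_addE; apply/loc_maxP => /=.
  by apply: idealD => //; exact: idealMr.
- elim/loc_ind=> x; elim/loc_ind=> y /loc_maxP Py.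
  rewrite -[_ * _]/(loc_mul _ _) loc_mulE; apply/loc_maxP => /=.
  exact: idealMl.
Qed.

Lemma loc_invertible a : ~ loc_max a -> is_invertible a.
Proof.
elim/loc_ind: a => x nx; have {}nx : ~ P (loc_num x) by move/loc_maxP.
exists (loc_pi hP (LocFrac (loc_den x) (loc_num x) nx)).
rewrite -[_ * _]/(loc_mul _ _) loc_mulE -[RHS]/(loc_of hP 1).
by apply: loc_pi_eq => /=; ring.
Qed.

Lemma loc_local : local_at loc_max.
Proof.
have n1 : ~ loc_max 1 by move=> /loc_of_max; exact: prime_n1.
split; last exact: loc_invertible.
split; first by split=> //; exact: loc_max_ideal.
move=> I [hI I1] MI; apply/seteqP; split=> // a Ia.
apply: contrapT => /loc_invertible[b e]; apply: I1; rewrite -e.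
exact: idealMr.
Qed.

Lemma loc_of_local_iso : local_iso (loc_of hP) P loc_max.
Proof.
split=> //.
- by case: loc_local.
- by apply/seteqP; split=> x /loc_of_max.
- exact: loc_of_eq0.
- elim/loc_ind=> x; exists (loc_den x), (loc_num x); split; last exact: loc_frac_mul.
  exact: loc_denP.
Qed.

End LocalizationMap.

Lemma PVR_localization (R : comNzRingType) (M : set R) (hM : is_maximal_ideal M) :
  PVR (localization (maximal_ideal_prime hM)) <-> comparable_at M.
Proof.
have pM := maximal_ideal_prime hM.
have li := loc_of_local_iso (maximal_ideal_prime hM).
split=> [/PVR_local[N [lN cN]]|cM].
  apply: (liso_comparable li hM).
  by rewrite (local_unique lN (loc_local (maximal_ideal_prime hM)).1).
apply/PVR_local; exists (@loc_max R M (maximal_ideal_prime hM)); split; first exact: loc_local.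
exact: (liso_comparable' li hM cM).
Qed.

Lemma LPVR_comparable (R : comNzRingType) :
  LPVR R <-> forall M : set R, is_maximal_ideal M -> comparable_at M.
Proof.
split=> [h M hM|h M hM]; first exact/PVR_localization/(h M hM).
exact/PVR_localization/h.
Qed.

Section QuotientRing.
Variables (R : comNzRingType) (K : set R) (hK : is_proper_ideal K).

Definition ideal_pred : {pred R} := fun x => `[< K x >].

Lemma ideal_pred_closed : idealr_closed ideal_pred.
Proof.
have [iK K1] := hK; split.
- by apply/asboolP; exact: ideal0.
- by apply/asboolP.
- move=> a x y /asboolP Kx /asboolP Ky; apply/asboolP.
  by apply: idealD => //; exact: idealMl.
Qed.

HB.instance Definition _ := isIdealr.Build R ideal_pred ideal_pred_closed.

Definition quotient_ring : comNzRingType := {ideal_quot ideal_pred}.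

Definition quotient_map (x : R) : quotient_ring := (\pi_({ideal_quot ideal_pred}) x)%qT.

Lemma quotient_map_zmod_morphism : zmod_morphism quotient_map.
Proof. by move=> x y; rewrite /quotient_map !piE. Qed.

Lemma quotient_map_monoid_morphism : monoid_morphism quotient_map.
Proof. by split=> [|x y]; rewrite /quotient_map !piE. Qed.

HB.instance Definition _ :=
  GRing.isZmodMorphism.Build R quotient_ring quotient_map quotient_map_zmod_morphism.
HB.instance Definition _ :=
  GRing.isMonoidMorphism.Build R quotient_ring quotient_map quotient_map_monoid_morphism.

Lemma quotient_map_eq0 x : quotient_map x = 0 <-> K x.
Proof.
rewrite /quotient_map -[K x]asboolE -[X in K X]subr0; split=> [/eqP|h].
  by rewrite !piE /Quotient.equiv.
by apply/eqP; rewrite !piE /Quotient.equiv.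
Qed.

Lemma quotient_map_surj a : exists x, quotient_map x = a.
Proof. by exists (repr (a : {ideal_quot ideal_pred})); exact: reprK. Qed.

End QuotientRing.

(** * Comparability and finite absorption *)

Section Comparability.
Variables (R : comNzRingType) (M : set R) (hM : is_maximal_ideal M).
Implicit Types (I : set R) (a b x y z : R).
Let pM : is_prime_ideal M := maximal_ideal_prime hM.
Let iM : is_ideal M := maximal_ideal hM.

(** An element of M^n is only a sum of products; absorption and unique cancellation of atoms need
    single products, of every length. *)
Definition divisible_at x : Prop := forall n, exists s (l : seq R),
  [/\ ~ M s, size l = n.+1, forall a, a \in l -> M a & s * x = \prod_(a <- l) a].

Lemma divisible_at_mem x : divisible_at x -> M x.
Proof.
move=> dx; have [s [l [ns]]] := dx 0; case: l => [|a [|//]] // _ Ml.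
rewrite big_seq1 => e; have /(prime_mulP pM)[] // : M (s * x).
by rewrite e; apply: Ml; rewrite mem_head.
Qed.

Hypothesis cM : comparable_at M.

(** From a sum a b + c d one factors out a or c, according to whether c is in aM or aM is in cR. *)
Lemma comparable_exp2 z : ideal_exp M 2 z ->
  exists s a b, [/\ ~ M s, M a, M b & s * z = a * b].
Proof.
rewrite ideal_exp2 //; move: z; apply: ideal_mul_ind => [|x y|x y Mx My].
- by exists 1, 0, 0; split; [exact: prime_n1|exact: ideal0|exact: ideal0|ring].
- move=> [s [a [b [ns Ma Mb e]]]] [t [c [d [nt Mc Md f]]]].
  have right : saturation M [set a * m | m in M] c ->
      exists u g h, [/\ ~ M u, M g, M h & u * (x + y) = g * h].
    move=> [v [nv [m Mm eg]]]; exists (v * (s * t)), a, (v * t * b + m * s * d).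
    split=> //; first by apply: prime_nmul => //; exact: prime_nmul.
      by apply: idealD => //; exact: idealMl.
    transitivity (v * t * (s * x) + v * s * (t * y)); first by ring.
    rewrite e f; transitivity (v * t * (a * b) + s * (v * c) * d); first by ring.
    by rewrite -eg; ring.
  have [/(_ (t * b) (idealMl t iM Mb))[u [nu /principalP[r g]]]|//] := cM a c.
  (* If r is outside M, it is a unit locally and u t a b = c r puts c back into aM. *)
  have [Mr|nr] := pselect (M r); last first.
    apply: right; exists r; split=> //; exists (u * t * b); first exact: idealMl.
    by rewrite [RHS]mulrC -g; ring.
  exists (u * (s * t)), c, (r + u * s * d); split=> //.
  + by apply: prime_nmul => //; exact: prime_nmul.
  + by apply: idealD => //; exact: idealMl.
  + transitivity (u * t * (s * x) + u * s * (t * y)); first by ring.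
    rewrite e f; transitivity (u * (a * (t * b)) + u * s * (c * d)); first by ring.
    by rewrite g; ring.
- by exists 1, x, y; split=> //; [exact: prime_n1|rewrite mul1r].
Qed.

(** For p q in M^2, compare pM with yR: y in pM would put y in M^2. *)
Lemma comparable_exp2_sub y : M y -> ~ ideal_exp M 2 y ->
  ideal_exp M 2 `<=` saturation M (principal y).
Proof.
move=> My ny; rewrite ideal_exp2 //.
apply: ideal_mul_sub => [|p q Mp Mq]; first exact/sat_ideal/principal_ideal.
have [|py] := cM p y; first exact.
case: ny; apply: (sat_exp hM); apply: satS py => _ [m Mm <-].
by rewrite ideal_exp2 //; exact: ideal_mul_mem.
Qed.

(** If M = M^2, splitting into two factors can be repeated. Otherwise an element of M^(n+1) is
    locally y^n m, which has n+1 factors. *)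
Lemma comparable_divisible x : (forall n, ideal_exp M n x) -> divisible_at x.
Proof.
move=> hx n.
have [MM|/existsNP[y /not_implyP[My ny]]] := pselect (M `<=` ideal_exp M 2).
  elim: n x hx => [|n IH] x hx.
    exists 1, [:: x]; rewrite big_seq1 mul1r; split=> //; first exact: prime_n1.
    by move=> a; rewrite inE => /eqP->; have := hx 1%N; rewrite ideal_exp1.
  have [s [a [b [ns Ma Mb e]]]] := comparable_exp2 (hx 2%N).
  have [|t [l [nt sl Ml f]]] := IH a; first by move=> k; exact: idempotent_exp.
  exists (t * s), (b :: l); split=> //=; first exact: prime_nmul.
  - by rewrite sl.
  - by move=> c; rewrite inE => /orP[/eqP->|/Ml].
  - by rewrite big_cons -f -mulrA e; ring.
have [s [ns [m Mm e]]] := exp_sub_sat_pow hM ny (comparable_exp2_sub My ny) (hx n.+1).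
exists s, (m :: nseq n y); split=> //=; first by rewrite size_nseq.
  by move=> c; rewrite inE mem_nseq => /orP[/eqP->|/andP[_ /eqP->]].
by rewrite big_cons big_nseq iter_mulr_1 -e mulrC.
Qed.

Lemma comparable_tame : (forall x, divisible_at x -> saturation M [set 0] x) -> tame_at M.
Proof.
move=> h; split; first exact: comparable_exp2_sub.
by move=> x hx; apply: h; exact: comparable_divisible.
Qed.

(* If s x is a product of n+1 elements of M and the saturation of xR is n-absorbing,
   then one of the factors can be dropped, and Nakayama's lemma kills x. *)
Lemma finite_absorbing_tame : finite_absorbing R -> tame_at M.
Proof.
move=> fR; apply: comparable_tame => x dx.
pose I := saturation M (principal x).
have hI : is_ideal I by exact/sat_ideal/principal_ideal.
have Ix : I x by apply: sat_sub => //; exact: principal_mem.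
have Mx := divisible_at_mem dx.
have IM : I `<=` M by apply: sat_proper => //; exact: principal_sub.
have [|n [_ hn]] := fR I; first by split=> // /IM; exact: prime_n1.
have [s [l [ns sl Ml e]]] := dx n.
have eprod : \prod_(i < n.+1) l`_i = s * x.
  by rewrite e -sl -(big_mkord predT (fun i => l`_i)) -(big_nth 0 predT id).
have [|i [u [nu /principalP[r f]]]] := hn (fun i => l`_i).
  by rewrite eprod; exact: idealMl.
have Mi : M l`_i by apply: Ml; rewrite mem_nth // sl.
rewrite (bigD1 i) //= in eprod; move: (\prod_(j | _) _) f eprod => p f eprod.
apply: (sat_cancel pM ns); rewrite -eprod; apply: idealMl; first exact: sat0_ideal.
apply: (sat0_fix pM (prime_nmul pM ns nu) (idealMr r iM Mi)).
by transitivity (s * (u * p)); [ring|rewrite f mulrA -eprod; ring].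
Qed.

End Comparability.

(** * Primary ideals *)

Section Primary.
Variable R : comNzRingType.
Implicit Types (I Q M P : set R) (x y : R).

Lemma radical_sub I : I `<=` radical I.
Proof. by move=> x Ix; exists 1%N; rewrite expr1. Qed.

Lemma radical_sub_prime I P : is_prime_ideal P -> I `<=` P -> radical I `<=` P.
Proof. by move=> hP IP x [n /IP /(prime_expP hP)]. Qed.

Lemma radical_prime P : is_prime_ideal P -> radical P = P.
Proof.
move=> hP; apply/seteqP; split; last exact: radical_sub.
exact: radical_sub_prime.
Qed.

Lemma prime_primary P : is_prime_ideal P -> is_primary P.
Proof.
move=> hP; split; first by case: hP.
by move=> x y; rewrite radical_prime //; case: hP => _; exact.
Qed.

Lemma power_primary M I k : is_maximal_ideal M -> is_ideal I -> ideal_exp M k `<=` I ->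
  I `<=` M -> is_primary_to M I.
Proof.
move=> hM hI MI IM; have pM := maximal_ideal_prime hM.
have e : radical I = M.
  apply/seteqP; split; first exact: radical_sub_prime.
  by move=> x Mx; exists k; apply: MI; exact: ideal_exp_mem.
split=> //; split; first by split=> // /IM; exact: prime_n1.
move=> x y Ixy; rewrite e; have [My|ny] := pselect (M y); [by right|left].
by apply: (sat_power_sub hM hI MI); exists y; rewrite mulrC.
Qed.

Lemma primary_sat Q M : is_primary Q -> radical Q `<=` M -> saturation M Q `<=` Q.
Proof.
by move=> [_ h] QM x [s [ns]]; rewrite mulrC => /h[//|/QM].
Qed.

Lemma primary_absorbing Q n : is_primary Q -> ideal_exp (radical Q) n `<=` Q ->
  is_absorbing n Q.
Proof.
move=> [hQ h] hn; split=> // a Qa.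
have [ra|/existsNP[i ni]] := pselect (forall i, radical Q (a i)).
  exists ord0; apply: hn.
  have := @ideal_exp_prod R (radical Q) _ a [set j | j != ord0]%SET (fun j _ => ra j).
  rewrite cardsE cardC1 card_ord /= (eq_bigl (fun j => j != ord0)) // => j.
  by rewrite inE.
by exists i; move: Qa; rewrite (bigD1 i) //= mulrC => /h[].
Qed.

Lemma absorbingS n I : is_absorbing n I -> is_absorbing n.+1 I.
Proof.
move=> [[iI I1] h]; split=> // a Ia.
(* The last of the n+2 factors is merged into the first. If the merged factor is the one dropped,
   the first factor is multiplied back and only the last is dropped. *)
pose b i := a (lift ord_max i) * (if i == ord0 then a ord_max else 1).
have prod_b (p : pred 'I_n.+1) : \prod_(i | p i) b i =
    (\prod_(i | p i) a (lift ord_max i)) * (if p ord0 then a ord_max else 1).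
  rewrite big_split /=; congr (_ * _).
  rewrite -big_mkcondr /=; case: ifP => p0.
    rewrite (bigD1 ord0) ?p0 //= big1 ?mulr1 // => i /andP[/andP[_ /eqP->]].
    by rewrite eqxx.
  by rewrite big1 // => i /andP[pi /eqP i0]; rewrite -i0 pi in p0.
have rec (p : pred 'I_n.+2) : \prod_(i | p i) a i =
    (\prod_(i | p (lift ord_max i)) a (lift ord_max i)) * (if p ord_max then a ord_max else 1).
  rewrite big_mkcond (bigD1_ord ord_max) //= mulrC -big_mkcond; congr (_ * _).
have [|i Ii] := h b.
  by rewrite prod_b /= -(rec predT).
have [i0|i0] := eqVneq i ord0.
  exists ord_max; rewrite rec eqxx /= mulr1 (eq_bigl predT); last first.
    by move=> j; rewrite eq_sym neq_lift.
  rewrite (bigD1 ord0) //=; apply: idealMl => //.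
  by move: Ii; rewrite prod_b i0 eqxx mulr1.
exists (lift ord_max i); rewrite rec; move: Ii; rewrite prod_b eq_sym i0 neq_lift.
by rewrite (eq_bigl (fun j => lift ord_max j != lift ord_max i)) // => j; rewrite (inj_eq lift_inj).
Qed.

Lemma absorbing_le m n I : (m <= n)%N -> is_absorbing m I -> is_absorbing n I.
Proof. by move=> /subnK <-; elim: (n - m)%N => // k IH /IH; exact: absorbingS. Qed.

Lemma absorbing_subset n I (T : finType) (a : T -> R) (A : {set T}) : is_absorbing n I ->
  I (\prod_(t in A) a t) -> exists2 B : {set T}, (#|B| <= n)%N & I (\prod_(t in B) a t).
Proof.
move=> hn; have [k] := ubnP #|A|; elim: k A => // k IH A cA IA.
have [An|nA] := leqP #|A| n; first by exists A.
case cardA : #|A| nA => [//|m] nm; have [_ h] := absorbing_le (nm : n <= m)%N hn.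
pose g (i : 'I_m.+1) := enum_val (cast_ord (esym cardA) i).
have gA i : g i \in A by exact: enum_valP.
have reindexA (p : pred T) : \prod_(t in A | p t) a t = \prod_(i | p (g i)) a (g i).
  rewrite -big_enum_cond (big_nth (g ord0)) -cardE cardA big_mkord.
  have gE (i : 'I_m.+1) : nth (g ord0) (enum A) i = g i by rewrite {2}/g (enum_val_nth (g ord0)).
  by apply: eq_big => [i|i _]; rewrite gE.
have [|i Ii] := h (fun i => a (g i)).
  by rewrite -(reindexA predT); under eq_bigl do rewrite andbT.
apply: (IH (A :\ g i)%SET); first by move: cA; rewrite (cardsD1 (g i)) gA.
rewrite (eq_bigl (fun t => (t \in A) && (t != g i))); last first.
  by move=> t; rewrite !inE andbC.
rewrite reindexA (eq_bigl (fun j => j != i)) // => j.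
by rewrite /g (inj_eq enum_val_inj) (inj_eq (@cast_ord_inj _ _ _)).
Qed.

Lemma absorbing_bigcap k (Q : 'I_k -> set R) (n : 'I_k -> nat) :
  is_proper_ideal (\bigcap_i Q i) -> (forall i, is_absorbing (n i) (Q i)) ->
  is_absorbing (\sum_i n i) (\bigcap_i Q i).
Proof.
move=> hQ hn; split=> // a Qa.
have /choice[B hB] i : exists B : {set _}, (#|B| <= n i)%N /\ Q i (\prod_(t in B) a t).
  have [|B cB QB] := absorbing_subset (A := [set: 'I_(\sum_i n i).+1]%SET) (a := a) (hn i).
    by rewrite big_mkcond; under eq_bigr do rewrite inE; exact: Qa.
  by exists B.
have card_U (T : finType) (C : 'I_k -> {set T}) :
    (#|(\bigcup_i C i)%SET| <= \sum_i #|C i|)%N.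
  elim/big_ind2: _ => [|A p A' q Ap A'q|i _//]; first by rewrite cards0.
  by apply: leq_trans (leq_add Ap A'q); rewrite cardsU leq_subr.
have [j nj] : exists j, j \notin (\bigcup_i B i)%SET.
  apply/existsP; rewrite -negb_forall; apply/negP => /forallP all.
  have /subset_leq_card : [set: 'I_(\sum_i n i).+1]%SET \subset (\bigcup_i B i)%SET.
    by apply/fintype.subsetP => j _; exact: all.
  rewrite cardsT card_ord leqNgt ltnS => /negP; apply.
  by apply: leq_trans (card_U _ B) _; apply: leq_sum => i _; case: (hB i).
exists j => i _; have [_ Qi] := hB i.
have sub t : t \in B i -> t != j.
  by move=> tB; apply: contraNneq nj => <-; apply/finset.bigcupP; exists i.
rewrite (bigID (mem (B i))) /= mulrC; apply: idealMl; first by case: (hn i) => -[].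
rewrite (eq_bigl (mem (B i))) // => t; rewrite andbC.
by case tB : (_ \in _) => //=; rewrite sub.
Qed.

Lemma strongly_Laskerian_finite_absorbing : strongly_Laskerian R -> finite_absorbing R.
Proof.
move=> [hL hp] I hI; have [k [Q [hQ e]]] := hL I hI.
have /choice[n hn] i : exists n, is_absorbing n (Q i).
  by have [n hn] := hp _ (hQ i); exists n; exact: primary_absorbing.
by exists (\sum_i n i)%N; rewrite e; apply: absorbing_bigcap => //; rewrite -e.
Qed.

(* A primary component of I + xM contains x if its radical does not contain M, and
   contains a power of M otherwise. *)
Lemma Laskerian_Krull M I x : strongly_Laskerian R -> is_maximal_ideal M -> is_ideal I ->
  (forall k, ideal_add I (ideal_exp M k) x) -> saturation M I x.
Proof.
move=> [hL hp] hM hI hx; have iM := maximal_ideal hM.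
have iM' := scale_ideal x iM.
pose J := ideal_add I [set x * m | m in M].
have hJ : is_ideal J by exact: ideal_add_ideal.
have [a [_ [Ia [m Mm <-] e]]] : J x.
  have [|J1] := pselect (J 1); first by move/(ideal_all hJ).
  have [k [Q [hQ eJ]]] := hL J (conj hJ J1).
  have JQ i : J `<=` Q i by rewrite eJ => y; exact.
  rewrite eJ => i _; have [[iQ _] prim] := hQ i.
  have [MQ|/existsNP[m /not_implyP[Mm nm]]] := pselect (M `<=` radical (Q i)).
    have [n hn] := hp _ (hQ i); apply: (ideal_add_sub iQ _ _ (hx n)).
      by move=> y Iy; apply: JQ; exact: ideal_addl.
    by apply: subset_trans hn; exact: ideal_exp_sub.
  have /prim[//|//] : Q i (x * m).
  by apply: JQ; apply: ideal_addr => //; exists m.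
exists (1 - m); split; last by rewrite mulrBl mul1r [m * x]mulrC {1}e addrK.
move=> M1m; apply: (maximal_n1 hM); rewrite -[1](subrK m); exact: idealD.
Qed.

(** For y in M outside M^2, the ideals yR + M^k with k > 0 are M-primary and not inside M^2, so they
    contain M^2; Krull's intersection theorem for yR finishes. *)
Lemma Laskerian_tame M : strongly_Laskerian R -> is_maximal_ideal M ->
    (forall Q, is_primary_to M Q -> comparable_sets Q (ideal_exp M 2)) ->
  tame_at M.
Proof.
move=> hR hM hc; have iM := maximal_ideal hM.
have iMk k := ideal_exp_ideal k iM.
split=> [y My ny z Mz|x hx]; last first.
  apply: Laskerian_Krull => // [|k]; first exact: is_ideal0.
  by apply: ideal_addr; [exact: is_ideal0|exact: hx].
have iy := principal_ideal y.
apply: Laskerian_Krull => // -[|k].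
  by rewrite ideal_exp0; exact: ideal_addr.
have hQ : is_ideal (ideal_add (principal y) (ideal_exp M k.+1)) by exact: ideal_add_ideal.
have [|QM|MQ] := hc (ideal_add (principal y) (ideal_exp M k.+1)).
- apply: (power_primary (k := k.+1)) => //; first exact: ideal_addr.
  apply: ideal_add_sub => //; first exact: principal_sub.
  exact: ideal_expSub.
- by case: ny; apply: QM; apply: ideal_addl => //; exact: principal_mem.
- exact: MQ.
Qed.

Section Tame.
Hypothesis tR : forall M, is_maximal_ideal M -> tame_at M.

(** A primary ideal is its own saturation at any maximal ideal above it, so [tame_sat_cases] makes
    it contain a power of that ideal or be prime. *)
Lemma tame_primary_power Q : is_primary Q -> exists n, ideal_exp (radical Q) n `<=` Q.
Proof.
move=> hQ; have [[iQ Q1] _] := hQ; have [M [hM QM]] := exists_maximal_ideal hQ.1.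
have pM := maximal_ideal_prime hM; have rM := radical_sub_prime pM QM.
have sQ : saturation M Q = Q.
  by apply/seteqP; split; [exact: primary_sat|exact: sat_sub].
have [[k]|[e p0 _]] := tame_sat_cases hM (tR hM) iQ.
  by rewrite sQ => h; exists k; apply: subset_trans h; exact: ideal_exp_sub.
have pQ : is_prime_ideal Q by rewrite -sQ e.
by exists 1%N; rewrite radical_prime // ideal_exp1.
Qed.

Lemma tame_primary_comparable M Q : is_maximal_ideal M -> is_primary_to M Q ->
  comparable_sets Q (ideal_exp M 2).
Proof.
move=> hM [hQ e]; have [[iQ _] _] := hQ.
have [|/existsNP[y /not_implyP[Qy ny]]] := pselect (Q `<=` ideal_exp M 2); first by left.
right; have My : M y by rewrite -e; exact: radical_sub.
apply: subset_trans ((tR hM).1 y My ny) _.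
apply: subset_trans (satS (principal_sub iQ Qy)) _.
by apply: primary_sat => //; rewrite e.
Qed.

End Tame.

Lemma tame_ring_strongly_Laskerian : tame_ring R -> strongly_Laskerian R.
Proof.
move=> [tR fR]; split; last exact: tame_primary_power.
move=> I hI; have [n [N [hN IN hM _]]] := finitely_saturated_reduced (fR I hI).
exists n, (fun i => saturation (N i) I); split; last first.
  by apply: finitely_saturated_cap => //; case: hI.
move=> i; have [iI _] := hI; have pN := maximal_ideal_prime (hN i).
have [[k hk]|[-> p0 _]] := tame_sat_cases (hN i) (tR _ (hN i)) iI.
  by case: (power_primary (hN i) (sat_ideal pN iI) hk (sat_proper pN (IN i))).
exact: prime_primary.
Qed.

End Primary.

(** * Products of 2-absorbing ideals *)

Section TwoAbsorbing.
Variable R : comNzRingType.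
Implicit Types (I J P Q M A : set R) (x y : R).

Lemma absorbing2P J : is_absorbing 2 J -> forall a b c, J (a * b * c) ->
  [\/ J (a * b), J (a * c) | J (b * c)].
Proof.
move=> [_ h] a b c Jabc; have [|i] := h (fun i => [:: a; b; c]`_i).
  by rewrite !big_ord_recl big_ord0 /= mulr1 mulrA.
rewrite big_mkcond !big_ord_recl big_ord0 /=.
case: i => -[|[|[|//]]] lti; rewrite ?eqE /= ?mul1r ?mulr1 => Jp.
- exact: Or33.
- exact: Or32.
- exact: Or31.
Qed.

Lemma absorbing2_sqr J y n : is_absorbing 2 J -> J (y ^+ n) -> J (y ^+ 2).
Proof.
move=> hJ; have iJ : is_ideal J by case: hJ => -[].
elim: n => [|[|n] IH]; rewrite ?expr0 => Jn; first by apply: ideal_all.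
  by rewrite expr2; exact: idealMl.
move: Jn; have -> : y ^+ n.+2 = y * y * y ^+ n by rewrite -mulrA -!exprS.
have e : y * y ^+ n = y ^+ n.+1 by rewrite exprS.
by case/(absorbing2P hJ); rewrite ?e //; rewrite expr2.
Qed.

(** Squares of elements of M lie in J, so u v (u + v) does. Dropping one of u, v, u + v leaves u v
    up to a square. *)
Lemma absorbing2_radical J M : is_absorbing 2 J -> M `<=` radical J -> ideal_mul M M `<=` J.
Proof.
move=> hJ MJ; have iJ : is_ideal J by case: hJ => -[].
have sqr m : M m -> J (m ^+ 2) by move=> /MJ[n]; exact: absorbing2_sqr.
apply: ideal_mul_sub => // u v /sqr Ju /sqr Jv.
have Juv : J (u * v * (u + v)).
  have -> : u * v * (u + v) = v * u ^+ 2 + u * v ^+ 2 by ring.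
  by apply: idealD => //; exact: idealMl.
have [//|h|h] := absorbing2P hJ Juv.
  have -> : u * v = u * (u + v) - u ^+ 2 by ring.
  exact: idealB.
have -> : u * v = v * (u + v) - v ^+ 2 by ring.
exact: idealB.
Qed.

Lemma absorbing2_between M J : is_maximal_ideal M -> is_ideal J ->
  ideal_exp M 2 `<=` J -> J `<=` M -> is_absorbing 2 J.
Proof.
move=> hM hJ MJ JM; have [pJ e] := power_primary hM hJ MJ JM.
by apply: primary_absorbing => //; rewrite e.
Qed.

Lemma prime_absorbing2 P : is_prime_ideal P -> is_absorbing 2 P.
Proof.
move=> hP; apply: primary_absorbing; first exact: prime_primary.
by rewrite radical_prime //; apply: ideal_expSub => //; exact: prime_ideal_ideal.
Qed.

(** The number of factors is recorded because over a local ring it is limited by the powers of M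
    that contain the ideal; see [local_factored_exp]. *)
Inductive factored : nat -> set R -> Prop :=
| factored0 : factored 0 setT
| factoredS n J I : is_absorbing 2 J -> factored n I -> factored n.+1 (ideal_mul J I).

Lemma factored_ideal n I : factored n I -> is_ideal I.
Proof. by case=> [|k J A [[iJ _] _] _]; [exact: ideal_setT|exact: ideal_mul_ideal]. Qed.

Lemma factored1 J : is_absorbing 2 J -> factored 1 J.
Proof.
move=> hJ; have iJ : is_ideal J by case: hJ => -[].
by rewrite -(ideal_mul1 iJ) ideal_mulC; apply: factoredS => //; exact: factored0.
Qed.

Lemma factored_mul m n I J : factored m I -> factored n J -> factored (m + n) (ideal_mul I J).
Proof.
move=> fI fJ; elim: fI => [|k K A hK _ IH].
  by rewrite ideal_mul1 //; exact: factored_ideal fJ.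
by rewrite -ideal_mulA addSn; exact: factoredS.
Qed.

Lemma factoredP I : (exists n, factored n I) <->
  exists (n : nat) (J : 'I_n -> set R),
    (forall i, is_absorbing 2 (J i)) /\ I = \big[@ideal_mul R/setT]_i J i.
Proof.
split=> [[n]|[n [J [hJ ->]]]].
  elim=> [|k J A hJ _ [m [K [hK ->]]]].
    by exists 0%N, (fun=> setT); split; [case|rewrite big_ord0].
  exists m.+1, (fun i => if unlift ord0 i is Some j then K j else J); split.
    by move=> i; case: unliftP.
  rewrite big_ord_recl unlift_none; congr ideal_mul.
  by apply: eq_bigr => i _; rewrite liftK.
exists n; elim: n J hJ => [|n IH] J hJ; first by rewrite big_ord0; exact: factored0.
by rewrite big_ord_recl; apply: factoredS => //; exact: IH.
Qed.

Lemma TAF_factored : TAF_ring R <-> forall I, is_proper_ideal I -> exists n, factored n I.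
Proof. by split=> h I /h /factoredP. Qed.

(* If Q <= M^2, then Q is the product of the saturation of yR and of {z in M | y z in Q},
   for any y in M outside M^2. *)
Lemma factored_power M k Q : is_maximal_ideal M -> tame_at M -> is_ideal Q ->
  ideal_exp M k `<=` Q -> Q `<=` M -> exists n, factored n Q.
Proof.
move=> hM tM; have pM := maximal_ideal_prime hM; have iM := maximal_ideal hM.
elim: k Q => [|k IH] Q iQ MQ QM.
  by case: (prime_n1 pM); apply: QM; apply: MQ; rewrite ideal_exp0.
have [M2Q|nM2Q] := pselect (ideal_exp M 2 `<=` Q).
  by exists 1%N; apply: factored1; exact: (absorbing2_between hM).
have QM2 : Q `<=` ideal_exp M 2.
  move=> q Qq; apply: contrapT => nq; apply: nM2Q.
  apply: subset_trans (tM.1 q (QM q Qq) nq) _.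
  apply: subset_trans (sat_power_sub hM iQ MQ).
  by apply: satS; exact: principal_sub.
have [MM|/existsNP[y /not_implyP[My ny]]] := pselect (M `<=` ideal_exp M 2).
  case: nM2Q; apply: subset_trans (ideal_expSub iM _) _ => //.
  by apply: subset_trans MQ; exact: idempotent_exp.
pose Y := saturation M (principal y).
have iY : is_ideal Y by exact/sat_ideal/principal_ideal.
have hY : is_absorbing 2 Y.
  apply: (absorbing2_between hM) => //; first exact: tM.1.
  by apply: sat_proper => //; exact: principal_sub.
pose Q1 := M `&` [set z | Q (y * z)].
have iQ1 : is_ideal Q1.
  apply: idealI => //; split=> /=; first by rewrite mulr0; exact: ideal0.
  - by move=> u v Qu Qv; rewrite mulrDr; exact: idealD.
  - by move=> a u Qu; rewrite mulrCA; exact: idealMl.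
have MQ1 : ideal_exp M k `<=` Q1.
  case: k MQ {IH} => [|k] MQ.
    case: nM2Q; apply: subset_trans MQ; exact: ideal_exp_le.
  move=> z Mz; split; first exact: ideal_expSub Mz.
  by apply: MQ; rewrite ideal_expS; exact: ideal_mul_mem.
have [n fQ1] := IH Q1 iQ1 MQ1 (@subIsetl _ _ _).
exists n.+1; suff -> : Q = ideal_mul Y Q1 by exact: factoredS.
apply/seteqP; split.
  have iYQ : is_ideal (ideal_mul Y Q1) by exact: ideal_mul_ideal.
  (* Both Q and the product contain a power of M and are thus saturated, so the equality may be
     checked locally. *)
  have MYQ : ideal_exp M (2 + k) `<=` ideal_mul Y Q1.
    by rewrite ideal_expD //; apply: ideal_mulS => //; exact: tM.1.
  move=> q Qq; apply: (sat_power_sub hM iYQ MYQ).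
  have [s [ns [m Mm e]]] := exp_sub_sat_pow hM ny (tM.1 y My ny) (n := 1) (QM2 q Qq).
  rewrite expr1 in e; exists s; split=> //; rewrite -e; apply: ideal_mul_mem.
    by apply: sat_sub => //; exact: principal_mem.
  by split=> //=; rewrite e; exact: idealMl.
apply: ideal_mul_sub => // u z [s [ns /principalP[r e]]] [_ /= Qyz].
apply: (sat_power_sub hM iQ MQ); exists s; split=> //.
have -> : s * (u * z) = r * (y * z) by rewrite mulrA e; ring.
exact: idealMl.
Qed.

Lemma factored_bigcap n (K : 'I_n -> set R) : (forall i, is_ideal (K i)) ->
    (forall i j, i != j -> exists a b, [/\ K i a, K j b & a + b = 1]) ->
    (forall i, exists k, factored k (K i)) ->
  exists k, factored k (\bigcap_i K i).
Proof.
elim: n K => [|n IH] K iK cK fK.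
  exists 0%N; suff -> : \bigcap_i K i = setT by exact: factored0.
  by apply/seteqP; split=> // x _ [].
pose L := \bigcap_i K (lift ord0 i).
have [k0 f0] := fK ord0.
have [|||k f] := IH (fun i => K (lift ord0 i)); [by []| |by []|].
  by move=> i j ij; apply: cK; rewrite (inj_eq lift_inj).
exists (k0 + k)%N; suff -> : \bigcap_i K i = ideal_mul (K ord0) L by exact: factored_mul.
have [e he] := comaximal_orthogonal iK cK.
apply/seteqP; split; last first.
  move=> x hx i _; have [j ->|->] := unliftP ord0 i; last exact: ideal_mul_subl hx.
  have := @ideal_mulS _ (K ord0) setT L (K (lift ord0 j)) (@subsetT _ _) _ x hx.
  by rewrite ideal_mul1 //; apply=> y; exact.
move=> x hx; have -> : x = (1 - e ord0) * x + x * e ord0 by ring.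
apply: ideal_mulD; apply: ideal_mul_mem.
- by case: (he ord0).
- by move=> i _; exact: hx.
- exact: hx.
- by move=> i _; apply: (he ord0).2; rewrite eq_sym neq_lift.
Qed.

Lemma tame_ring_TAF : tame_ring R -> TAF_ring R.
Proof.
move=> [tR fR]; apply/TAF_factored => I hI; have [iI I1] := hI.
have [n [N [hN IN hM dN]]] := finitely_saturated_reduced (fR I hI).
rewrite [I](finitely_saturated_cap iI hN hM).
have pN i := maximal_ideal_prime (hN i).
have iK i : is_ideal (saturation (N i) I) by exact: sat_ideal.
apply: factored_bigcap => // [i j /dN ij|i].
  by case: (tame_comaximal tR iI (hN i) (hN j) (IN i) (IN j)).
have [[k hk]|[-> p0 _]] := tame_sat_cases (hN i) (tR _ (hN i)) iI.
  by apply: (factored_power (hN i)) hk _ => //; [exact: tR|exact: sat_proper].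
by exists 1%N; apply: factored1; exact: prime_absorbing2.
Qed.

End TwoAbsorbing.

(** * Local TAF-rings *)

Section LocalTAF.
Variables (R : comNzRingType) (M : set R).
Hypotheses (lM : local_at M) (hR : TAF_ring R).
Let hM : is_maximal_ideal M := lM.1.
Let pM : is_prime_ideal M := maximal_ideal_prime hM.
Let iM : is_ideal M := maximal_ideal hM.
Implicit Types (I J P Q A : set R) (x y : R).

Let fR I : is_proper_ideal I -> exists n, factored n I.
Proof. by move/(iffLR (TAF_factored R) hR). Qed.

Lemma local_factored_exp n I : factored n I -> I `<=` ideal_exp M n.
Proof.
elim=> [|k J A [hJ _] _ IH]; first by rewrite ideal_exp0.
by rewrite ideal_expS; apply: ideal_mulS => //; exact: local_sub.
Qed.

(** A 2-absorbing factor that contains some power of y contains y^2, so n factors contain y^(2n). *)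
Lemma factored_pow n I y k : factored n I -> I (y ^+ k) -> I (y ^+ (n + n)).
Proof.
elim=> [//|m J A hJ fA IH] Iy; have iJ : is_ideal J by case: hJ => -[].
have iA' := factored_ideal fA.
have -> : y ^+ (m.+1 + m.+1) = y ^+ 2 * y ^+ (m + m).
  by rewrite -exprD addSn addnS.
apply: ideal_mul_mem; first by apply: (absorbing2_sqr hJ (n := k)); exact: ideal_mul_subl Iy.
by apply: IH; exact: ideal_mul_subr Iy.
Qed.

(* P + y^(2n) R is a product of at least n ideals, since each factor contains y^2. *)
Lemma local_prime_exp P n : is_prime_ideal P -> P `<=` M -> P <> M -> P `<=` ideal_exp M n.
Proof.
move=> hP PM nPM; have iP := prime_ideal_ideal hP.
have [MP|/existsNP[y /not_implyP[My ny]]] := pselect (M `<=` P).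
  by case: nPM; apply/seteqP.
pose I := ideal_add P (principal (y ^+ (n + n))).
have iy := principal_ideal (y ^+ (n + n)).
have hI : is_ideal I by exact: ideal_add_ideal.
case: n @I iy hI => [|n] I iy hI; first by rewrite ideal_exp0.
have IM : I `<=` M.
  apply: ideal_add_sub => //; apply: principal_sub => //.
  by rewrite addSn exprS; exact: idealMr.
have [|m fI] := fR (I := I); first by split=> // /IM; exact: prime_n1.
have [nm|mn] := leqP n.+1 m.
  apply: subset_trans (ideal_addl iy) _; apply: subset_trans (local_factored_exp fI) _.
  exact: ideal_exp_le.
have : I (y ^+ (m + m)).
  apply: (factored_pow (k := (n.+1 + n.+1)%N)) => //; apply: ideal_addr => //.
  exact: principal_mem.
move=> [p [_ [Pp /principalP[r ->] e]]].
have lt : (m + m < n.+1 + n.+1)%N by rewrite -ltnS; apply: leq_add; rewrite // ltnW.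
(* With m < n+1 factors, y^(2m) is an element of P plus a multiple of y^(2n+2). Factoring out y^(2m)
   leaves a unit, against y outside P. *)
have Pz : P (y ^+ (m + m) * (1 - y ^+ (n.+1 + n.+1 - (m + m)) * r)).
  have -> : y ^+ (m + m) * (1 - y ^+ (n.+1 + n.+1 - (m + m)) * r) = p => [|//].
  rewrite mulrBr mulr1 mulrA -exprD subnKC; last exact: ltnW.
  by rewrite e addrK.
have [/(prime_expP hP)//|/PM h] := prime_mulP hP Pz.
case: (prime_n1 pM); rewrite -[1](subrK (y ^+ (n.+1 + n.+1 - (m + m)) * r)).
apply: idealD => //; apply: idealMr => //.
by move: lt; rewrite -subn_gt0; case: (_ - _)%N => // d _; rewrite exprS; exact: idealMr.
Qed.

(** Two or more factors would put I inside M^2, and no factor would make I the whole ring. *)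
Lemma local_absorbing2 I : is_proper_ideal I -> ~ (I `<=` ideal_exp M 2) -> is_absorbing 2 I.
Proof.
move=> hI nI; have [[|[|n]] fI] := fR hI.
- by inversion fI; case: hI => _; rewrite -H0.
- inversion fI as [|m J A hJ fA eI eA].
  inversion fA as [eT|]; rewrite ideal_mulC ideal_mul1 //.
  by case: hJ => -[].
- case: nI; apply: subset_trans (local_factored_exp fI) _.
  exact: ideal_exp_le.
Qed.

Lemma local_radical I m : is_ideal I -> (forall P, is_prime_ideal P -> I `<=` P -> P = M) ->
  M m -> radical I m.
Proof.
move=> hI h Mm; apply: contrapT => /(exists_prime_avoiding_powers hI)[P [hP IP nP]].
by apply: nP; rewrite (h P).
Qed.

Lemma local_proper_prime P : is_prime_ideal P -> P `<=` M.
Proof. by move=> hP; apply: local_sub => //; case: hP. Qed.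

(** By [local_absorbing2] the ideal yR is 2-absorbing. Primes other than M lie in M^2 and miss y, so
    M is the radical of yR and [absorbing2_radical] applies. *)
Lemma local_exp2_sub y : M y -> ~ ideal_exp M 2 y -> ideal_exp M 2 `<=` principal y.
Proof.
move=> My ny; have iy := principal_ideal y; have yM := principal_sub iM My.
have hy : is_absorbing 2 (principal y).
  apply: local_absorbing2; first by split=> // /yM; exact: prime_n1.
  by move=> h; apply: ny; apply: h; exact: principal_mem.
rewrite ideal_exp2 //; apply: absorbing2_radical => // m; apply: local_radical => // P hP yP.
apply: contrapT => nPM; apply: ny.
apply: (@local_prime_exp P 2 hP (local_proper_prime hP) nPM).
by apply: yP; exact: principal_mem.
Qed.

(** A 2-absorbing factor with an element of order l contains M^(l+1). So all factors contain a power
    of M, or one of them lies in every power and is moved to the front. *)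
Lemma local_factored_cases n I : factored n I ->
  (exists t, ideal_exp M t `<=` I) \/
  (exists J A, [/\ is_absorbing 2 J, forall k, J `<=` ideal_exp M k & I = ideal_mul J A]).
Proof.
elim=> [|k J A hJ fA IH]; first by left; exists 0%N.
have iJ : is_ideal J by case: hJ => -[].
have [Jk|/existsNP[k' /existsNP[j /not_implyP[Jj nj]]]] :=
    pselect (forall k, J `<=` ideal_exp M k).
  by right; exists J, A.
have [l [Ml nl]] : exists l, ideal_exp M l j /\ ~ ideal_exp M l.+1 j.
  apply: contrapT => h; apply: nj; elim: k' => [|i IHi]; first by rewrite ideal_exp0.
  by apply: contrapT => ni; apply: h; exists i.
case: IH => [[t Mt]|[J' [A' [hJ' J'k ->]]]]; [left|right].
  exists (l.+1 + t)%N; rewrite ideal_expD //; apply: ideal_mulS => //.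
  apply: subset_trans (local_sat lM iJ).
  have h2 y : M y -> ~ ideal_exp M 2 y -> ideal_exp M 2 `<=` saturation M (principal y).
    by move=> My ny; apply: subset_trans (local_exp2_sub My ny) _; exact: sat_sub.
  apply: subset_trans (exp_sub_scale hM h2 Ml nl) _.
  by apply: satS => _ [m _ <-]; exact: idealMr.
exists J', (ideal_mul J A'); split=> //.
by rewrite ideal_mulA [ideal_mul J J']ideal_mulC -ideal_mulA.
Qed.

(* If x lies in every power of M, then some 2-absorbing factor J of xR does as well;
   then J = yJ for y in M outside M^2, so that xR = y xR. *)
Lemma local_TAF_tame : ~ (M `<=` ideal_exp M 2) -> tame_at M.
Proof.
move=> /existsNP[y /not_implyP[My ny]].
have h2 y' : M y' -> ~ ideal_exp M 2 y' -> ideal_exp M 2 `<=` saturation M (principal y').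
  by move=> My' ny'; apply: subset_trans (local_exp2_sub My' ny') _; exact: sat_sub.
split=> // x hx; have Mx : M x by have := hx 1%N; rewrite ideal_exp1.
have ix := principal_ideal x; have xM := principal_sub iM Mx.
have [|n fx] := fR (I := principal x); first by split=> // /xM; exact: prime_n1.
have fix_x r : M r -> x = r * x -> saturation M [set 0] x.
  by move=> Mr e; apply: (sat0_fix pM (prime_n1 pM) Mr); rewrite mul1r.
(* If xR contains M^t, then x, being in M^(t+1), is in xM. *)
have [[t Mt]|[J [A [hJ JM ex]]]] := local_factored_cases fx.
  have : ideal_mul (principal x) M x.
    rewrite ideal_mulC; apply: (ideal_mulS (subset_refl (A := M)) Mt).
    by rewrite -ideal_expS.
  have : ideal_mul (principal x) M `<=` [set x * m | m in M].
    apply: ideal_mul_sub; first exact: scale_ideal.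
    move=> _ m /principalP[r ->] Mm; exists (r * m); first exact: idealMl.
    by rewrite mulrA.
  by move=> h /h[m Mm e]; apply: (fix_x m Mm); rewrite mulrC.
have iJ : is_ideal J by case: hJ => -[].
have J3 j : J j -> exists2 m, M m & j = y ^+ 2 * m.
  move=> /(JM 3%N) /(exp_sub_sat_pow hM ny (h2 y My ny) (n := 2)) h.
  have i3 := scale_ideal (y ^+ 2) iM.
  by have [m Mm <-] := local_sat lM i3 h; exists m.
(* If y^2 is in J, it is in y^2 M and so vanishes; then M^3 vanishes, and x with it. *)
have [/J3[m Mm e]|nJ] := pselect (J (y ^+ 2)).
  have y0 : saturation M [set 0] (y ^+ 2).
    by apply: (sat0_fix pM (prime_n1 pM) Mm); rewrite mul1r mulrC.
  have := exp_sub_sat_pow hM ny (h2 y My ny) (hx 3%N); apply: sat_subl => // _ [m' _ <-].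
  by apply: idealMr => //; exact: sat0_ideal.
(* For j = y y m in J with y^2 outside J, the 2-absorbing property leaves only y m in J. *)
have Jy j : J j -> exists2 j', J j' & j = y * j'.
  move=> Jj; have [m Mm e] := J3 j Jj; exists (y * m); last by rewrite e expr2 mulrA.
  have : J (y * y * m) by rewrite -expr2 -e.
  by case/(absorbing2P hJ) => //; rewrite -expr2.
have : [set y * z | z in principal x] x.
  have : ideal_mul J A x by rewrite -ex; exact: principal_mem.
  rewrite ex; apply: ideal_mul_ind => [|_ _ [u Ju <-] [v Jv <-]|j a /Jy[j' Jj' ->] Aa].
  - by exists 0; [exact: ideal_mul0|rewrite mulr0].
  - by exists (u + v); [exact: ideal_mulD|rewrite mulrDr].
  - by exists (j' * a); [exact: ideal_mul_mem|rewrite mulrA].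
move=> [_ /principalP[r ->] e]; apply: (fix_x (y * r)); first exact: idealMr.
by rewrite -mulrA [r * x]mulrC.
Qed.

(* Every 2-absorbing factor of P + xR contains M^2 = M, so M = P + xR = P + x^2 R. *)
Lemma local_TAF_idempotent P x : M `<=` ideal_exp M 2 -> is_ideal P -> P `<=` M -> M x ->
    (forall Q, is_prime_ideal Q -> P `<=` Q -> Q x -> Q = M) -> P x.
Proof.
move=> MM iP PM Mx h; have ix := principal_ideal x.
pose I := ideal_add P (principal x).
have hI : is_ideal I by exact: ideal_add_ideal.
have IM : I `<=` M by apply: ideal_add_sub => //; exact: principal_sub.
have MI m : M m -> radical I m.
  apply: local_radical => // Q hQ IQ; apply: h => //.
    by apply: subset_trans IQ; exact: ideal_addl.
  by apply: IQ; apply: ideal_addr => //; exact: principal_mem.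
have [|n fI] := fR (I := I); first by split=> // /IM; exact: prime_n1.
have {}MI : M `<=` I.
  (* As M is idempotent it equals M^(2n), and each of the n factors takes one M^2. *)
  apply: subset_trans (idempotent_exp hM MM (n + n)) _.
  elim: fI MI => [//|k J A hJ fA IH] MI; have [[iJ _] _] := hJ; have iA := factored_ideal fA.
  have -> : (k.+1 + k.+1 = 2 + (k + k))%N by rewrite addSn addnS.
  rewrite ideal_expD // ideal_exp2 //; apply: ideal_mulS.
    by apply: absorbing2_radical => // m /MI[d h']; exists d; exact: ideal_mul_subl h'.
  by apply: IH => m /MI[d h']; exists d; exact: ideal_mul_subr h'.
have : ideal_add P (principal (x ^+ 2)) x.
  have iJ : is_ideal (ideal_add P (principal (x ^+ 2))).
    by apply: ideal_add_ideal => //; exact: principal_ideal.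
  move: (MM x Mx); rewrite ideal_exp2 //.
  apply: ideal_mul_sub => // u v /MI[p [_ [Pp /principalP[r ->] ->]]].
  move=> /MI[q [_ [Pq /principalP[t ->] ->]]].
  exists (p * (q + x * t) + x * r * q), (x ^+ 2 * (r * t)); split.
  - by apply: idealD => //; [exact: idealMr|exact: idealMl].
  - by apply/principalP; exists (r * t).
  - by ring.
move=> [p [_ [Pp /principalP[r ->] e]]].
have n1 : ~ M (1 - x * r).
  move=> h1; apply: (prime_n1 pM); rewrite -[1](subrK (x * r)).
  by apply: idealD => //; exact: idealMr.
apply: (local_sat lM iP); exists (1 - x * r); split=> //.
have -> : (1 - x * r) * x = x - x ^+ 2 * r by ring.
by rewrite {1}e addrK.
Qed.

End LocalTAF.

(** * TAF-rings under localization *)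

Section TAFLocalization.
Variables (R S : comNzRingType) (f : {rmorphism R -> S}) (M : set R) (N : set S).
Hypotheses (fMN : local_iso f M N) (lN : local_at N).
Let pM : is_prime_ideal M. Proof. by case: fMN. Qed.
Implicit Types (I J P : set R).

Definition extension J : set S := [set a | exists t x, [/\ ~ M t, J x & f t * a = f x]].

Lemma extensionP J : extends_to f M J (extension J).
Proof.
split=> // x Jx; exists 1, x; split=> //; first exact: prime_n1.
by rewrite rmorph1 mul1r.
Qed.

Lemma extension_mem J x : is_ideal J -> extension J (f x) <-> saturation M J x.
Proof.
move=> hJ; split=> [[t [y [nt Jy]]]|[s [ns Jx]]].
  rewrite -rmorphM => /(liso_ker fMN)[s [ns e]].
  exists (s * t); rewrite -mulrA e; split; first exact: prime_nmul.
  exact: idealMl.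
by exists s, (s * x); rewrite rmorphM.
Qed.

Lemma extension_ideal J : is_ideal J -> is_ideal (extension J).
Proof.
move=> hJ; split.
- by exists 1, 0; rewrite mulr0 rmorph0; split=> //; [exact: prime_n1|exact: ideal0].
- move=> a b [t [x [nt Jx e]]] [u [y [nu Jy g]]].
  exists (t * u), (u * x + t * y); split; first exact: prime_nmul.
    by apply: idealD => //; exact: idealMl.
  by rewrite rmorphD !rmorphM -e -g; ring.
- move=> b a [t [x [nt Jx e]]]; have [u [y [nu g]]] := liso_lift fMN b.
  exists (t * u), (x * y); split; [exact: prime_nmul|exact: idealMr|].
  by rewrite !rmorphM -e -g; ring.
Qed.

Lemma extension_unique J (J' : set S) : is_ideal J' -> extends_to f M J J' -> J' = extension J.
Proof.
move=> hJ' [JJ J'J]; apply/seteqP; split=> // a [t [x [nt Jx e]]].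
apply: (local_sat lN hJ'); exists (f t); split; first exact: (liso_nmem fMN).
by rewrite e; exact: JJ.
Qed.

Lemma extension_mul I J : is_ideal I -> extension (ideal_mul I J) =
  ideal_mul (extension I) (extension J).
Proof.
move=> hI; apply/esym/extension_unique.
  by apply: ideal_mul_ideal; exact: extension_ideal.
by apply: (extends_mul fMN) => //; exact: extensionP.
Qed.

Lemma extension_absorbing2 J : is_absorbing 2 J -> is_proper_ideal (extension J) ->
  is_absorbing 2 (extension J).
Proof.
move=> [[iJ J1] h] hE; split=> // a [t [x [nt Jx e]]].
have /choice[ty hty] : forall i, exists ty : R * R, ~ M ty.1 /\ f ty.1 * a i = f ty.2.
  by move=> i; have [u [y]] := liso_lift fMN (a i); exists (u, y).
have [|v [nv ev]] := @liso_ker _ _ _ _ _ fMN (t * \prod_i (ty i).2) ((\prod_i (ty i).1) * x).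
  rewrite !rmorphM !rmorph_prod -e mulrCA -big_split /=; congr (_ * _).
  by apply: eq_bigr => i _; case: (hty i).
have nw : ~ M (v * t) by exact: prime_nmul.
(* The correction v t is spread over all numerators, so that it is still matched by denominators
   outside M whichever factor is dropped. *)
have [|i Ji] := h (fun i => v * t * (ty i).2).
  rewrite big_split /= prodr_const card_ord exprSr -mulrA; apply: idealMl => //.
  by rewrite -mulrA ev mulrA; exact: idealMl.
exists i, (\prod_(j | j != i) (v * t * (ty j).1)), (\prod_(j | j != i) (v * t * (ty j).2)).
split=> //.
  apply: prime_nprod => // j _; apply: prime_nmul => //.
  by case: (hty j).
rewrite !rmorph_prod -big_split /=; apply: eq_bigr => j _.
by have [_ ej] := hty j; rewrite !rmorphM -ej mulrA.
Qed.

Lemma extension_factored n J : factored n J -> exists m, @factored S m (extension J).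
Proof.
have ET : extension setT = setT.
  by apply/esym/extension_unique => //; exact: (extends_setT fMN).
elim=> [|k K A hK fA [m fEA]]; first by exists 0%N; rewrite ET; exact: factored0.
have iK : is_ideal K by case: hK => -[].
rewrite extension_mul //; have iE := extension_ideal iK.
(* A factor not inside M extends to the whole ring and disappears, so the number of factors may
   fall. *)
have [E1|E1] := pselect (extension K 1); last first.
  by exists m.+1; apply: factoredS => //; exact: extension_absorbing2.
exists m; have -> : extension K = setT by apply/seteqP; split=> // a _; exact: ideal_all.
by rewrite ideal_mul1 //; exact: factored_ideal fEA.
Qed.

Lemma TAF_local_iso : TAF_ring R -> TAF_ring S.
Proof.
move=> /TAF_factored hR; apply/TAF_factored => I [iI I1].
have iJ : is_ideal (f @^-1` I).
  split; rewrite /preimage /=; first by rewrite rmorph0; exact: ideal0.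
  - by move=> x y Ix Iy; rewrite rmorphD; exact: idealD.
  - by move=> a x Ix; rewrite rmorphM; exact: idealMl.
have [|n fJ] := hR (f @^-1` I); first by split=> //; rewrite /preimage /= rmorph1.
suff -> : I = extension (f @^-1` I) by exact: extension_factored fJ.
apply: extension_unique => //; split=> // a Ia.
have [t [x [nt e]]] := liso_lift fMN a; exists t, x; split=> //.
by rewrite /preimage /= -e; exact: idealMl.
Qed.

Lemma extension_prime P : is_prime_ideal P -> P `<=` M -> is_prime_ideal (extension P).
Proof.
move=> hP PM; have iP := prime_ideal_ideal hP.
have mem x : extension P (f x) -> P x.
  by move=> /extension_mem h; apply: (sat_prime hP PM (subset_refl (A := P))); exact: h.
split; first split; first exact: extension_ideal.
  by rewrite -(rmorph1 f) => /mem; exact: prime_n1.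
move=> a b Pab; have [t [x [nt e]]] := liso_lift fMN a.
have [u [y [nu g]]] := liso_lift fMN b.
have : P (x * y).
  apply: mem; rewrite rmorphM -e -g mulrACA; apply: idealMl => //.
  exact: extension_ideal.
by move=> /(prime_mulP hP)[Px|Py]; [left; exists t, x|right; exists u, y].
Qed.

End TAFLocalization.

(** * Tameness of TAF-rings *)

Section TAFTame.
Variable R : comNzRingType.
Implicit Types (I J P Q M A : set R) (x y : R).

(* If M = M^2 were nonzero, there would be primes P < Q < Q' in M such that Q' is
   minimal over Q + zR; the localization at Q' is then tame, which leaves no
   room for two primes below Q'. *)
Lemma local_TAF_idempotent_eq0 M x : local_at M -> TAF_ring R ->
  M `<=` ideal_exp M 2 -> M x -> x = 0.
Proof.
move=> lM hR MM Mx; have hM := lM.1; have pM := maximal_ideal_prime hM.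
have strict P y : is_ideal P -> P `<=` M -> M y -> ~ P y ->
    exists Q, [/\ is_prime_ideal Q, P `<=` Q, Q y & Q <> M].
  move=> iP PM My nPy; apply: contrapT => h; apply: nPy.
  apply: (local_TAF_idempotent lM hR MM iP PM My) => Q hQ PQ Qy.
  by apply: contrapT => nQM; apply: h; exists Q.
have below P : is_prime_ideal P -> P `<=` M by apply: local_proper_prime.
have outside P : is_prime_ideal P -> P <> M -> exists2 y, M y & ~ P y.
  move=> hP nPM; apply: contrapT => h; apply: nPM; apply/seteqP; split; first exact: below.
  by move=> y My; apply: contrapT => nPy; apply: h; exists y.
apply: contrapT => x0; have [_ ->|P [hP _ _ nPM]] := strict [set 0] x (@is_ideal0 R) _ Mx x0.
  by apply: ideal0; exact: maximal_ideal.
have [y My nPy] := outside P hP nPM; have iP := prime_ideal_ideal hP.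
have [Q1 [hQ1 PQ1 Q1y nQ1M]] := strict P y iP (below P hP) My nPy.
have [z Mz nQ1z] := outside Q1 hQ1 nQ1M; have iQ1 := prime_ideal_ideal hQ1.
pose I := ideal_add Q1 (principal z).
have IM : I `<=` M.
  apply: ideal_add_sub; [exact: maximal_ideal|exact: below|].
  by apply: principal_sub => //; exact: maximal_ideal.
have [Q' [hQ' IQ' _ minQ']] := exists_minimal_prime pM IM.
have Q1Q' : Q1 `<=` Q' by apply: subset_trans IQ'; exact/ideal_addl/principal_ideal.
have Q'z : Q' z by apply: IQ'; apply: ideal_addr => //; exact: principal_mem.
pose f : {rmorphism R -> localization hQ'} := loc_of hQ'; pose N := @loc_max R Q' hQ'.
have lN : local_at N := loc_local hQ'; have li : local_iso f Q' N := loc_of_local_iso hQ'.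
have hN := lN.1; have hS : TAF_ring (localization hQ') := TAF_local_iso li lN hR.
have ext_mem P' w : is_prime_ideal P' -> P' `<=` Q' -> extension f Q' P' (f w) -> P' w.
  move=> hP' P'Q' /(extension_mem li _ (prime_ideal_ideal hP')).
  by move: w; apply: sat_prime => //; exact: subset_refl.
have ext_sub P' : is_prime_ideal P' -> P' `<=` Q' -> extension f Q' P' `<=` N.
  move=> hP' P'Q' a [t [w [nt P'w e]]]; have := liso_nmem li nt.
  have : N (f w) by apply/(liso_mem li); exact: P'Q'.
  by rewrite -e => /(prime_mulP (maximal_ideal_prime hN))[].
have tN : tame_at N.
  (* Minimality of Q' makes N the only prime over the extension of Q1 and z. Were N idempotent,
     [local_TAF_idempotent] would put z in Q1. *)
  apply: (local_TAF_tame lN hS) => NN; apply: nQ1z; apply: (ext_mem Q1) => //.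
  apply: (local_TAF_idempotent lN hS NN).
  - exact: (extension_ideal li).
  - exact: ext_sub.
  - exact/(liso_mem li).
  move=> T hT Q1T Tz; have iT := prime_ideal_ideal hT.
  have TN : T `<=` N by apply: (local_proper_prime lN).
  have eQ' : f @^-1` T = Q'.
    apply: minQ'.
    - split; first split; first split; rewrite /preimage /=.
      + by rewrite rmorph0; exact: ideal0.
      + by move=> u v Tu Tv; rewrite rmorphD; exact: idealD.
      + by move=> u v Tv; rewrite rmorphM; exact: idealMl.
      + by rewrite rmorph1; exact: prime_n1.
      + by move=> u v; rewrite rmorphM; exact: prime_mulP.
    - move=> _ [u [_ [Q1u /principalP[r ->] ->]]]; rewrite /preimage /= rmorphD rmorphM.
      apply: idealD => //; last exact: idealMr.
      by apply: Q1T; exact: ((extensionP li Q1).1 u Q1u).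
    - by move=> u /TN /(liso_mem li).
  apply/seteqP; split=> // a Na; have [t [w [nt e]]] := liso_lift li a.
  have : T (f w).
    have : Q' w by apply/(liso_mem li); rewrite -e; apply: idealMl => //; exact: maximal_ideal.
    by rewrite -[X in X w]eQ'.
  by rewrite -e => /(prime_mulP hT)[/TN /(liso_mem li)|].
have pE := extension_prime li hQ1 Q1Q'; have pEP : P `<=` Q' by apply: subset_trans PQ1 Q1Q'.
(* The extension of Q1 differs from N because of z, so it lies in the saturation of 0 and hence in
   the extension of P; but y is in Q1 and not in P. *)
have [eN|sub] := tame_prime hN tN pE (ext_sub Q1 hQ1 Q1Q').
  by apply: nQ1z; apply: (ext_mem Q1) => //; rewrite eN; exact/(liso_mem li).
apply: nPy; apply: (ext_mem P) => //.
apply: (sat_prime (extension_prime li hP pEP) (ext_sub P hP pEP)) (sub _ _).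
  by move=> _ ->; apply: ideal0; exact: (extension_ideal li).
by move: Q1y; exact: (extensionP li Q1).1.
Qed.

End TAFTame.

Section TAFGlobal.
Variable R : comNzRingType.
Implicit Types (I J P Q M A : set R) (x y : R).

Lemma TAF_tame M : TAF_ring R -> is_maximal_ideal M -> tame_at M.
Proof.
move=> hR hM; have hP := maximal_ideal_prime hM.
have li := loc_of_local_iso hP; have lN := loc_local hP; have hN := lN.1.
apply: (liso_tame li hM); have hS := TAF_local_iso li lN hR.
have [NN|] := pselect (@loc_max R M hP `<=` ideal_exp (@loc_max R M hP) 2); last first.
  exact: (local_TAF_tame lN).
have N0 := local_TAF_idempotent_eq0 lN hS NN.
split=> [y Ny []|x hx]; first exact: NN.
rewrite (N0 x); first by apply: ideal0; apply: sat0_ideal; exact: maximal_ideal_prime.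
by have := hx 1%N; rewrite ideal_exp1 //; exact: maximal_ideal.
Qed.

Hypothesis tR : forall M, is_maximal_ideal M -> tame_at M.

(** If the saturation of IJ at M contains a power of M, then M itself belongs to the family of the
    factor that it contains. Otherwise it is a prime containing one factor, I say; the saturation of
    I at M is then one listed as taken at some [N t], and that of IJ agrees at M and [N t], since
    the two are not comaximal. *)
Lemma finitely_saturated_mul I J : is_ideal I -> is_ideal J ->
  finitely_saturated I -> finitely_saturated J -> finitely_saturated (ideal_mul I J).
Proof.
have half A B T (N : T -> set R) M : is_ideal A -> is_ideal B -> 
    (forall t, is_maximal_ideal (N t) /\ A `<=` N t) ->
    (forall M, is_maximal_ideal M -> A `<=` M -> exists t, saturation M A = saturation (N t) A) ->
    is_maximal_ideal M -> 
    (exists2 k, ideal_exp M k `<=` saturation M (ideal_mul A B) & A `<=` M) \/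
    (A `<=` saturation M [set 0] /\
     saturation M (ideal_mul A B) = saturation M [set 0]) ->
    exists t, saturation M (ideal_mul A B) = saturation (N t) (ideal_mul A B).
  move=> iA iB hN hA hM hAB; have pM := maximal_ideal_prime hM.
  have iAB : is_ideal (ideal_mul A B) by exact: ideal_mul_ideal.
  have ABA : ideal_mul A B `<=` A by exact: ideal_mul_subl.
  case: hAB => [[k Mk AM]|[A0 e]].
    have [t et] := hA M hM AM; exists t; have [mN AN] := hN t.
    have pN := maximal_ideal_prime mN.
    suff -> : N t = M by [].
    apply: (maximal_sub_eq hM); [exact: maximal_ideal|exact: maximal_n1|].
    apply: (prime_ideal_exp pN (n := k)); apply: subset_trans Mk _.
    by apply: subset_trans (satS ABA) _; rewrite et; exact: sat_proper.
  have AM : A `<=` M.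
    apply: subset_trans A0 _; apply: sat_proper => // _ ->.
    by apply: ideal0; exact: maximal_ideal.
  have [t et] := hA M hM AM; exists t; have [mN AN] := hN t.
  have pN := maximal_ideal_prime mN.
  have eMA : saturation M A = saturation M [set 0].
    by apply/seteqP; split; [exact: sat_subl|exact: sat0_sub].
  have ABM := subset_trans ABA AM; have ABN := subset_trans ABA AN.
  have [//|[a [b [Ma Nb e1]]]] := tame_comaximal tR iAB hM mN ABM ABN.
  case: (maximal_n1 mN); rewrite -e1; apply: idealD; first exact: maximal_ideal.
    by move: a Ma {e1}; rewrite e -eMA et; exact: sat_proper.
  by move: b Nb {e1}; exact: sat_proper.
move=> iI iJ [T [N [hN hI]]] [T' [N' [hN' hJ]]].
have iIJ : is_ideal (ideal_mul I J) by exact: ideal_mul_ideal.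
have IJI : ideal_mul I J `<=` I by exact: ideal_mul_subl.
have IJJ : ideal_mul I J `<=` J by exact: ideal_mul_subr.
exists (T + T')%type, (fun t => match t with inl t => N t | inr t => N' t end); split.
  move=> [t|t]; [have [mN IN] := hN t|have [mN IN] := hN' t]; split=> //.
    exact: subset_trans IN.
  exact: subset_trans IN.
move=> M hM IJM; have pM := maximal_ideal_prime hM.
have left_case : (exists2 k, ideal_exp M k `<=` saturation M (ideal_mul I J) & I `<=` M) \/
    (I `<=` saturation M [set 0] /\
     saturation M (ideal_mul I J) = saturation M [set 0]) ->
    exists t : T + T', saturation M (ideal_mul I J) =
      saturation (match t with inl t => N t | inr t => N' t end) (ideal_mul I J).
  by move=> /(half I J T N M iI iJ hN hI hM)[t]; exists (inl t).
have right_case : (exists2 k, ideal_exp M k `<=` saturation M (ideal_mul I J) & J `<=` M) \/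
    (J `<=` saturation M [set 0] /\
     saturation M (ideal_mul I J) = saturation M [set 0]) ->
    exists t : T + T', saturation M (ideal_mul I J) =
      saturation (match t with inl t => N t | inr t => N' t end) (ideal_mul I J).
  rewrite ideal_mulC => /(half J I T' N' M iJ iI hN' hJ hM)[t].
  by exists (inr t).
have [[k Mk]|[e p0 _]] := tame_sat_cases hM (tR hM) iIJ.
  have [IM|JM] := prime_ideal_mul pM IJM; [apply: left_case|apply: right_case].
    by left; exists k.
  by left; exists k.
have : ideal_mul I J `<=` saturation M [set 0] by rewrite -e; exact: sat_sub.
move=> /(prime_ideal_mul p0)[I0|J0]; [apply: left_case|apply: right_case].
  by right.
by right.
Qed.

Lemma factored_finitely_saturated n I : factored n I -> finitely_saturated I.
Proof.
elim=> [|k J A hJ fA IH].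
  exists void, (fun=> set0); split=> [[]|M hM sub].
  by case: (maximal_n1 hM); exact: sub.
apply: finitely_saturated_mul => //; [by case: hJ => -[]|exact: factored_ideal fA|].
exact: (absorbing_finitely_saturated tR hJ).
Qed.

End TAFGlobal.

Lemma TAF_tame_ring (R : comNzRingType) : TAF_ring R -> tame_ring R.
Proof.
move=> hR; have tR M (hM : is_maximal_ideal M) : tame_at M := TAF_tame hR hM.
split=> // I /(iffLR (TAF_factored R) hR)[n].
exact: factored_finitely_saturated.
Qed.

(** * Mori domains *)

Section Domains.
Variable D : idomainType.
Implicit Types (I J M P : set D) (a b p q x y z : D) (l : seq D).

Local Notation "x %:F" := (tofrac x).

Lemma fraction_quotient (x : {fraction D}) : exists p q : D, q != 0 /\ x * q%:F = p%:F.
Proof.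
elim/quotW: x => r; exists \n_r, \d_r; split; first exact: denom_ratioP.
rewrite !piE; apply/eqmodP; rewrite /= FracField.equivfE /FracField.mulf.
rewrite !numden_Ratio ?mulf_neq0 ?oner_neq0 ?denom_ratioP //.
by rewrite !mulr1 mulrC.
Qed.

(* (D : J) <= (D : I), with both quotients taken in the field of fractions. *)
Definition inverse_closed J I : Prop := forall p q, q != 0 ->
  (forall j, J j -> principal q (p * j)) -> forall i, I i -> principal q (p * i).

(** The Mori property in terms of generators: each nonzero ideal has the divisorial closure of
    finitely many of its elements. *)
Definition v_finite : Prop := forall I, is_ideal I -> (exists2 a, I a & a != 0) ->
  exists l, (forall j, j \in l -> I j) /\ inverse_closed [set` l] I.

Lemma divisorial_inverse_closed I J : is_divisorial I -> inverse_closed I J -> J `<=` I.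
Proof.
move=> [hI e] h z Jz.
suff [y Iy /eqP] : (@tofrac D @` I) z%:F by rewrite tofrac_eq => /eqP <-.
rewrite -e => x hx; have [p [q [q0 ex]]] := fraction_quotient x.
have q0' : q%:F != 0 by rewrite tofrac_eq0.
have [|y /esym ey] := iffLR (principalP q (p * z)) _.
  apply: (h p q q0 _ z Jz) => j Ij; have [|y _ ey] := hx j%:F; first by exists j.
  apply/principalP; exists y; apply/eqP; rewrite -tofrac_eq !tofracM ey -ex.
  by rewrite mulrAC mulrC.
exists y => //; apply: (mulIf q0'); rewrite -tofracM mulrC ey tofracM -ex.
by rewrite mulrAC [_ * x]mulrC.
Qed.

Lemma v_finite_Mori : v_finite -> Mori D.
Proof.
move=> vD I dI sI; have mono m n : (m <= n)%N -> I m `<=` I n.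
  elim: n => [|n IH]; rewrite leq_eqVlt => /orP[/eqP->//|//].
  move/IH/subset_trans; apply; exact: sI.
pose U := \bigcup_n I n.
have iI n : is_ideal (I n) by case: (dI n).
have iU : is_ideal U.
  split; first by exists 0%N => //; exact: ideal0.
  - move=> x y [m _ Ix] [n _ Iy]; exists (maxn m n) => //; apply: idealD => //.
      by apply: mono Ix; exact: leq_maxl.
    by apply: mono Iy; exact: leq_maxr.
  - by move=> a x [n _ Ix]; exists n => //; exact: idealMl.
have [[a Ua a0]|U0] := pselect (exists2 a, U a & a != 0); last first.
  have I0 n : I n = [set 0].
    apply/seteqP; split=> [x Ix|_ ->]; last exact: ideal0.
    by apply: contrapT => /eqP x0; apply: U0; exists x => //; exists n.
  by exists 0%N => n _; rewrite !I0.
have [l [lU cl]] := vD U iU (ex_intro2 _ _ a Ua a0).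
have [N lN] : exists N, forall j, j \in l -> I N j.
  elim: l lU {cl} => [|j l IH] lU; first by exists 0%N.
  have [|N lN] := IH; first by move=> i il; apply: lU; rewrite inE il orbT.
  have [m _ Ij] := lU j (mem_head _ _); exists (maxn N m) => i.
  rewrite inE => /orP[/eqP->|/lN]; first by apply: mono Ij; exact: leq_maxr.
  by apply: mono; exact: leq_maxl.
exists N => n Nn; apply/seteqP; split; last exact: mono.
apply: divisorial_inverse_closed => // p q q0 h x Inx.
by apply: (cl p q q0) => [j /lN /h//|]; exists n.
Qed.

(** This is the divisorial closure D : (D : J), with p / q running over D : J. Since J lies in D, 1
    is in D : J and the closure stays inside D. *)
Definition inverse_closure J : set D := [set z | inverse_closed J [set z]].

Lemma inverse_closure_sub J : J `<=` inverse_closure J.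
Proof. by move=> j Jj p q q0 h _ ->; exact: h. Qed.

Lemma inverse_closureS J J' : J `<=` J' -> inverse_closure J `<=` inverse_closure J'.
Proof. by move=> JJ z h p q q0 h'; apply: (h p q q0) => j /JJ; exact: h'. Qed.

Lemma inverse_closure_divisorial J : is_divisorial (inverse_closure J).
Proof.
have iq q := principal_ideal q; split.
  split=> [p q q0 h _ ->|x y hx hy p q q0 h _ ->|a x hx p q q0 h _ ->].
  - by rewrite mulr0; exact: ideal0.
  - by rewrite mulrDr; apply: idealD => //; [exact: (hx p q q0 h)|exact: (hy p q q0 h)].
  - by rewrite mulrCA; apply: idealMl => //; exact: (hx p q q0 h).
apply/seteqP; split=> [y hy|y Iy x hx]; last by rewrite mulrC; exact: hx.
have [|z _ ez] := hy 1; first by move=> _ [j Jj <-]; exists j => //; rewrite mul1r.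
rewrite mulr1 in ez; exists z => // p q q0 h _ ->.
have q0' : q%:F != 0 by rewrite tofrac_eq0.
have [|t _ et] := hy (p%:F / q%:F).
  move=> _ [u Uu <-]; have [t e] := iffLR (principalP q (p * u)) (Uu p q q0 h u (erefl _)).
  exists t => //; apply: (mulIf q0').
  by rewrite mulrAC divfK // -!tofracM e mulrC.
apply/principalP; exists t; apply/eqP; rewrite -tofrac_eq !tofracM et -ez.
by rewrite mulrCA [q%:F * _]mulrC divfK // mulrC.
Qed.

Lemma Mori_v_finite : Mori D -> v_finite.
Proof.
move=> mD I iI [a Ia a0]; apply: contrapT => nfin.
have /choice[g hg] : forall l, exists i,
    (forall j, j \in l -> I j) -> I i /\ ~ inverse_closure [set` l] i.
  move=> l; apply: contrapT => /forallNP h; apply: nfin; exists l.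
  have lI : forall j, j \in l -> I j.
    by apply: contrapT => nl; apply: (h 0) => /nl.
  split=> // p q q0 hl i Ii; apply: contrapT => ni; apply: (h i) => _; split=> // hi.
  by apply: ni; exact: (hi p q q0 hl).
(* [g l] lies in I outside the divisorial closure of [l], so adjoining it repeatedly makes these
   closures increase strictly. *)
pose l n := iter n (fun l => g l :: l) [:: a].
have lI n : forall j, j \in l n -> I j.
  elim: n => [|n IH] j; first by rewrite inE => /eqP->.
  by rewrite inE => /orP[/eqP->|/IH//]; case: (hg _ IH).
have [|n|N hN] := mD (fun n => inverse_closure [set` l n]).
- by move=> n; exact: inverse_closure_divisorial.
- by apply: inverse_closureS => j /= jl; rewrite inE jl orbT.
have [_] := hg _ (lI N); apply; rewrite -(hN N.+1) //.
by apply: inverse_closure_sub; rewrite /= mem_head.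
Qed.

Lemma domain_sat0 M x : is_prime_ideal M -> saturation M [set 0] x -> x = 0.
Proof.
move=> pM [s [ns /eqP]]; rewrite mulf_eq0 => /orP[/eqP s0|/eqP//].
by case: ns; rewrite s0; apply: ideal0; exact: prime_ideal_ideal.
Qed.

Lemma sat_common_denominator M I l : is_prime_ideal M -> is_ideal I ->
  (forall j, j \in l -> saturation M I j) ->
  exists s, ~ M s /\ forall j, j \in l -> I (s * j).
Proof.
move=> pM iI; elim: l => [|j l IH] h; first by exists 1; split=> //; exact: prime_n1.
have [|s [ns hs]] := IH; first by move=> i il; apply: h; rewrite inE il orbT.
have [t [nt It]] := h j (mem_head _ _); exists (s * t); split; first exact: prime_nmul.
move=> i; rewrite inE => /orP[/eqP->|/hs Is]; first by rewrite -mulrA; exact: idealMl.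
by rewrite mulrAC; exact: idealMr.
Qed.

Section Mori.
Hypotheses (vD : v_finite) (cD : forall M, is_maximal_ideal M -> comparable_at M).

(** A common denominator s of the finitely many generators serves all of I, because s / a multiplies
    them, hence I, into D. *)
Lemma v_finite_sat M a I : is_prime_ideal M -> is_ideal I -> I `<=` saturation M (principal a) ->
  a != 0 -> (exists2 b, I b & b != 0) -> exists s, ~ M s /\ forall i, I i -> principal a (s * i).
Proof.
move=> pM iI Isat a0 nz; have [l [lI cl]] := vD iI nz.
have [|s [ns hs]] := @sat_common_denominator M (principal a) l pM (principal_ideal a).
  by move=> j /lI /Isat.
by exists s; split=> //; exact: cl.
Qed.

(* A nonzero x in all powers of M is locally a multiple b x' of an element of the same
   kind with b in M; iterating gives a strictly ascending chain of principal ideals. *)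
Lemma v_finite_tame M : is_maximal_ideal M -> tame_at M.
Proof.
move=> hM; have pM := maximal_ideal_prime hM; have iM := maximal_ideal hM.
have cM := cD hM; split; first exact: comparable_exp2_sub.
move=> x hx; have [->|/eqP x0] := eqVneq x 0; first exact: (ideal0 (sat0_ideal pM)).
case: x0.
pose X := [set x | (forall n, ideal_exp M n x) /\ x != 0].
have step z : exists z', X z -> X z' /\ exists s b, [/\ ~ M s, M b & s * z = b * z'].
  have [[hz z0]|nX] := pselect (X z); last by exists 0 => /nX.
  have nz s : ~ M s -> s * z != 0.
    move=> ns; rewrite mulf_eq0 (negbTE z0) orbF; apply/eqP => s0.
    by apply: ns; rewrite s0; exact: ideal0.
  have [MM|/existsNP[y /not_implyP[My ny]]] := pselect (M `<=` ideal_exp M 2).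
    have [s [a [b [ns Ma Mb e]]]] := comparable_exp2 hM cM (hz 2%N).
    exists b => _; split; last by exists s, a.
    split; first by move=> n; exact: idempotent_exp.
    by apply: contraTneq (nz s ns) => b0; rewrite e b0 mulr0 eqxx.
  have y0 : y != 0.
    apply/eqP => y0; apply: ny; rewrite y0; apply: ideal0; exact: ideal_exp_ideal.
  have hy := comparable_exp2_sub hM cM My ny.
  (* Here s z = y m. As z is locally in y^(n+1) M for every n, cancelling y in the domain shows that
     m is again in all powers of M. *)
  have [s [ns [m Mm e]]] := exp_sub_sat_pow hM ny hy (hz 2%N).
  rewrite expr1 in e; exists m => _; split; last by exists s, y.
  split; last by apply: contraTneq (nz s ns) => m0; rewrite -e m0 mulr0 eqxx.
  move=> [|n]; first by rewrite ideal_exp0.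
  have [t [nt [m' Mm' e']]] := exp_sub_sat_pow hM ny hy (hz n.+2).
  apply: (exp_cancel hM nt); have -> : t * m = s * (y ^+ n * m').
    apply: (mulfI y0); transitivity (t * (y * m)); first by ring.
    by rewrite e; transitivity (s * (t * z)); [ring|rewrite -e' exprS; ring].
  apply: idealMl; first exact: ideal_exp_ideal.
  by rewrite mulrC ideal_expS; apply: ideal_mul_mem => //; exact: ideal_exp_mem.
have /choice[g hg] := step; apply/eqP; apply: contrapT => /negP x0.
pose u n := iter n g x.
have Xu n : X (u n) by elim: n => [//|n IH]; case: (hg _ IH).
pose A n := saturation M (principal (u n)).
have iA n : is_ideal (A n) by exact/sat_ideal/principal_ideal.
have sA n : A n `<=` A n.+1.
  apply: sat_subl => //; apply: principal_sub; first exact: iA.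
  have [_ [s [b [ns Mb e]]]] := hg _ (Xu n); exists s; split=> //.
  by apply/principalP; exists b; rewrite e; exact: mulrC.
have mono m n : (m <= n)%N -> A m `<=` A n.
  elim: n => [|n IH]; rewrite leq_eqVlt => /orP[/eqP->//|//].
  move/IH/subset_trans; apply; exact: sA.
pose U := \bigcup_n A n.
have iU : is_ideal U.
  split; first by exists 0%N => //; exact: ideal0.
  - move=> z w [m _ Iz] [n _ Iw]; exists (maxn m n) => //; apply: idealD => //.
      by apply: mono Iz; exact: leq_maxl.
    by apply: mono Iw; exact: leq_maxr.
  - by move=> a z [n _ Iz]; exists n => //; exact: idealMl.
have Uu n : U (u n) by exists n => //; apply: sat_sub => //; exact: principal_mem.
have [l [lU cl]] := vD iU (ex_intro2 _ _ (u 0%N) (Uu 0%N) (Xu 0%N).2).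
have [N lN] : exists N, forall j, j \in l -> A N j.
  elim: l lU {cl} => [|j l IH] lU; first by exists 0%N.
  have [|N lN] := IH; first by move=> i il; apply: lU; rewrite inE il orbT.
  have [m _ Ij] := lU j (mem_head _ _); exists (maxn N m) => i.
  rewrite inE => /orP[/eqP->|/lN]; first by apply: mono Ij; exact: leq_maxr.
  by apply: mono; exact: leq_maxl.
(* The fraction s / u_N multiplies the finite list into D, hence also u_(N+1). As u_N is locally b
   u_(N+1) with b in M, Nakayama's lemma kills u_(N+1). *)
have [s [ns hs]] := sat_common_denominator pM (principal_ideal (u N)) lN.
have [r er] := iffLR (principalP _ _) (cl s (u N) (Xu N).2 hs (u N.+1) (Uu N.+1)).
have [_ [t [b [nt Mb et]]]] := hg _ (Xu N).
have : saturation M [set 0] (u N.+1).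
  apply: (sat0_fix pM (prime_nmul pM nt ns) (idealMr r iM Mb)).
  rewrite -mulrA er; transitivity (r * (t * u N)); first by ring.
  by rewrite et; rewrite /u /=; ring.
by move=> /(domain_sat0 pM)/eqP; apply/negP; case: (Xu N.+1).
Qed.

End Mori.

(** * Finite character of tame Mori domains *)

Section FiniteCharacter.
Hypotheses (vD : v_finite) (tD : forall M, is_maximal_ideal M -> tame_at M).

(** Let A be the saturation of aD and k the largest exponent with M^k not inside A. For c in M^k
    outside A, M is the set of z with c z in A, and one s outside M multiplies A into aD; b is s
    c. *)
Lemma maximal_colon M a : is_maximal_ideal M -> M a -> a != 0 ->
  exists b, forall z, M z <-> principal a (b * z).
Proof.
move=> hM Ma a0; have pM := maximal_ideal_prime hM; have iM := maximal_ideal hM.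
pose A := saturation M (principal a).
have iA : is_ideal A by exact/sat_ideal/principal_ideal.
have Aa : A a by apply: sat_sub => //; exact: principal_mem.
have [|k0 hk0] := tame_exp_sub_sat hM (tD hM) (principal_ideal a) Aa.
  by move=> /(domain_sat0 pM)/eqP; exact/negP.
have [k [hk nk]] : exists k, ideal_exp M k.+1 `<=` A /\ ~ (ideal_exp M k `<=` A).
  apply: contrapT => h; suff : forall k, ~ (ideal_exp M k `<=` A) by move/(_ k0).
  elim=> [|k IH]; last by move=> hk; apply: h; exists k.
  rewrite ideal_exp0 => h1; apply: (maximal_n1 hM).
  by apply: (sat_proper pM (principal_sub iM Ma)); exact: h1.
have /existsNP[c /not_implyP[Mc nc]] := nk.
have [|s [ns hs]] := v_finite_sat vD pM iA (subset_refl (A := A)) a0; first by exists a.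
exists (s * c) => z; split=> [Mz|h].
  rewrite -mulrA; apply: hs; apply: hk; rewrite ideal_expS mulrC.
  exact: ideal_mul_mem.
apply: contrapT => nz; apply: nc; exists (s * z); split; first exact: prime_nmul.
by rewrite mulrAC.
Qed.

(* Every maximal M containing a is (aD : b_M); v-finiteness of the ideal generated by a and
   the b_M bounds their number. *)
Lemma finitely_many_maximal a : a != 0 -> exists (T : finType) (N : T -> set D),
  (forall t, is_maximal_ideal (N t) /\ N t a) /\
  forall M, is_maximal_ideal M -> M a -> exists t, M = N t.
Proof.
move=> a0.
pose B := [set b | exists M, [/\ is_maximal_ideal M, M a & forall z, M z <-> principal a (b * z)]].
pose J := ideal_add (principal a) (ideal_mul setT B).
have iJ : is_ideal J.
  apply: ideal_add_ideal; [exact: principal_ideal|exact/ideal_mul_ideal/ideal_setT].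
have Ja : J a.
  by apply: ideal_addl; [exact/ideal_mul_ideal/ideal_setT|exact: principal_mem].
(* A single ideal M covers its b_M, multiples of a need no ideal, and a sum is covered by the union
   of the two families. *)
pose covered j := exists (T : finType) (N : T -> set D),
  (forall t, is_maximal_ideal (N t) /\ N t a) /\
  forall w, (forall t, N t w) -> principal a (w * j).
have covered_sum l : (forall j, j \in l -> covered j) -> exists (T : finType) (N : T -> set D),
    (forall t, is_maximal_ideal (N t) /\ N t a) /\
    forall w, (forall t, N t w) -> forall j, j \in l -> principal a (w * j).
  elim: l => [|j l IH] h.
    by exists void, (fun=> set0); split=> [[]|].
  have [|T [N [hN hw]]] := IH; first by move=> i il; apply: h; rewrite inE il orbT.
  have [T' [N' [hN' hw']]] := h j (mem_head _ _).
  exists (T + T')%type, (fun t => match t with inl t => N t | inr t => N' t end).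
  split=> [[]//|w hNw i]; rewrite inE => /orP[/eqP->|il].
    by apply: hw' => t; exact: (hNw (inr t)).
  by apply: hw => // t; exact: (hNw (inl t)).
have coveredD x y : covered x -> covered y -> covered (x + y).
  move=> cx cy; have [|T [N [hN hw]]] := covered_sum [:: x; y].
    by move=> j; rewrite !inE => /orP[]/eqP->.
  exists T, N; split=> // w hNw; rewrite mulrDr; apply: idealD; first exact: principal_ideal.
    by apply: hw => //; rewrite mem_head.
  by apply: hw => //; rewrite !inE eqxx orbT.
have cJ j : J j -> covered j.
  have cP r : covered (a * r).
    exists void, (fun=> set0); split=> [[]|w _]; apply/principalP.
    by exists (w * r); ring.
  move=> [_ [z [/principalP[r ->] hz ->]]]; apply: (coveredD) => //.
  move: z hz; apply: (@ideal_mul_ind D setT B covered) => [||r' b _ [M [hM Ma hb]]].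
  - by have := cP 0; rewrite mulr0.
  - exact: coveredD.
  exists unit, (fun=> M); split=> // w /(_ tt)/hb h.
  have -> : w * (r' * b) = r' * (b * w) by ring.
  by apply: idealMl => //; exact: principal_ideal.
have nz : exists2 b, J b & b != 0 by exists a.
have [l [lJ cl]] := vD iJ nz.
have [|T [N [hN hw]]] := covered_sum l; first by move=> j /lJ; exact: cJ.
exists T, N; split=> // M hM Ma; apply: contrapT => nM.
have /choice[w hw'] t : exists w, N t w /\ ~ M w.
  apply: contrapT => h; apply: nM; exists t; have [mN _] := hN t.
  apply: (maximal_sub_eq mN); [exact: maximal_ideal|exact: maximal_n1|].
  by move=> w Nw; apply: contrapT => nMw; apply: h; exists w.
have [b hb] := maximal_colon hM Ma a0.
have Jb : J b.
  apply: ideal_addr; first exact: principal_ideal.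
  by rewrite -[b]mul1r; apply: ideal_mul_mem => //; exists M.
have nw : ~ M (\prod_t w t).
  apply: (prime_nprod (maximal_ideal_prime hM)) => t _.
  by case: (hw' t).
(* The product of the w t lies in every N t, so it multiplies [l], hence J and its element b, into
   aD; but then it belongs to M. *)
apply: nw; apply/hb; rewrite mulrC; apply: (cl _ _ a0) => // j jl.
apply: hw => // t; rewrite (bigD1 t) //=; apply: idealMr; last by case: (hw' t).
by apply: maximal_ideal; case: (hN t).
Qed.

Lemma v_finite_finitely_saturated I : is_proper_ideal I -> finitely_saturated I.
Proof.
move=> [iI I1]; have [[a Ia a0]|I0] := pselect (exists2 a, I a & a != 0).
  have [T [N [hN hM]]] := finitely_many_maximal a0.
  exists {t : T | `[< I `<=` N t >]}, (fun t => N (val t)); split.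
    by move=> [t /= /asboolP It]; split=> //; case: (hN t).
  move=> M mM IM; have [t eM] := hM M mM (IM a Ia).
  have It : `[< I `<=` N t >] by apply/asboolP; rewrite -eM.
  by exists (exist _ t It); rewrite /= -eM.
have {}I0 : I = [set 0].
  apply/seteqP; split=> [x Ix|_ ->]; last exact: ideal0.
  by apply: contrapT => /eqP x0; apply: I0; exists x.
have [M [hM IM]] := exists_maximal_ideal (conj iI I1).
have satE N : is_maximal_ideal N -> saturation N I = [set 0].
  move=> hN; have pN := maximal_ideal_prime hN; rewrite I0; apply/seteqP; split.
    by move=> x /(domain_sat0 pN).
  exact: sat_sub.
by exists unit, (fun=> M); split=> // N hN _; exists tt; rewrite !satE.
Qed.

End FiniteCharacter.

End Domains.

(** * Tame domains are Mori *)

Section TameDomain.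
Variable D : idomainType.
Hypothesis tD : tame_ring D.
Implicit Types (I J M P N : set D) (a b p q x y z : D) (l : seq D).

(** Let b have the least order k in I, and let c in I be locally outside bD. If p / q sends b and c
    into D, then d = p b / q is in M, since otherwise c would be locally in bD. So d i is in
    M^(k+1), locally bM, for all i in I. *)
Lemma tame_two_generators M I : is_maximal_ideal M -> is_ideal I ->
    (exists2 a, I a & a != 0) ->
  exists b c, [/\ I b, I c & forall p q, q != 0 -> principal q (p * b) ->
    principal q (p * c) -> forall i, I i -> saturation M (principal q) (p * i)].
Proof.
move=> hM iI [a Ia a0]; have pM := maximal_ideal_prime hM; have iM := maximal_ideal hM.
have tM := tD.1 M hM.
have order x : x != 0 -> exists k, ideal_exp M k x /\ ~ ideal_exp M k.+1 x.
  by move=> x0; apply: (tame_order tM) => /(domain_sat0 pM)/eqP; exact/negP.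
have [k [[b [Ib Mb nb]] IM]] : exists k,
    (exists b, [/\ I b, ideal_exp M k b & ~ ideal_exp M k.+1 b]) /\ I `<=` ideal_exp M k.
  have [k [Mk nk]] := order a a0.
  pose Z j := `[< exists i, I i /\ ~ ideal_exp M j.+1 i >].
  have Zk : exists j, Z j by exists k; apply/asboolP; exists a.
  case: (ex_minnP Zk) => j /asboolP[b [Ib nb]] jmin; exists j; split.
    exists b; split=> //; case: j jmin {nb} => [|j] jmin; first by rewrite ideal_exp0.
    apply: contrapT => nMb; suff /jmin : Z j by rewrite ltnn.
    by apply/asboolP; exists b.
  move=> i Ii; case: j jmin {nb} => [|j] jmin; first by rewrite ideal_exp0.
  apply: contrapT => nMi; suff /jmin : Z j by rewrite ltnn.
  by apply/asboolP; exists i.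
have b0 : b != 0.
  by apply/eqP => b0; apply: nb; rewrite b0; apply: ideal0; exact: ideal_exp_ideal.
have [Ib'|/existsNP[c /not_implyP[Ic nc]]] := pselect (I `<=` saturation M (principal b)).
  exists b, b; split=> // p q q0 /principalP[r e] _ i /Ib'[s [ns /principalP[t f]]].
  exists s; split=> //; apply/principalP; exists (r * t).
  transitivity (p * (s * i)); first by ring.
  by rewrite f; transitivity (p * b * t); [ring|rewrite e; ring].
exists b, c; split=> // p q q0 /principalP[d ed] /principalP[e ee] i Ii.
have Md : M d.
  apply: contrapT => nd; apply: nc; exists d; split=> //; apply/principalP; exists e.
  apply: (mulfI q0); transitivity ((q * d) * c); first by ring.
  by rewrite -ed; transitivity ((p * c) * b); [ring|rewrite ee; ring].
have /(tame_exp_sub hM tM Mb nb)[s [ns [m Mm f]]] : ideal_exp M k.+1 (d * i).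
  by rewrite ideal_expS; apply: ideal_mul_mem => //; exact: IM.
exists s; split=> //; apply/principalP; exists m.
apply: (mulfI b0); transitivity (s * (p * b) * i); first by ring.
by rewrite ed; transitivity (q * (s * (d * i))); [ring|rewrite -f; ring].
Qed.

(** At a maximal ideal M containing a, the saturation of aD contains a power of M and so determines
    M. Thus there are finitely many such M; each contributes two generators, and a itself settles
    the other maximal ideals. *)
Lemma tame_v_finite : v_finite D.
Proof.
move=> I iI [a Ia a0].
have [nu|pr] := pselect (principal a 1).
  exists [:: a]; split=> [j|p q q0 h i Ii]; first by rewrite inE => /eqP->.
  have /principalP[r e] := nu.
  have -> : p * i = r * i * (p * a) by rewrite -[LHS]mulr1 e; ring.
  by apply: idealMl; [exact: principal_ideal|apply: h; rewrite /= mem_head].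
have [|T [N [hN hM]]] := tD.2 (principal a); first by split=> //; exact: principal_ideal.
have /choice[bc hbc] t : exists bc : D * D, [/\ I bc.1, I bc.2 & forall p q, q != 0 ->
    principal q (p * bc.1) -> principal q (p * bc.2) ->
    forall i, I i -> saturation (N t) (principal q) (p * i)].
  have [b [c h]] := tame_two_generators (hN t).1 iI (ex_intro2 _ _ a Ia a0).
  by exists (b, c).
exists (a :: [seq (bc t).1 | t <- enum T] ++ [seq (bc t).2 | t <- enum T]); split.
  move=> j; rewrite inE mem_cat => /orP[/eqP->//|/orP[]/mapP[t _ ->]].
    by case: (hbc t).
  by case: (hbc t).
move=> p q q0 h i Ii; apply: sat_cap => [|M mM qM]; first exact: principal_ideal.
have pM := maximal_ideal_prime mM; have iM := maximal_ideal mM.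
have [Ma|na] := pselect (M a); last first.
  exists a; split=> //; have := h a; rewrite /= mem_head => /(_ isT) hpa.
  have -> : a * (p * i) = i * (p * a) by ring.
  by apply: idealMl => //; exact: principal_ideal.
have aM : principal a `<=` M by exact: principal_sub.
have [t e] := hM M mM aM; have [mN aN] := hN t.
suff -> : M = N t.
  have [_ _] := hbc t; apply=> //; apply: h; rewrite /= inE mem_cat.
    by apply/orP; right; apply/orP; left; apply/mapP; exists t; rewrite ?mem_enum.
  by apply/orP; right; apply/orP; right; apply/mapP; exists t; rewrite ?mem_enum.
have [||k hk] := tame_exp_sub_sat mM (tD.1 M mM) (principal_ideal a) (x := a).
- by apply: sat_sub => //; exact: principal_mem.
- by move=> /(domain_sat0 pM)/eqP; exact/negP.
apply/esym/(maximal_sub_eq mM); [exact: maximal_ideal|exact: maximal_n1|].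
have pN := maximal_ideal_prime mN; apply: (prime_ideal_exp pN (n := k)).
by apply: subset_trans hk _; rewrite e; exact: sat_proper.
Qed.

End TameDomain.

(** * Local pseudo-valuation domains *)

Section PseudoValuationDomain.
Variables (S : idomainType) (N : set S).
Hypothesis lN : local_at N.
Let hN : is_maximal_ideal N := lN.1.
Let pN : is_prime_ideal N := maximal_ideal_prime hN.
Let iN : is_ideal N := maximal_ideal hN.

Lemma PVD_comparable : PVD S -> comparable_at N.
Proof.
move=> hS a b.
have [ab|/existsNP[m /not_implyP[Nm nm]]] := pselect (forall m, N m -> principal b (a * m)).
  by left=> m Nm; apply: sat_sub => //; exact: ab.
have [->|b0] := eqVneq b 0; [right|].
  by apply: ideal0; apply: sat_ideal => //; exact: scale_ideal.
have [a0|a0] := eqVneq a 0.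
  by case: nm; rewrite a0 mul0r; apply: ideal0; exact: principal_ideal.
have a0' : tofrac a != 0 by rewrite tofrac_eq0.
have b0' : tofrac b != 0 by rewrite tofrac_eq0.
(* The defining property is applied to m = (a m / b) (b / a). *)
have [|[n Nn e]|[n Nn e]] := hS N pN (tofrac (a * m) / tofrac b) (tofrac b / tofrac a).
- exists m => //; rewrite mulrA divfK // tofracM mulrAC mulfV ?mul1r //.
- case: nm; apply/principalP; exists n; apply/eqP; rewrite -tofrac_eq [tofrac (b * n)]tofracM e.
  by rewrite mulrCA mulfV ?mulr1.
right; apply: sat_sub => //; exists n => //.
by apply/eqP; rewrite -tofrac_eq tofracM e mulrCA mulfV ?mulr1.
Qed.

Lemma tame_PVD : tame_at N -> PVD S.
Proof.
move=> tN P hP x y.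
have PN : P `<=` N by exact: local_proper_prime.
have [->|P0] := tame_prime hN tN hP PN; last first.
  move=> [z /P0 /(domain_sat0 pN) ->]; rewrite rmorph0 => /esym/eqP.
  have P00 := ideal0 (prime_ideal_ideal hP).
  by rewrite mulf_eq0 => /orP[]/eqP->; [left|right]; exists 0; rewrite // rmorph0.
(* For u = p / q outside N, the inverse of u multiplies N into S: by comparability either qN lies in
   pS, or p is in qN, which would put u in N. Applied to both factors of x y in N, this shows that
   they lie in S. *)
have inverse u : ~ (@tofrac S @` N) u -> u != 0 /\
    forall m, N m -> exists r, tofrac m = u * tofrac r.
  move=> nu; have u0 : u != 0.
    by apply/eqP => u0; apply: nu; rewrite u0; exists 0; rewrite ?rmorph0 //; exact: ideal0.
  split=> // m Nm; have [p [q [q0 e]]] := fraction_quotient u.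
  have q0' : tofrac q != 0 by rewrite tofrac_eq0.
  have ip := principal_ideal p; have iq := scale_ideal q iN.
  have [h|/(local_sat lN iq)[n Nn en]] := tame_comparable hN tN q p; last first.
    case: nu; exists n => //; apply: (mulIf q0').
    by rewrite e -en tofracM mulrC.
  have /principalP[r er] := local_sat lN ip (h m Nm).
  exists r; apply: (mulIf q0'); rewrite mulrAC e -!tofracM -er.
  by rewrite mulrC.
move=> [m Nm e]; apply: contrapT => /not_orP[nx ny].
have [x0 hx] := inverse x nx; have [y0 hy] := inverse y ny.
have [r er] := hx m Nm; have [r' er'] := hy m Nm.
have exr : y = tofrac r by apply: (mulfI x0); rewrite -er e.
have eyr : x = tofrac r' by apply: (mulfI y0); rewrite -er' e mulrC.
have : N (r' * r).
  suff -> : r' * r = m by [].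
  by apply/eqP; rewrite -tofrac_eq tofracM -exr -eyr e.
by move=> /(prime_mulP pN)[h|h]; [apply: nx; exists r'|apply: ny; exists r].
Qed.

End PseudoValuationDomain.

Lemma LPVD_comparable (D : idomainType) : LPVD D ->
  forall M : set D, is_maximal_ideal M -> comparable_at M.
Proof.
move=> hD M hM; have li := loc_of_local_iso (maximal_ideal_prime hM).
apply: (liso_comparable li hM); apply: PVD_comparable; first exact: loc_local.
exact: hD.
Qed.

Lemma tame_LPVD (D : idomainType) : (forall M : set D, is_maximal_ideal M -> tame_at M) -> LPVD D.
Proof.
move=> hD M hM; have li := loc_of_local_iso (maximal_ideal_prime hM).
apply: (tame_PVD (loc_local (maximal_ideal_prime hM))).
exact: (liso_tame' li hM (hD M hM)).
Qed.

Lemma Mori_LPVD_tame_ring (D : idomainType) : Mori D -> LPVD D -> tame_ring D.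
Proof.
move=> /Mori_v_finite vD /LPVD_comparable cD.
have tD M (hM : is_maximal_ideal M) : tame_at M := v_finite_tame vD cD hM.
by split=> // I; exact: v_finite_finitely_saturated.
Qed.

(** * Atomic pseudo-valuation rings *)

Section AtomicPVR.
Variables (R : comNzRingType) (M : set R).
Hypothesis lM : local_at M.
Let hM : is_maximal_ideal M := lM.1.
Let pM : is_prime_ideal M := maximal_ideal_prime hM.
Let iM : is_ideal M := maximal_ideal hM.
Implicit Types (x y a : R).

Lemma local_noninvertible x : ~ is_invertible x -> M x.
Proof. by move=> nx; apply: contrapT => /lM.2. Qed.

Lemma local_invertible x : is_invertible x -> ~ M x.
Proof. by move=> [y e] Mx; apply: (prime_n1 pM); rewrite -e; exact: idealMr. Qed.

Lemma local_sat0 x : saturation M [set 0] x -> x = 0.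
Proof. by move/(local_sat lM (@is_ideal0 R)). Qed.

(** An element of M^2 is b c with b and c in M, up to a unit. Irreducibility makes a divide one of
    the factors, so a is in aM and vanishes. *)
Lemma irreducible_nexp2 a : comparable_at M -> a != 0 -> is_irreducible a -> ~ ideal_exp M 2 a.
Proof.
move=> cM /eqP a0 [na hirr] /(comparable_exp2 hM cM)[s [b [c [ns Mb Mc e]]]].
have [t et] := lM.2 s ns; apply: a0; apply: local_sat0.
have ea : a = (t * b) * c by rewrite -mulrA -e mulrA [t * s]mulrC et mul1r.
have [h|h] := hirr _ _ ea.
  have /principalP[r er] : principal a (t * b) by rewrite h; exact: principal_mem.
  apply: (sat0_fix pM (prime_n1 pM) (idealMl r iM Mc)).
  by rewrite mul1r {1}ea er; ring.
have /principalP[r er] : principal a c by rewrite h; exact: principal_mem.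
apply: (sat0_fix pM (prime_n1 pM) (idealMl (t * r) iM Mb)).
by rewrite mul1r {1}ea er; ring.
Qed.

(** Like [exp_sub_sat_pow], but with different elements outside M^2 in place of the powers of one,
    as needed for a product of atoms. *)
Lemma prod_exp_sub (l : seq R) : comparable_at M ->
  (forall a, a \in l -> M a /\ ~ ideal_exp M 2 a) ->
  ideal_exp M (size l).+1 `<=` saturation M [set \prod_(a <- l) a * m | m in M].
Proof.
move=> cM; elim: l => [|a l IH] h.
  rewrite ideal_exp1 // => m Mm; apply: sat_sub => //; exists m => //.
  by rewrite big_nil mul1r.
have [Ma na] := h a (mem_head _ _).
have {}IH := IH (fun b bl => h b (mem_behead (s := a :: l) bl)).
rewrite /= ideal_expS; apply: ideal_mul_sub.
  by apply: sat_ideal => //; exact: scale_ideal.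
move=> u v Mu /IH[s [ns [m Mm e]]].
have h2 := comparable_exp2_sub hM cM Ma na.
have [|t [nt [m' Mm' f]]] := @exp_sub_sat_pow _ _ hM _ na h2 1 (u * m).
  by rewrite ideal_exp2 //; exact: ideal_mul_mem.
exists (t * s); split; first exact: prime_nmul.
exists m' => //; rewrite big_cons; transitivity ((\prod_(b <- l) b) * (a ^+ 1 * m')).
  by rewrite expr1; ring.
by rewrite f; transitivity (t * u * (\prod_(b <- l) b * m)); [ring|rewrite e; ring].
Qed.

(** If x is a product of l atoms, all outside M^2, then M^(l+1) is inside xM. An element divisible
    l+1 times lies in M^(l+1), hence in its own multiple xM. *)
Lemma atomic_tame : atomic R -> comparable_at M -> tame_at M.
Proof.
move=> aR cM; apply: comparable_tame => // x dx.
have [->|x0] := eqVneq x 0; first exact: (ideal0 (sat0_ideal pM)).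
have Mx : M x by exact: (divisible_at_mem hM dx).
have [|l [hl ex]] := aR x x0; first by move=> /local_invertible.
have hl' a : a \in l -> M a /\ ~ ideal_exp M 2 a.
  move=> al; have [na _] := hl a al; split; first exact: local_noninvertible.
  apply: irreducible_nexp2 => //; last exact: hl.
  by apply: contra_neq x0 => a0; rewrite ex (big_rem a) //= a0 mul0r.
have [s [w [ns sw Mw e]]] := dx (size l).
have Mexp : ideal_exp M (size l).+1 (s * x).
  rewrite e -sw; elim: w Mw {sw e} => [|b w IH] Mw; first by rewrite ideal_exp0.
  rewrite big_cons ideal_expS; apply: ideal_mul_mem; first by apply: Mw; rewrite mem_head.
  by apply: IH => c cw; apply: Mw; rewrite inE cw orbT.
have [t [nt [m Mm f]]] := prod_exp_sub cM hl' Mexp.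
apply: (sat0_fix pM (prime_nmul pM nt ns) Mm).
by rewrite -mulrA -f -ex mulrC.
Qed.

Lemma local_tame_ring : tame_at M -> tame_ring R.
Proof.
move=> tM; split=> [N hN|I hI]; first by rewrite (local_unique lM hN).
exists unit, (fun=> M); split=> [_|N hN _]; first by split=> //; exact: local_sub.
by exists tt; rewrite (local_unique lM hN).
Qed.

(** Elements of M outside M^2 are irreducible. An element of order k+1 is y^k m up to a unit, and
    its order forces m outside M^2. *)
Lemma local_tame_atomic : tame_at M -> atomic R.
Proof.
move=> tM a a0 na; have Ma := local_noninvertible na.
have [|k [Mk nk]] := tame_order tM (x := a).
  by move/local_sat0; apply/eqP.
have irr b : M b -> ~ ideal_exp M 2 b -> is_irreducible b.
  move=> Mb nb; split; first by move/local_invertible.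
  move=> c d e.
  have unitP u v : is_invertible u -> b = v * u -> principal b = principal v.
    move=> [w ew] ->; apply/seteqP; split=> z /principalP[t ->]; apply/principalP.
      by exists (u * t); rewrite mulrA.
    by exists (w * t); transitivity (u * w * (v * t)); [rewrite ew mul1r|ring].
  have [/lM.2 ic|/contrapT Mc] := pselect (~ M c).
    by right; apply: (unitP c) => //; rewrite mulrC.
  have [/lM.2 id|/contrapT Md] := pselect (~ M d).
    by left; apply: (unitP d).
  by case: nb; rewrite e ideal_exp2 //; exact: ideal_mul_mem.
case: k Mk nk => [|k] Mk nk; first by case: nk; rewrite ideal_exp1.
have [MM|/existsNP[y /not_implyP[My ny]]] := pselect (M `<=` ideal_exp M 2).
  by case: nk; exact: idempotent_exp.
have [s [ns [m Mm e]]] := exp_sub_sat_pow hM ny (tM.1 y My ny) Mk.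
have [t et] := lM.2 s ns.
exists (t * m :: nseq k y); split; last first.
  rewrite big_cons big_nseq iter_mulr_1 -mulrA [m * _]mulrC e mulrA [t * s]mulrC et.
  by rewrite mul1r.
move=> x; rewrite inE mem_nseq => /orP[/eqP->|/andP[_ /eqP->]]; last exact: irr.
apply: irr; first exact: idealMl.
move=> h; apply: nk; rewrite -[a]mul1r -et [s * t]mulrC -mulrA -e mulrCA.
by rewrite -addn2 ideal_expD //; apply: ideal_mul_mem => //; exact: ideal_exp_mem.
Qed.

End AtomicPVR.

(** * Products of rings *)

Section Surjection.
Variables (R S : comNzRingType) (f : {rmorphism R -> S}).
Hypothesis fs : forall a, exists x, f x = a.

Lemma preimage_ideal (J : set S) : is_ideal J -> is_ideal (f @^-1` J).
Proof.
move=> iJ; split; rewrite /preimage /=; first by rewrite rmorph0; exact: ideal0.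
- by move=> x y Jx Jy; rewrite rmorphD; exact: idealD.
- by move=> a x Jx; rewrite rmorphM; exact: idealMl.
Qed.

Lemma preimage_proper (J : set S) : is_proper_ideal J -> is_proper_ideal (f @^-1` J).
Proof.
by move=> [iJ J1]; split; [exact: preimage_ideal|rewrite /preimage /= rmorph1].
Qed.

Lemma image_ideal (I : set R) : is_ideal I -> is_ideal (f @` I).
Proof.
move=> iI; split.
- by exists 0; [exact: ideal0|exact: rmorph0].
- by move=> _ _ [x Ix <-] [y Iy <-]; exists (x + y); [exact: idealD|exact: rmorphD].
- move=> a _ [x Ix <-]; have [y <-] := fs a.
  by exists (y * x); [exact: idealMl|exact: rmorphM].
Qed.

Lemma image_preimage (J : set S) : f @` (f @^-1` J) = J.
Proof.
apply/seteqP; split=> [_ [x Jx <-] //|a Ja].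
by have [x e] := fs a; exists x; rewrite // /preimage /= e.
Qed.

Lemma preimage_image (I : set R) : is_ideal I -> (forall x, f x = 0 -> I x) ->
  f @^-1` (f @` I) = I.
Proof.
move=> iI kI; apply/seteqP; split=> [x [y Iy e]|x Ix]; last by exists x.
rewrite -[x](subrK y); apply: idealD => //; apply: kI.
by rewrite rmorphB e subrr.
Qed.

Lemma preimage_maximal (N : set S) : is_maximal_ideal N -> is_maximal_ideal (f @^-1` N).
Proof.
move=> [pN hN]; split; first exact: preimage_proper.
move=> I [iI I1] NI.
have kI x : f x = 0 -> I x.
  by move=> e; apply: NI; rewrite /preimage /= e; apply: ideal0; case: pN.
rewrite -[I](preimage_image iI kI); congr (f @^-1` _); apply: hN.
  split; first exact: image_ideal.
  by rewrite -(rmorph1 f) => h; apply: I1; rewrite -(preimage_image iI kI).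
by rewrite -[X in X `<=` _]image_preimage => _ [x /NI Ix <-]; exists x.
Qed.

Lemma image_maximal (M : set R) : is_maximal_ideal M -> (forall x, f x = 0 -> M x) ->
  is_maximal_ideal (f @` M).
Proof.
move=> hM kM; have iM := maximal_ideal hM; split.
  split; first exact: image_ideal.
  rewrite -(rmorph1 f) => h; apply: (maximal_n1 hM).
  by rewrite -(preimage_image iM kM).
move=> J [iJ J1] MJ; rewrite -(image_preimage J).
rewrite (maximal_sub_eq hM (preimage_ideal iJ)) //.
  by rewrite /preimage /= rmorph1.
by move=> x Mx; apply: MJ; exists x.
Qed.

Lemma surjection_local_iso (N : set S) : is_maximal_ideal N ->
  (forall x, f x = 0 -> saturation (f @^-1` N) [set 0] x) -> local_iso f (f @^-1` N) N.
Proof.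
move=> hN kN; have hM := preimage_maximal hN; split=> //; first exact: maximal_ideal_prime.
move=> a; have [x e] := fs a; exists 1, x; rewrite rmorph1 mul1r e; split=> //.
exact: maximal_n1.
Qed.

Lemma extends_image (M : set R) (I : set R) : is_prime_ideal M -> extends_to f M I (f @` I).
Proof.
move=> pM; split=> [x Ix|_ [x Ix <-]]; first by exists x.
by exists 1, x; rewrite rmorph1 mul1r; split=> //; exact: prime_n1.
Qed.

Lemma finitely_saturated_image (I : set S) : is_ideal I ->
  (forall M, is_maximal_ideal M -> (forall x, f x = 0 -> M x) ->
    forall x, f x = 0 -> saturation M [set 0] x) ->
  finitely_saturated (f @^-1` I) -> finitely_saturated I.
Proof.
move=> iI hK [T [N [hN hT]]]; exists T, (fun t => f @` (N t)).
have iJ := preimage_ideal iI.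
have kI x : f x = 0 -> (f @^-1` I) x by move=> e; rewrite /preimage /= e; exact: ideal0.
have kN t x : f x = 0 -> N t x by move=> /kI; apply: (hN t).2.
have mN t := (hN t).1; have iN t := maximal_ideal (mN t).
have satE (M : set S) x : is_maximal_ideal M -> I `<=` M ->
    saturation (f @^-1` M) (f @^-1` I) x <-> saturation M I (f x).
  move=> hM IM; have hM' := preimage_maximal hM.
  have li : local_iso f (f @^-1` M) M.
    apply: surjection_local_iso => //; apply: hK => // y /kI; exact: IM.
  apply: (liso_sat li) => //; rewrite -[X in extends_to _ _ _ X]image_preimage.
  by apply: extends_image; exact: maximal_ideal_prime.
split=> [t|M hM IM].
  split; first by apply: image_maximal => // x; exact: kN.
  rewrite -[X in X `<=` _]image_preimage => _ [x Ix <-]; exists x => //.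
  exact: (hN t).2.
have [t e] := hT _ (preimage_maximal hM) (fun x => IM (f x)).
exists t; apply/seteqP; split=> a; have [x <-] := fs a.
  move=> /(satE M x hM IM); rewrite e -{1}(preimage_image (iN t) (kN t)).
  apply: (iffLR (satE _ x _ _)); first by apply: image_maximal => // y; exact: kN.
  rewrite -[X in X `<=` _]image_preimage => _ [y Iy <-]; exists y => //.
  exact: (hN t).2.
move=> h; apply/(satE M x hM IM); rewrite e -{1}(preimage_image (iN t) (kN t)).
apply/satE => //; first by apply: image_maximal => // y; exact: kN.
rewrite -[X in X `<=` _]image_preimage => _ [y Iy <-]; exists y => //.
exact: (hN t).2.
Qed.

End Surjection.

Section Product.
Variables (R : comNzRingType) (r : nat) (R_ : 'I_r -> comNzRingType).
Variable f : forall i, {rmorphism R -> R_ i}.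
Hypothesis fbij : bijective (fun (x : R) (i : 'I_r) => f i x).

Lemma product_lift (v : forall i, R_ i) : exists x, forall i, f i x = v i.
Proof.
case: fbij => g _ gK; exists (g v) => i.
exact: (congr1 (fun w : forall i, R_ i => w i) (gK v)).
Qed.

Lemma product_inj x y : (forall i, f i x = f i y) -> x = y.
Proof. by move=> e; apply: (bij_inj fbij); exact: functional_extensionality_dep. Qed.

Lemma product_surj i (a : R_ i) : exists x, f i x = a.
Proof.
pose v j : R_ j := if i =P j is ReflectT e then ecast k (R_ k) e a else 0.
have [x hx] := product_lift v; exists x; rewrite hx /v.
by case: eqP => // e; rewrite (eq_axiomK e).
Qed.

Lemma product_idempotent i : exists e, f i e = 1 /\ forall j, j != i -> f j e = 0.
Proof.
have [e he] := product_lift (fun j => (j == i)%:R).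
by exists e; split=> [|j /negbTE ji]; rewrite he ?eqxx ?ji.
Qed.

Lemma product_local_iso i (N : set (R_ i)) : is_maximal_ideal N ->
  local_iso (f i) (f i @^-1` N) N.
Proof.
move=> hN; apply: surjection_local_iso => //; first exact: product_surj.
move=> x fx; have [e [ei ej]] := product_idempotent i; exists e; split.
  by rewrite /preimage /= ei; exact: maximal_n1.
apply: product_inj => j; rewrite rmorphM rmorph0.
by have [->|/ej->] := eqVneq j i; [rewrite fx mulr0|rewrite mul0r].
Qed.

Lemma product_maximal (M : set R) : is_maximal_ideal M ->
  exists i (N : set (R_ i)), is_maximal_ideal N /\ M = f i @^-1` N.
Proof.
move=> hM; have iM := maximal_ideal hM.
have /choice[e he] := product_idempotent.
have [i ni] : exists i, ~ M (e i).
  apply: contrapT => h; apply: (maximal_n1 hM).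
  have -> : 1 = \sum_i e i.
    apply: product_inj => j; rewrite rmorph1 rmorph_sum (bigD1 j) //= (he j).1 big1 ?addr0 //.
    by move=> i ij; apply: (he i).2; rewrite eq_sym.
  apply: ideal_sum => // i _; apply: contrapT => ni; apply: h; by exists i.
have kM x : f i x = 0 -> M x.
  move=> fx; have /(prime_mulP (maximal_ideal_prime hM))[] // : M (e i * x).
  suff -> : e i * x = 0 by exact: ideal0.
  apply: product_inj => j; rewrite rmorphM rmorph0.
  by have [->|/(he i).2->] := eqVneq j i; [rewrite fx mulr0|rewrite mul0r].
exists i, (f i @` M); split; last by rewrite preimage_image.
by apply: image_maximal => //; exact: product_surj.
Qed.

Lemma product_tame_ring : (forall i, tame_ring (R_ i)) -> tame_ring R.
Proof.
move=> tR; split=> [M hM|I [iI I1]].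
  have [i [N [hN e]]] := product_maximal hM.
  move: hM; rewrite e => hM; apply: (liso_tame (product_local_iso hN) hM).
  exact: (tR i).1.
have iI' i : is_ideal (f i @` I) by apply: image_ideal => //; exact: product_surj.
(* The image of I in a factor may be the whole ring; no maximal ideal contains it then, and the
   empty family works. *)
have fin i : finitely_saturated (f i @` I).
  have [h1|n1] := pselect ((f i @` I) 1); last exact: (tR i).2.
  exists void, (fun=> set0); split=> [[]|M hM IM].
  by case: (maximal_n1 hM); exact: IM.
pose T i := projT1 (cid (fin i)); pose N i := projT1 (cid (projT2 (cid (fin i)))).
have hN i : _ := projT2 (cid (projT2 (cid (fin i)))).
exists {i : 'I_r & T i}, (fun t => f (tag t) @^-1` (N (tag t) (tagged t))).
have sat_pre i (L : set (R_ i)) : is_maximal_ideal L ->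
    saturation (f i @^-1` L) I = f i @^-1` (saturation L (f i @` I)).
  move=> hL; have hL' := preimage_maximal (@product_surj i) hL.
  have E := @extends_image _ _ (f i) _ I (maximal_ideal_prime hL').
  apply/seteqP; split=> x; first by move/(liso_sat (product_local_iso hL) _ iI E).
  by move=> h; apply/(liso_sat (product_local_iso hL) _ iI E).
split=> [[i t]|M hM IM] /=.
  have [mN IN] := (hN i).1 t; split; first by apply: preimage_maximal => //; exact: product_surj.
  by move=> x Ix; apply: IN; exists x.
have [i [L [hL e]]] := product_maximal hM.
have IL : f i @` I `<=` L by move=> _ [x /IM + <-]; rewrite e.
have [t et] := (hN i).2 L hL IL; exists (Tagged T t).
rewrite e sat_pre // et sat_pre //.
by case: ((hN i).1 t).
Qed.

End Product.

Section ToDomain.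
Variables (S : comNzRingType) (hS : forall x y : S, x * y = 0 -> x = 0 \/ y = 0).

(* The dependence on hS keeps the instances below from applying to S itself. *)
Definition to_domain : Type := let _ := hS in S.

HB.instance Definition _ := GRing.ComNzRing.on to_domain.

Definition domain_unit : {pred to_domain} := fun a => `[< exists b : to_domain, b * a = 1 >].

Definition domain_inv (a : to_domain) : to_domain :=
  if pselect (exists b : to_domain, b * a = 1) is left h then projT1 (cid h) else a.

Lemma domain_mulV : {in domain_unit, left_inverse 1 domain_inv *%R}.
Proof.
move=> a /asboolP h; rewrite /domain_inv.
by case: pselect => // h'; case: (cid h').
Qed.

Lemma domain_unitP (a b : to_domain) : b * a = 1 -> domain_unit a.
Proof. by move=> e; apply/asboolP; exists b. Qed.

Lemma domain_inv_out : {in [predC domain_unit], domain_inv =1 id}.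
Proof. by move=> a /asboolP h; rewrite /domain_inv; case: pselect. Qed.

HB.instance Definition _ := GRing.ComNzRing_hasMulInverse.Build to_domain
  domain_mulV domain_unitP domain_inv_out.

Lemma domain_integral (a b : to_domain) : a * b = 0 -> (a == 0) || (b == 0).
Proof. by move=> /hS[]->; rewrite eqxx ?orbT. Qed.

HB.instance Definition _ := GRing.ComUnitRing_isIntegral.Build to_domain domain_integral.

Lemma tame_ring_Mori_LPVD : tame_ring S -> Mori_LPVD S.
Proof.
move=> tS; have tD : tame_ring to_domain by exact: tS.
exists to_domain; split.
- by exists (idfun : {rmorphism S -> S}); exists idfun.
- exact/v_finite_Mori/tame_v_finite.
- exact: tame_LPVD tD.1.
Qed.

End ToDomain.

(** An isomorphism is treated as a product with a single factor. *)
Lemma Mori_LPVD_tame (R : comNzRingType) : Mori_LPVD R -> tame_ring R.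
Proof.
move=> [D [[f fbij] mD lD]].
apply: (@product_tame_ring R 1 (fun=> D) (fun=> f)); last first.
  by move=> _; exact: Mori_LPVD_tame_ring.
have [g fK gK] := fbij; exists (fun v => g (v ord0)) => [x|v]; first exact: fK.
by apply/funext => i; rewrite gK (ord1 i).
Qed.

Lemma atomic_PVR_tame (R : comNzRingType) : atomic R -> PVR R -> tame_ring R.
Proof.
move=> aR /PVR_local[M [lM cM]]; apply: (local_tame_ring lM).
exact: atomic_tame.
Qed.

(** * Decomposition of a tame ring *)

Section Decomposition.
Variables (R : comNzRingType) (M : set R) (hM : is_maximal_ideal M).
Hypothesis tR : tame_ring R.
Let pM : is_prime_ideal M := maximal_ideal_prime hM.
Let K := saturation M [set 0].

Lemma zero_sub : [set 0] `<=` M.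
Proof. by move=> _ ->; apply: ideal0; exact: maximal_ideal. Qed.

Lemma kernel_proper : is_proper_ideal K.
Proof.
split; first exact: sat0_ideal.
by move=> /(sat_proper pM zero_sub); exact: prime_n1.
Qed.

Let S := quotient_ring kernel_proper.
Let f : {rmorphism R -> S} := quotient_map kernel_proper.

Let fs a : exists x, f x = a. Proof. exact: quotient_map_surj. Qed.

Let fK x : f x = 0 <-> K x. Proof. exact: quotient_map_eq0. Qed.

(** If L contains K, then K and the saturation of 0 at L are not comaximal, hence equal. So the
    quotient by K keeps the localizations of R at the maximal ideals above K. *)
Lemma kernel_local L : is_maximal_ideal L -> (forall x, f x = 0 -> L x) ->
  forall x, f x = 0 -> saturation L [set 0] x.
Proof.
move=> hL kL; have KL : K `<=` L by move=> x /fK; exact: kL.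
have [e|[a [b [Ka Lb e]]]] := tame_comaximal tR.1 (@is_ideal0 R) hM hL zero_sub
  (fun x => KL x \o @sat_sub _ _ pM _ x).
  by move=> x /fK; rewrite /K e.
case: (maximal_n1 hL); rewrite -e; apply: idealD; first exact: maximal_ideal.
  exact: KL.
apply: sat_proper Lb; first exact: maximal_ideal_prime.
by move=> _ ->; apply: ideal0; exact: maximal_ideal.
Qed.

Lemma quotient_tame_ring : tame_ring S.
Proof.
split=> [N hN|I hI].
  have hL := preimage_maximal fs hN.
  have li : local_iso f (f @^-1` N) N.
    apply: surjection_local_iso => //; apply: kernel_local => // x e.
    by rewrite /preimage /= e; apply: ideal0; exact: maximal_ideal.
  exact: (liso_tame' li hL (tR.1 _ hL)).
apply: (finitely_saturated_image fs); first by case: hI.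
  exact: kernel_local.
by apply: tR.2; exact: preimage_proper.
Qed.

(** If K contains a power of M, the quotient is local with a nilpotent maximal ideal; otherwise K is
    prime and the quotient is a domain. *)
Lemma quotient_class : (atomic S /\ PVR S) \/ Mori_LPVD S.
Proof.
have kM x : f x = 0 -> M x by move=> /fK; apply: sat_proper => //; exact: zero_sub.
have [[k Mk]|[_ pK _]] := tame_sat_cases hM (tR.1 M hM) (@is_ideal0 R); [left|right].
  have lN : local_at (f @` M).
    split; first exact: (image_maximal fs hM kM).
    move=> a na; have [x e] := fs a.
    have nx : ~ M x by move=> Mx; apply: na; exists x.
    have [t [m [Mm em]]] := maximal_exp_coprime k hM nx.
    exists (f t); rewrite -e mulrC -rmorphM -[f (t * x)]addr0.
    have <- : f m = 0 by apply/fK; exact: Mk.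
    by rewrite -rmorphD em rmorph1.
  have tN := quotient_tame_ring.1 _ lN.1.
  split; first exact: (local_tame_atomic lN tN).
  by apply/PVR_local; exists (f @` M); split=> //; exact: (tame_comparable lN.1 tN).
apply: tame_ring_Mori_LPVD quotient_tame_ring => a b.
have [x <-] := fs a; have [y <-] := fs b; rewrite -rmorphM => /fK/(prime_mulP pK).
by move=> [/fK|/fK]; [left|right].
Qed.

End Decomposition.

Lemma tame_ring_decomposition (R : comNzRingType) : tame_ring R ->
  exists (r : nat) (R_ : 'I_r -> comNzRingType),
    [/\ (0 < r)%N, isomorphic_to_product R R_ &
        forall i : 'I_r, (atomic (R_ i) /\ PVR (R_ i)) \/ Mori_LPVD (R_ i)].
Proof.
move=> tR; have h0 : is_proper_ideal [set (0 : R)].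
  by split; [exact: is_ideal0|move=> /= /eqP; rewrite oner_eq0].
have [n [N [hN N0 hM dN]]] := finitely_saturated_reduced (tR.2 _ h0).
exists n, (fun i => quotient_ring (kernel_proper (hN i))); split.
- have [M [mM M0]] := exists_maximal_ideal h0; have [i _] := hM M mM M0.
  by apply: leq_ltn_trans (ltn_ord i).
- exists (fun i => quotient_map (kernel_proper (hN i))).
  pose K i := saturation (N i) [set (0 : R)].
  have iK i : is_ideal (K i) by apply: sat0_ideal; exact: maximal_ideal_prime.
  have [|e he] := comaximal_orthogonal iK.
    by move=> i j /dN ij; case: (tame_comaximal tR.1 h0.1 (hN i) (hN j) (N0 i) (N0 j)).
  have /choice[g hg] : forall v : (forall i, quotient_ring (kernel_proper (hN i))),
      exists x, forall i, quotient_map (kernel_proper (hN i)) x = v i.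
    move=> v; pose w i := projT1 (cid (quotient_map_surj (v i))).
    have hw i : quotient_map _ (w i) = v i := projT2 (cid (quotient_map_surj (v i))).
    exists (\sum_i e i * w i) => i; rewrite -hw; apply/eqP; rewrite -subr_eq0 -rmorphB.
    apply/eqP/quotient_map_eq0; rewrite (bigD1 i) //= addrAC.
    apply: (idealD (iK i)).
      have -> : e i * w i - w i = - ((1 - e i) * w i) by ring.
      by apply: (idealN (iK i)); apply: (idealMr _ (iK i)); case: (he i).
    elim/big_ind: _ => [|x y|j ji]; [exact: ideal0|exact: idealD|].
    by apply: (idealMr _ (iK i)); apply: (he j).2; rewrite eq_sym.
  exists g => [x|v]; last by apply: functional_extensionality_dep => i; exact: hg.
  have : (\bigcap_i K i) (g (fun i => quotient_map (kernel_proper (hN i)) x) - x).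
    move=> i _; apply/(quotient_map_eq0 (kernel_proper (hN i))).
    by apply/eqP; rewrite rmorphB subr_eq0; apply/eqP; exact: hg.
  by rewrite -(finitely_saturated_cap h0.1 hN hM) => /eqP; rewrite subr_eq0 => /eqP.
- by move=> i; exact: quotient_class.
Qed.

Theorem theorem32 (R : comNzRingType) :
  [<->
    TAF_ring R;
    strongly_Laskerian R /\
      (forall M : set R, is_maximal_ideal M ->
       forall Q : set R, is_primary_to M Q ->
         comparable_sets Q (ideal_exp M 2));
    strongly_Laskerian R /\ LPVR R;
    finite_absorbing R /\ LPVR R;
    exists (r : nat) (R_ : 'I_r -> comNzRingType),
      [/\ (0 < r)%N, isomorphic_to_product R R_ &
          forall i : 'I_r, (atomic (R_ i) /\ PVR (R_ i)) \/ Mori_LPVD (R_ i)] ].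
Proof.
tfae.
- move=> /TAF_tame_ring tR; split; first exact: tame_ring_strongly_Laskerian.
  by move=> M hM Q; apply: tame_primary_comparable => //; exact: tR.1.
- move=> [hL hc]; split=> //; apply/LPVR_comparable => M hM.
  by apply: tame_comparable => //; apply: Laskerian_tame => //; exact: hc.
- by move=> [hL hp]; split=> //; exact: strongly_Laskerian_finite_absorbing.
- move=> [hF /LPVR_comparable cR]; apply: tame_ring_decomposition.
  have tR M (hM : is_maximal_ideal M) : tame_at M := finite_absorbing_tame hM (cR M hM) hF.
  by split=> // I hI; have [n] := hF I hI; exact: absorbing_finitely_saturated.
- move=> [r [R_ [_ [f fbij] hR]]]; apply: tame_ring_TAF; apply: (product_tame_ring fbij) => i.
  by have [[]|] := hR i; [exact: atomic_PVR_tame|exact: Mori_LPVD_tame].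
Qed.
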